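(* Let $G$ be a compactly generated locally compact group with compact symmetric generating set $S$, fix $M>1$, and let $\mathcal R$ be the set of equivalence classes of representations $(\pi,E)$ of $G$ on separable Banach spaces with $\sup_{g\in S}\|\pi(g)\|\le M$. Let $\mathcal F\subset\mathcal R$. Assume that $\mathcal C_{\mathcal F}(G)$ has a Kazhdan projection and that $H^1(G,\pi)=0$ for all $(\pi,E)\in\mathcal F$. Then there is a strong neighbourhood $\mathcal F'\subset\mathcal R$ of $\mathcal F$ such that $\mathcal C_{\mathcal F'}(G)$ has a Kazhdan projection and $H^1(G,\pi)=0$ for all $(\pi,E)\in\mathcal F'$.
   Context: Standing assumptions: $G$ is compactly generated, locally compact, separable and infinite; $S$ is a compact symmetric generating set containing the identity; $\int f$ denotes integration against a left Haar measure. A representation $(\pi,E)$ is a strongly continuous homomorphism $\pi$ from $G$ to the bounded invertible operators on a Banach space $E$; two are equivalent if there is a $G$-equivariant surjective linear isometry between the spaces. $\pi(f)x=\int f(g)\pi(g)x\,dg$ for $f\in C_c(G)$. $H^1(G,\pi)=0$ means that every continuous affine action of $G$ on $E$ with linear part $\pi$ (i.e. $\sigma(g)x=\pi(g)x+b(g)$ with $b:G\to E$ continuous, $b(gh)=b(g)+\pi(g)b(h)$) has a fixed point. $\mathcal C_{\mathcal F}(G)$ is the (Hausdorff) completion of $C_c(G)$ for $\|f\|_{\mathcal F}=\sup_{(\pi,E)\in\mathcal F}\|\pi(f)\|_{B(E)}$. A Kazhdan projection in it is an idempotent $p$ in the closure of $\{f\in C_c(G):\int f=1\}$ such that $\pi(p)$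 is a projection onto $E^\pi=\{x:\pi(g)x=x\ \forall g\}$ for every $(\pi,E)\in\mathcal F$. Topology on $\mathcal R$: a basis is given by the sets $W_{x_1,\dots,x_n,Q,\varepsilon}(\pi,E)$, for $(\pi,E)\in\mathcal R$, $x_1,\dots,x_n\in E$, $Q\subset G$ compact, $\varepsilon>0$, consisting of all $(\pi',E')\in\mathcal R$ for which there exist $x_1',\dots,x_n'\in E'$ with $$\sup_{f_1,\dots,f_n}\Big|\big\|\sum_k\pi'(f_k)x_k'\big\|-\big\|\sum_k\pi(f_k)x_k\big\|\Big|<\varepsilon,$$ the supremum being over $f_1,\dots,f_n\in C_c(G)$ supported in $Q$ with $\|f_k\|_{L_1}\le1$. Strong neighbourhood: for subsets $A,B$ of a topological space $X$, $B$ is a strong neighbourhood of $A$ if for every net $(x_i)_{i\in I}$ in $X$ all of whose accumulation points are contained in $A$, there is $i_0$ with $x_i\in B$ for all $i\ge i_0$. (A strong neighbourhood of $A$ need not contain $A$.) *)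

(* Defs.v *)
From HB Require Import structures.
From mathcomp Require Import all_boot all_order all_algebra.
From mathcomp Require Import all_classical all_reals all_analysis.
From mathcomp Require Import complex.
Set Implicit Arguments.
Unset Strict Implicit.
Unset Printing Implicit Defensive.
Import Order.TTheory GRing.Theory Num.Theory.
Import numFieldNormedType.Exports.
Local Open Scope classical_set_scope.
Local Open Scope ring_scope.

HB.mixin Record isTopologicalGroup G of PointedTopological G & Group G := {
  mulg_continuous : continuous (fun z : G * G => (z.1 * z.2)%g) ;
  invg_continuous : continuous (fun x : G => (x^-1)%g)
}.

(* The library's measurable types are pointed, hence PointedTopological; the
   distinguished point plays no role. *)
#[short(type="topologicalGroupType")]
HB.structure Definition TopologicalGroup :=
  {G of PointedTopological G & Group G & isTopologicalGroup G}.

Definition separable (T : topologicalType) :=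
  exists2 D : set T, countable D & dense D.

Definition generates (G : groupType) (S : set G) :=
  forall g : G, exists2 s : seq G, (forall x, x \in s -> S x) &
    g = (\big[*%g/1%g]_(x <- s) x)%g.

(* Topological spaces are given here by a basis of open sets on a type, and sets
   by Prop-valued predicates: the type of equivalence classes of representations
   lives in a universe too large for the library's set and topologicalType. *)
Section StrongNeighbourhood.
Context (X : Type) (basis : (X -> Prop) -> Prop).

Definition basis_nbhs (p : X) (V : X -> Prop) :=
  exists W, [/\ basis W, W p & forall q, W q -> V q].

Definition accumulation_point (I : Type) (le : I -> I -> Prop) (x : I -> X)
    (p : X) :=
  forall V, basis_nbhs p V -> forall i, exists2 j, le i j & V (x j).

Definition directed (I : Type) (le : I -> I -> Prop) :=
  [/\ inhabited I, (forall i, le i i),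
      (forall i j l, le i j -> le j l -> le i l) &
      (forall i j, exists2 l, le i l & le j l)].

Definition strong_nbhs (A B : X -> Prop) :=
  forall (I : Type) (le : I -> I -> Prop) (x : I -> X), directed le ->
    (forall p, accumulation_point le x p -> A p) ->
    exists i0, forall i, le i0 i -> B (x i).

End StrongNeighbourhood.

Definition borel (T : ptopologicalType) := g_sigma_algebraType (@open T).

Record left_haar (R : realType) (G : topologicalGroupType)
    (mu : {measure set (borel G) -> \bar R}) : Prop := LeftHaar {
  haar_invariant : forall (g : G) (A : set (borel G)), measurable A ->
    mu [set (g * x)%g | x in A] = mu A ;
  haar_neq0 : mu [set: borel G] != 0%E ;
  haar_compact : forall Q : set G, compact Q -> (mu Q < +oo)%E ;
  haar_outer : forall A : set (borel G), measurable A ->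
    mu A = ereal_inf [set mu U | U in [set U : set G | open U /\ A `<=` U]] ;
  haar_inner : forall U : set G, open U ->
    mu U = ereal_sup [set mu Q | Q in [set Q : set G | compact Q /\ Q `<=` U]]
}.

(* Banach spaces are allowed to be real or complex: everything below is relative
   to K = scalar_field R k, which is R or R[i].  As norms of spaces over R[i] are
   (real) elements of R[i], rnorm brings them back to R. *)
Variant scalar_kind := RealScalars | ComplexScalars.

Definition scalar_field (R : realType) (k : scalar_kind) : numFieldType :=
  match k with RealScalars => R | ComplexScalars => R[i] end.

Definition re_scalar (R : realType) (k : scalar_kind) : scalar_field R k -> R :=
  match k with RealScalars => fun x => x | ComplexScalars => @complex.Re R end.

Definition of_real (R : realType) (k : scalar_kind) : R -> scalar_field R k :=
  match k with
  | RealScalars => fun x => x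
  | ComplexScalars => fun x => Complex x 0
  end.

Definition rnorm (R : realType) (k : scalar_kind)
  (E : normedModType (scalar_field R k)) (x : E) : R := re_scalar `|x|.

Definition opnorm (R : realType) (k : scalar_kind)
    (E : normedModType (scalar_field R k)) (T : E -> E) : \bar R :=
  ereal_sup [set (rnorm (T x))%:E | x in [set x : E | rnorm x <= 1]].

Definition projection_onto (K : numFieldType) (E : normedModType K)
    (V : set E) (T : E -> E) :=
  [/\ continuous T, (forall x, T (T x) = T x) & range T = V].

Section Integral.
Context (R : realType) (k : scalar_kind) (G : topologicalGroupType).
Context (mu : {measure set (borel G) -> \bar R}).
Local Notation K := (scalar_field R k).

(* y is the Bochner integral of F, i.e. the limit of the integrals of simple
   functions converging to F in L^1.  It is only meaningful for (strongly)
   measurable F; it is only used for continuous compactly supported F. *)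
Definition is_bochner (E : normedModType K) (F : G -> E) (y : E) :=
  forall e : R, 0 < e ->
  exists (n : nat) (A : 'I_n -> set (borel G)) (c : 'I_n -> E),
    [/\ (forall i, measurable (A i) /\ (mu (A i) < +oo)%E),
        trivIset [set: 'I_n] A,
        (\int[mu]_g (rnorm (F g - \sum_i (\1_(A i) g : K) *: c i))%:E
          < e%:E)%E &
        rnorm (y - \sum_i of_real k (fine (mu (A i))) *: c i) < e].

Definition bochner (E : normedModType K) (F : G -> E) : E :=
  xget 0 [set y | is_bochner F y].

Definition supp (f : G -> K) : set G := closure [set g | f g != 0].

Definition Cc (f : G -> K) := continuous (f : G -> K^o) /\ compact (supp f).

Definition integral_Cc (f : G -> K) : K := bochner (f : G -> K^o).

Definition L1norm (f : G -> K) : \bar R :=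
  (\int[mu]_g (rnorm (f g : K^o))%:E)%E.

Definition convolution (f h : G -> K) : G -> K :=
  fun x => integral_Cc (fun y => f y * h (y^-1 * x)%g).

End Integral.

Section Representations.
Context (R : realType) (k : scalar_kind) (G : topologicalGroupType).
Local Notation K := (scalar_field R k).

(* Invertibility of the operators follows from rep1 and repM. *)
Record rep := Rep {
  rep_space :> completeNormedModType K ;
  rep_op : G -> {linear rep_space -> rep_space} ;
  rep_bounded : forall g, continuous (rep_op g) ;
  rep1 : forall x, rep_op 1%g x = x ;
  repM : forall g h x, rep_op (g * h)%g x = rep_op g (rep_op h x) ;
  rep_strongly_continuous : forall x, continuous (rep_op ^~ x)
}.

Definition rep_equiv (r r' : rep) :=
  exists phi : {linear r -> r'},
    [/\ (forall x, `|phi x| = `|x|), (forall y, exists x, phi x = y) &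
        forall g x, phi (rep_op r g x) = rep_op r' g (phi x)].

Definition rep_inv (r : rep) : set r := [set x | forall g, rep_op r g x = x].

Definition H1_vanishes (r : rep) :=
  forall b : G -> r, continuous b ->
    (forall g h, b (g * h)%g = b g + rep_op r g (b h)) ->
    exists x, forall g, rep_op r g x + b g = x.

Definition admissible (S : set G) (M : R) (r : rep) :=
  separable r /\ forall g, S g -> (opnorm (rep_op r g) <= M%:E)%E.

(* An equivalence class is the class of representations in it; the conditions
   defining admissible are invariant under rep_equiv. *)
Record repclass (S : set G) (M : R) := RepClass {
  members : rep -> Prop ;
  repclassP : exists2 r, admissible S M r & members = rep_equiv r
}.

End Representations.

Arguments rep_inv {R k G} r _.

Section Kazhdan.
Context (R : realType) (k : scalar_kind) (G : topologicalGroupType).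
Context (mu : {measure set (borel G) -> \bar R}) (S : set G) (M : R).
Local Notation K := (scalar_field R k).
Local Notation rep := (rep R k G).
Local Notation repclass := (@repclass R k G S M).

Definition rep_int (r : rep) (f : G -> K) (x : r) : r :=
  bochner mu (fun g => f g *: rep_op r g x).

Definition test_fun (Q : set G) (f : G -> K) :=
  [/\ Cc f, supp f `<=` Q & (L1norm mu f <= 1)%E].

Definition basic_nbhs (r : rep) (n : nat) (x : 'I_n -> r) (Q : set G) (e : R)
    (c : repclass) : Prop :=
  exists (r' : rep) (x' : 'I_n -> r'), [/\ members c r' &
    (ereal_sup [set `|rnorm (\sum_i rep_int (f i) (x' i)) -
                      rnorm (\sum_i rep_int (f i) (x i))|%:E |
        f in [set f : 'I_n -> G -> K | forall i, test_fun Q (f i)]] < e%:E)%E].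

Definition rep_basis (W : repclass -> Prop) :=
  exists (c : repclass) (r : rep) (n : nat) (x : 'I_n -> r) (Q : set G) (e : R),
    [/\ members c r, compact Q, 0 < e & W = basic_nbhs x Q e].

Section Completion.
Context (F : repclass -> Prop).

(* 0 is added so that the supremum over an empty family is 0 *)
Definition seminorm (f : G -> K) : \bar R :=
  ereal_sup (0%E |` [set z | exists (c : repclass) (r : rep),
    [/\ F c, members c r & z = opnorm (@rep_int r f)]]).

Definition cauchy_Cc (p : nat -> G -> K) :=
  (forall n, Cc (p n)) /\
  forall e : R, 0 < e -> exists N : nat, forall m n, (N <= m)%N -> (N <= n)%N ->
    (seminorm (p m \- p n)%R < e%:E)%E.

Definition cauchy_equiv (p q : nat -> G -> K) :=
  (fun n => seminorm (p n \- q n)) @ \oo --> 0%E.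

(* The Hausdorff completion of C_c(G): an element is the class of all Cauchy
   sequences equivalent to a given one. *)
Record completion := Completion {
  sequences : set (nat -> G -> K) ;
  completionP : exists2 p, cauchy_Cc p &
    sequences = [set q | cauchy_Cc q /\ cauchy_equiv p q]
}.

Definition idempotent_elt (P : completion) :=
  forall p, sequences P p -> sequences P (fun n => convolution mu (p n) (p n)).

Definition in_closure (A : set (G -> K)) (P : completion) :=
  forall e : R, 0 < e -> exists2 f, A f &
    forall p, sequences P p ->
      \forall n \near \oo, (seminorm (p n \- f)%R < e%:E)%E.

(* T = pi(P), for the extension of pi : C_c(G) -> B(E) to the completion *)
Definition is_image (r : rep) (P : completion) (T : r -> r) :=
  forall p, sequences P p ->
    (fun n => opnorm (rep_int (p n) \- T)) @ \oo --> 0%E.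

Definition kazhdan_projection (P : completion) :=
  [/\ idempotent_elt P,
      in_closure [set f : G -> K | Cc f /\ integral_Cc mu f = 1] P &
      forall (c : repclass) (r : rep), F c -> members c r ->
        exists2 T : {linear r -> r}, is_image P T &
          projection_onto (rep_inv r) T].

Definition has_kazhdan_projection := exists P, kazhdan_projection P.

End Completion.

Definition H1_vanishes_on (F : repclass -> Prop) :=
  forall (c : repclass) (r : rep), F c -> members c r -> H1_vanishes r.

End Kazhdan.

(* Main.v *)
(* For an affine action sigma with linear part pi and cocycle b, and f in C_c(G) with
   integral 1, write b(f) = sigma(f)0. Say that f contracts (pi, E) if, for every such
   action, moving the origin to b(f) multiplies the displacement of the origin by the
   generators by at most 3/4. If a fixed f contracts every member of a family F', then
   iterating x -> sigma(f)x gives fixed points, and the powers of f converge to a Kazhdan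
   projection, uniformly in F'.

   Conversely let f = f1 * phi, where phi is any function of integral 1 and f1 is so
   close to the Kazhdan projection of F that pi(f1) contracts displacements in F as much
   as we want, and let F' be the set of classes contracted by f. If F' were not a strong
   neighbourhood of F, some net would have, frequently, actions not contracted by f.
   Move their origins to b(phi): this makes the cocycles equicontinuous, so that their
   limit along an ultrafilter is a continuous cocycle with values in the closed span of
   its image in the ultraproduct, a separable space with a continuous representation.
   By Riemann sums with weights independent of the representation, that representation
   is an accumulation point of the net. It therefore lies in F, so the limit cocycle is a
   coboundary x - pi(g)x, and pi(f1) contracts the displacement of x. Since
   sigma(f1 * phi)0 is the image of sigma(phi)0 under sigma(f1), this contradicts the
   failure of f to contract along the net. *)
Require Import Defs.
From HB Require Import structures.
From mathcomp Require Import all_boot all_order all_algebra.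
From mathcomp Require Import all_classical all_reals all_analysis.
From mathcomp Require Import measurable_realfun finmap complex ring lra.
Import Order.TTheory GRing.Theory Num.Theory.
Import numFieldNormedType.Exports.
Set Implicit Arguments.
Unset Strict Implicit.
Unset Printing Implicit Defensive.
Local Open Scope classical_set_scope.
Local Open Scope ring_scope.

(** * Scalars and real-valued norms *)

(** The two hypotheses on [F] play different roles. The Kazhdan projection gives one function good
    for all of [F], but only on coboundaries; the vanishing of [H^1] says that there are no other
    cocycles. Contraction merges both into one inequality for one function, tested on all cocycles,
    and a failure is witnessed by a cocycle and a generator, data that pass to a limit. Two
    obstacles shape the proof. Cocycles bounded by 1 on [S] share no modulus of continuity, whence
    the convolution with [phi]; it enlarges the bound on [S] to a constant [C0], so [f1] is chosen
    after [phi], with tolerance [1 / 2 / (C0 + 1)]. Moreover a neighbourhood in the space of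
    representations compares norms uniformly over all test functions, whereas an ultrafilter handles
    finitely many conditions at a time: hence nets of points depending only on the support, and
    compactness of the set of bounded coefficients. The constants leave room for errors: a failure
    exceeds [3 / 4], the limit is at most [1 / 2], and two errors of [1 / 16] are lost in
    between. *)

Section Scalars.
Context (R : realType) (k : scalar_kind).
Local Notation K := (scalar_field R k).

Lemma of_realK (a : R) : re_scalar (of_real k a) = a.
Proof. by case: k. Qed.

Lemma of_realD (a b : R) : of_real k (a + b) = of_real k a + of_real k b.
Proof. by case: k => //=; rewrite /GRing.add /= /ComplexField.addc /= addr0. Qed.

Lemma of_realM (a b : R) : of_real k (a * b) = of_real k a * of_real k b.
Proof.
case: k => //=; rewrite /GRing.mul /= /ComplexField.mulc /= !mulr0 mul0r subr0.
by rewrite addr0.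
Qed.

Lemma of_real0 : of_real k (0 : R) = 0.
Proof. by case: k. Qed.

Lemma of_real1 : of_real k (1 : R) = 1.
Proof. by case: k. Qed.

Lemma of_realN (a : R) : of_real k (- a) = - of_real k a.
Proof. by apply/eqP; rewrite -addr_eq0 -of_realD addNr of_real0. Qed.

Lemma of_realB (a b : R) : of_real k (a - b) = of_real k a - of_real k b.
Proof. by rewrite of_realD of_realN. Qed.

Lemma of_real_sum I (s : seq I) (P : pred I) (F : I -> R) :
  of_real k (\sum_(i <- s | P i) F i) = \sum_(i <- s | P i) of_real k (F i).
Proof. exact: (big_morph _ of_realD of_real0). Qed.

Lemma ler_of_real (a b : R) : (of_real k a <= of_real k b) = (a <= b).
Proof. by case: k => //=; rewrite lecE /= eqxx. Qed.

Lemma ltr_of_real (a b : R) : (of_real k a < of_real k b) = (a < b).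
Proof. by case: k => //=; rewrite ltcE /= eqxx. Qed.

Lemma of_real_ge0 (a : R) : (0 <= of_real k a) = (0 <= a).
Proof. by rewrite -of_real0 ler_of_real. Qed.

Lemma of_real_gt0 (a : R) : (0 < of_real k a) = (0 < a).
Proof. by rewrite -of_real0 ltr_of_real. Qed.

Lemma re_scalarK (z : K) : 0 <= z -> of_real k (re_scalar z) = z.
Proof.
case: k z => [z|[a b]] //=.
by rewrite lecE /= => /andP[/eqP -> _].
Qed.

Lemma normr_of_real (a : R) : `|of_real k a| = of_real k `|a|.
Proof.
have [a0|a0] := leP 0 a; first by rewrite !ger0_norm ?of_real_ge0.
by rewrite (ltr0_norm a0) of_realN ltr0_norm// -of_real0 ltr_of_real.
Qed.

Lemma gt0_of_real (z : K) : 0 < z -> exists2 a : R, 0 < a & z = of_real k a.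
Proof.
move=> z0; exists (re_scalar z); last by rewrite re_scalarK// ltW.
by rewrite -of_real_gt0 re_scalarK// ltW.
Qed.

End Scalars.

Section RNorm.
Context (R : realType) (k : scalar_kind).
Local Notation K := (scalar_field R k).
Context (E : normedModType K).
Implicit Types (x y : E) (a : K).

Lemma rnormE x : `|x| = of_real k (rnorm x).
Proof. by rewrite /rnorm re_scalarK. Qed.

Lemma rnorm_ge0 x : 0 <= rnorm x.
Proof. by rewrite -(of_real_ge0 k) -rnormE. Qed.

Lemma rnorm0 : rnorm (0 : E) = 0.
Proof. by rewrite /rnorm normr0; case: k. Qed.

Lemma rnorm0_eq0 x : rnorm x = 0 -> x = 0.
Proof. by move=> x0; apply: normr0_eq0; rewrite rnormE x0 of_real0. Qed.

Lemma ler_rnormD x y : rnorm (x + y) <= rnorm x + rnorm y.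
Proof. by rewrite -(ler_of_real k) of_realD -!rnormE ler_normD. Qed.

Lemma rnormN x : rnorm (- x) = rnorm x.
Proof. by rewrite /rnorm normrN. Qed.

Lemma rdistC x y : rnorm (x - y) = rnorm (y - x).
Proof. by rewrite /rnorm distrC. Qed.

Lemma ler_rnormB x y : rnorm (x - y) <= rnorm x + rnorm y.
Proof. by rewrite -(rnormN y) ler_rnormD. Qed.

Lemma ler_rdist (z x y : E) : rnorm (x - y) <= rnorm (x - z) + rnorm (z - y).
Proof. by rewrite -[x - y](subrKA z) ler_rnormD. Qed.

Lemma ler_rnorm_dist x y : `|rnorm x - rnorm y| <= rnorm (x - y).
Proof.
rewrite ler_norml; have := ler_rnormD (x - y) y; rewrite subrK.
have := ler_rnormD (y - x) x; rewrite subrK rdistC; lra.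
Qed.

Lemma ler_rnorm_sum I (s : seq I) (P : pred I) (F : I -> E) :
  rnorm (\sum_(i <- s | P i) F i) <= \sum_(i <- s | P i) rnorm (F i).
Proof.
apply: (big_ind2 (fun x (a : R) => rnorm x <= a)) => //.
  by rewrite rnorm0.
by move=> x a y b xa yb; rewrite (le_trans (ler_rnormD _ _))// lerD.
Qed.

Lemma rnormZ a x : rnorm (a *: x) = rnorm (a : K^o) * rnorm x.
Proof. by rewrite -[RHS](of_realK k) of_realM /rnorm !re_scalarK// -normrZ. Qed.

Lemma rnorm_of_real (a : R) : rnorm (of_real k a : K^o) = `|a|.
Proof. by rewrite /rnorm normr_of_real of_realK. Qed.

Lemma rnormZr (a : R) x : rnorm (of_real k a *: x) = `|a| * rnorm x.
Proof. by rewrite rnormZ rnorm_of_real. Qed.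

(** A radius in a normed module is a scalar of [K], possibly complex; this equivalence is what
    allows every later epsilon to be real. *)
Lemma nbhs_rnormP x (A : set E) :
  nbhs x A <-> exists2 e : R, 0 < e & forall y, rnorm (y - x) < e -> A y.
Proof.
split=> [/nbhs_normP[z z0 zA]|[e e0 eA]].
  have [e e0 ze] := gt0_of_real z0.
  exists e => // y yxe; apply: zA => /=.
  by rewrite ze distrC rnormE ltr_of_real.
apply/nbhs_normP; exists (of_real k e); first by rewrite /= of_real_gt0.
by move=> y /=; rewrite distrC rnormE ltr_of_real => /eA.
Qed.

Lemma cvg_rnormP T (F : set_system T) (FF : Filter F) (f : T -> E) (x : E) :
  (f y @[y --> F] --> x) <->
  (forall e : R, 0 < e -> \forall y \near F, rnorm (f y - x) < e).
Proof.
split=> [fx e e0|fx A /nbhs_rnormP[e e0 eA]].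
  by apply: (fx [set y | rnorm (y - x) < e]); apply/nbhs_rnormP; exists e.
rewrite /nbhs/=; apply: filterS (fx e e0) => y; exact: eA.
Qed.

Lemma rnorm_continuous : continuous (@rnorm R k E).
Proof.
move=> x; apply/cvgrPdist_lt => e e0; apply/nbhs_rnormP; exists e => // y yx.
by rewrite (le_lt_trans (ler_rnorm_dist _ _))// rdistC.
Qed.

Lemma rnorm_le_eq0 x : (forall e : R, 0 < e -> rnorm x <= e) -> x = 0.
Proof.
move=> xe; apply: rnorm0_eq0; apply/eqP; rewrite eq_le rnorm_ge0 andbT.
by apply/ler_addgt0Pl => e e0; rewrite addr0 xe.
Qed.

End RNorm.

Lemma rnormM (R : realType) (k : scalar_kind) (a b : scalar_field R k) :
  rnorm (a * b : (scalar_field R k)^o) =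
  rnorm (a : (scalar_field R k)^o) * rnorm (b : (scalar_field R k)^o).
Proof. exact: (rnormZ (E := (scalar_field R k)^o)). Qed.

Lemma rnorm1 (R : realType) (k : scalar_kind) :
  rnorm (1 : (scalar_field R k)^o) = 1.
Proof. by rewrite -[X in rnorm X](of_real1 R k) rnorm_of_real normr1. Qed.

Lemma rnorm_cauchy_cvg (R : realType) (k : scalar_kind)
    (E : completeNormedModType (scalar_field R k)) (x : nat -> E) :
  (forall e : R, 0 < e -> exists N, forall m n, (N <= m)%N -> (N <= n)%N ->
     rnorm (x m - x n) < e) ->
  exists l, forall e : R, 0 < e -> exists N, forall n, (N <= n)%N ->
    rnorm (x n - l) < e.
Proof.
move=> xC; have /cauchy_cvgP : cauchy (x @ \oo).
  apply: cauchy_exP => z z0; have [e e0 ->] := gt0_of_real z0.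
  have [N xN] := xC e e0; exists (x N), N => // n /= Nn.
  by rewrite -ball_normE /= rnormE ltr_of_real xN.
move=> /cvg_ex[/= l /cvg_rnormP xl]; exists l => e /xl[N _ NP].
by exists N => n Nn; apply: NP.
Qed.

(** * Topological groups *)

Section TopologicalGroups.
Context (G : topologicalGroupType).
Implicit Types (g h x y : G) (A B Q U V : set G).

Lemma cvg_mulg T (F : set_system T) (FF : Filter F) (u v : T -> G) x y :
  u @ F --> x -> v @ F --> y -> (fun t => (u t * v t)%g) @ F --> (x * y)%g.
Proof.
move=> ux vy; apply: (@cvg_comp _ _ _ (fun t => (u t, v t))
  (fun z : G * G => (z.1 * z.2)%g) F (nbhs (x, y))).
  exact: cvg_pair.
exact: (@mulg_continuous G (x, y)).
Qed.

Lemma mulgl_continuous g : continuous (fun x : G => (g * x)%g).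
Proof. by move=> x; apply: cvg_mulg => //; apply: cvg_cst. Qed.

Lemma mulgr_continuous g : continuous (fun x : G => (x * g)%g).
Proof. by move=> x; apply: cvg_mulg => //; apply: cvg_cst. Qed.

Lemma lcosetE g A : [set (g * x)%g | x in A] = [set x | A (g^-1 * x)%g].
Proof.
apply/seteqP; split=> [_ [x Ax <-]|x Ax] /=; first by rewrite mulKg.
by exists (g^-1 * x)%g => //; rewrite mulVKg.
Qed.

Lemma open_lcoset g U : open U -> open [set (g * x)%g | x in U].
Proof.
move=> oU; rewrite lcosetE.
by apply: (@open_comp _ _ (fun x => (g^-1 * x)%g)) => // x _; apply: mulgl_continuous.
Qed.

Lemma nbhs_lcoset g U : nbhs (1%g : G) U -> nbhs g [set x | U (g^-1 * x)%g].
Proof. by move=> U1; apply: (@mulgl_continuous g^-1%g g U); rewrite mulVg. Qed.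

Lemma near_invg1 (P : G -> Prop) : (\forall x \near (1%g : G), P x) ->
  \forall x \near (1%g : G), P (x^-1)%g.
Proof. by move=> P1; apply: (@invg_continuous G 1%g P); rewrite invg1. Qed.

Lemma compact_mulg A B : compact A -> compact B ->
  compact [set (x * y)%g | x in A & y in B].
Proof.
move=> cA cB; rewrite (_ : [set _ | _ in _ & _ in _] =
    (fun z : G * G => (z.1 * z.2)%g) @` (A `*` B)); last first.
  apply/seteqP; split=> [_ [x Ax [y By <-]]|_ [[x y] [/= Ax By] <-]].
    by exists (x, y).
  by exists x => //; exists y.
apply: continuous_compact; last exact: compact_setX.
by apply: continuous_subspaceT; apply: (@mulg_continuous G).
Qed.

Lemma compact_lcoset g A : compact A -> compact [set (g * x)%g | x in A].
Proof.
move=> cA; apply: continuous_compact => //; apply: continuous_subspaceT.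
exact: mulgl_continuous.
Qed.

Lemma compact_invg A : compact A -> compact [set (x^-1)%g | x in A].
Proof.
move=> cA; apply: continuous_compact => //; apply: continuous_subspaceT.
exact: (@invg_continuous G).
Qed.

Lemma locally_compact_nbhs1 : locally_compact [set: G] ->
  exists2 Q, nbhs (1%g : G) Q & compact Q.
Proof.
by move=> /(_ 1%g I); rewrite withinET => -[Q Q1 [cQ _]]; exists Q.
Qed.

Lemma compact_translates_cover Q V : compact Q -> nbhs (1%g : G) V ->
  exists s : seq G, (forall t, t \in s -> Q t) /\
    forall x, Q x -> exists2 t, t \in s & V (t^-1 * x)%g.
Proof.
rewrite compact_cover => cQ V1.
have [D DQ QD] := cQ G Q (fun t => [set (t * x)%g | x in V^°])
  (fun t _ => @open_lcoset t _ (@open_interior _ V))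
  (fun x Qx => ex_intro2 _ _ x Qx (ex_intro2 _ _ 1%g V1 (mulg1 x))).
exists (enum_fset D); split=> [t tD|x /QD[t tD [v Vv <-]]].
  by have := DQ t tD => /set_mem.
by exists t => //; rewrite mulKg; apply: interior_subset.
Qed.

Lemma near_mulg_compact Q (P : G -> G -> Prop) : compact Q ->
  (forall x, Q x -> \forall y \near x & v \near (1%g : G), P v y) ->
  \forall v \near (1%g : G), forall x, Q x -> P v x.
Proof. by move=> /compact_near_coveringP; apply. Qed.

Section UniformContinuity.
Context (R : realType) (k : scalar_kind).
Context (E : normedModType (scalar_field R k)) (F : G -> E).
Hypothesis cF : continuous F.

(** The operation [op v x] stands for [v * x] or [x * v], so that left and right uniform continuity
    come from one compactness argument. *)
Lemma uniform_continuity Q (op : G -> G -> G) : compact Q ->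
  continuous (fun z : G * G => op z.1 z.2) -> (forall x, op 1%g x = x) ->
  forall e : R, 0 < e ->
  \forall v \near (1%g : G), forall x, Q x -> rnorm (F (op v x) - F x) < e.
Proof.
move=> cQ cop op1 e e0; apply: near_mulg_compact => // x Qx.
have e20 : 0 < e / 2 by rewrite divr_gt0.
have /cvg_rnormP/(_ _ e20) h1 : F (op z.2 z.1) @[z --> (x, 1%g)] --> F x.
  rewrite -[in X in _ --> X](op1 x).
  apply: (@cvg_comp _ _ _ (fun z => op z.2 z.1) F).
    apply: (@cvg_comp _ _ _ (fun z : G * G => (z.2, z.1))
       (fun z : G * G => op z.1 z.2) _ (nbhs (1%g, x))); last exact: cop.
    by apply: cvg_pair; [exact: cvg_snd|exact: cvg_fst].
  exact: cF.
have /cvg_rnormP/(_ _ e20) h2 : F z.1 @[z --> (x, 1%g : G)] --> F x.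
  by apply: (@cvg_comp _ _ _ (@fst G G) F); [exact: cvg_fst|exact: cF].
near=> z => /=; apply: le_lt_trans (ler_rdist (F x) _ _) _.
rewrite [ltRHS](splitr e) ltrD//; first by near: z.
by rewrite rdistC; near: z.
Unshelve. all: by end_near. Qed.

Lemma unif_cont_mulgr Q : compact Q -> forall e : R, 0 < e ->
  \forall v \near (1%g : G), forall x, Q x -> rnorm (F (x * v)%g - F x) < e.
Proof.
move=> cQ; apply: (uniform_continuity (op := fun v x => (x * v)%g)) => //.
  by move=> [a b]; apply: cvg_mulg; [exact: cvg_snd|exact: cvg_fst].
by move=> x; rewrite mulg1.
Qed.

Lemma unif_cont_mulgl Q : compact Q -> forall e : R, 0 < e ->
  \forall v \near (1%g : G), forall x, Q x -> rnorm (F (v * x)%g - F x) < e.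
Proof.
move=> cQ; apply: (uniform_continuity (op := fun v x => (v * x)%g)) => //.
  exact: (@mulg_continuous G).
by move=> x; rewrite mul1g.
Qed.

Lemma unif_cont_mulgl_supp Q : compact Q -> (forall x, ~ Q x -> F x = 0) ->
  forall e : R, 0 < e ->
  \forall v \near (1%g : G), forall x, rnorm (F (v * x)%g - F x) < e.
Proof.
move=> cQ FQ e e0; near=> v => x.
have [Qx|Qx] := pselect (Q x); first by move: x Qx; near: v; apply: unif_cont_mulgl.
have [Qvx|Qvx] := pselect (Q (v * x)%g); last by rewrite !FQ// subr0 rnorm0.
(* Only [v * x] lies in [Q] here: the estimate is read backwards from that point, with [v^-1]. *)
rewrite rdistC -{1}(mulKg v x); move: (v * x)%g Qvx.
near: v.
apply: (near_invg1 (P := fun v => forall y, Q y -> rnorm (F (v * y)%g - F y) < e)).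
exact: unif_cont_mulgl.
Unshelve. all: by end_near. Qed.

Lemma rnorm_compact_bounded Q : compact Q -> exists2 C : R, 0 <= C &
  forall x, Q x -> rnorm (F x) <= C.
Proof.
move=> cQ; have /compact_bounded[C [_ CQ]] :
    compact ((fun x => rnorm (F x)) @` Q).
  apply: continuous_compact => //; apply: continuous_subspaceT => x.
  apply: (@cvg_comp _ _ _ F (@rnorm R k E)); first exact: cF.
  exact: rnorm_continuous.
exists (`|C| + 1) => [|x Qx]; first by rewrite addr_ge0.
apply: le_trans (ler_norm _) _.
apply: (CQ (`|C| + 1)); last by exists x.
by rewrite (le_lt_trans (ler_norm _))// ltrDl.
Qed.

End UniformContinuity.

Section Partition.
Hypothesis hG : hausdorff_space G.

Lemma open_borel U : open U -> measurable (U : set (borel G)).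
Proof. by move=> oU; apply: sub_sigma_algebra. Qed.

Lemma closed_borel A : closed A -> measurable (A : set (borel G)).
Proof.
move=> cA; rewrite -(setCK A); apply: measurableC; apply: open_borel.
exact: closed_openC.
Qed.

Lemma compact_borel Q : compact Q -> measurable (Q : set (borel G)).
Proof. by move=> cQ; apply: closed_borel; apply: compact_closed. Qed.

Lemma measurable_lcoset g (A : set (borel G)) : measurable A ->
  measurable ([set (g * x)%g | x in A] : set (borel G)).
Proof.
rewrite lcosetE => mA; rewrite -[X in measurable X]setTI.
suff : measurable_fun [set: borel G] (fun x : borel G => (g^-1 * x)%g : borel G).
  exact.
apply: measurability => // _ [U oU <-]; rewrite setTI.
apply: open_borel; apply: (@open_comp _ _ (fun x : G => (g^-1 * x)%g)) => // x _.
exact: mulgl_continuous.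
Qed.

End Partition.

End TopologicalGroups.

(** * Bochner integrals *)

Section SimpleFunctions.
Context d (T : measurableType d) (R : realType) (k : scalar_kind).
Local Notation K := (scalar_field R k).
Context (mu : {measure set T -> \bar R}) (E : normedModType K).
Implicit Types (H : T -> E).

Definition simple n (A : 'I_n -> set T) (c : 'I_n -> E) (x : T) : E :=
  \sum_i (\1_(A i) x : K) *: c i.

Definition simple_integral n (A : 'I_n -> set T) (c : 'I_n -> E) : E :=
  \sum_i of_real k (fine (mu (A i))) *: c i.

(** Just enough measurability to integrate norms, without a Borel structure on [E]. It is preserved
    by adding simple functions; for a general sum it appears below as a separate hypothesis. *)
Definition dist_measurable H :=
  forall c, measurable_fun setT (fun x => (rnorm (H x + c))%:E).

Lemma dist_measurable_add_indic H (A : set T) c : measurable A ->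
  dist_measurable H ->
  dist_measurable (fun x => H x + (\1_A x : K) *: c).
Proof.
move=> mA mH c'.
rewrite (_ : (fun _ => _) = (fun x => if x \in A
    then (rnorm (H x + (c + c')))%:E else (rnorm (H x + c'))%:E)).
  apply: measurable_fun_ifT => //.
  by apply: (measurable_fun_bool true) => //; rewrite setTI preimage_mem_true.
apply/funext => x; rewrite indicE; case: (x \in A).
  by rewrite scale1r addrA.
by rewrite scale0r addr0.
Qed.

Lemma dist_measurable_sum H n (A : 'I_n -> set T) (c : 'I_n -> E) :
  (forall i, measurable (A i)) -> dist_measurable H ->
  dist_measurable (fun x => H x + simple A c x).
Proof.
move=> mA mH; rewrite /simple; elim: (index_enum _) => [|i s ih].
  by rewrite (_ : (fun _ => _) = H)//; apply/funext => x; rewrite big_nil addr0.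
rewrite (_ : (fun _ => _) = (fun x => (H x + \sum_(j <- s) (\1_(A j) x : K) *: c j)
    + (\1_(A i) x : K) *: c i)); first exact: dist_measurable_add_indic.
by apply/funext => x; rewrite big_cons [X in _ + X]addrC addrA.
Qed.

Lemma simpleN n (A : 'I_n -> set T) (c : 'I_n -> E) x :
  - simple A c x = simple A (fun i => - c i) x.
Proof. by rewrite /simple -sumrN; apply: eq_bigr => i _; rewrite scalerN. Qed.

(** The sets may overlap, so both sides are rewritten over the atoms of the algebra that they
    generate, indexed by the set [I] of those [i] with [x] in [A i]. The simple function is constant
    on each atom, and the triangle inequality concludes. *)
Lemma simple_integral_le n (A : 'I_n -> set T) (c : 'I_n -> E) :
  (forall i, measurable (A i) /\ (mu (A i) < +oo)%E) ->
  ((rnorm (simple_integral A c))%:E <= \int[mu]_x (rnorm (simple A c x))%:E)%E.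
Proof.
move=> mA; pose sel x : {set 'I_n} := [set i | x \in A i]%SET.
pose atom (I : {set 'I_n}) : set T := [set x | sel x = I].
have indic_atom I x : \1_(atom I) x = (sel x == I)%:R :> R.
  rewrite indicE; congr (nat_of_bool _)%:R.
  by apply/idP/eqP => [/set_mem|?]; last apply/mem_set.
have matom I : measurable (atom I).
  rewrite (_ : atom I = \bigcap_(i in [set: 'I_n])
      (if i \in I then A i else ~` A i)).
    apply: fin_bigcap_measurable => [|i _]; first exact: finite_finset.
    by case: ifP => _; [|apply: measurableC]; exact: (mA i).1.
  apply/seteqP; split=> [x <- i _|x xI].
    by rewrite inE; case: ifPn => [/set_mem//|/negP xA Ax]; apply/xA/mem_set.
  apply/setP => i; rewrite inE; have := xI i Logic.I.
  by case: ifPn => [iI /mem_set ->//|iI Ax]; apply/negbTE/negP => /set_mem.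
have simpleE x : simple A c x = \sum_(i in sel x) c i.
  rewrite /simple [RHS]big_mkcond /=; apply: eq_bigr => i _; rewrite inE indicE.
  by case: (x \in A i); rewrite ?scale1r ?scale0r.
pose sc (I : {set 'I_n}) := \sum_(i in I) c i.
have muA i : (mu (A i) =
    \sum_(I <- seq.filter (fun J : {set 'I_n} => i \in J) (index_enum _)) mu (atom I))%E.
  rewrite -[in LHS](setIT (A i)) -integral_indic//; last exact: (mA i).1.
  under [in RHS]eq_bigr => J _ do rewrite -(setIT (atom J)) -integral_indic//.
  rewrite -ge0_integral_sum//; last first.
    by move=> J; apply/measurable_EFinP; apply: measurable_indic.
  apply: eq_integral => x _; rewrite sumEFin big_filter; congr EFin.
  under eq_bigr do rewrite indic_atom.
  rewrite big_mkcond (bigD1 (sel x))//= eqxx big1 => [|J].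
    by rewrite addr0 indicE inE; case: (x \in A i).
  by rewrite eq_sym => /negbTE ->; rewrite if_same.
pose m I := fine (mu (atom I)).
have atomE i (I : {set 'I_n}) : i \in I -> mu (atom I) = (m I)%:E.
  move=> iI; rewrite fineK// ge0_fin_numE//; apply: le_lt_trans (mA i).2.
  apply: le_measure; [exact/mem_set|by apply/mem_set; case: (mA i)|].
  by move=> x; rewrite /atom /= => xI; move: iI; rewrite -xI inE => /set_mem.
have fineA i : fine (mu (A i)) = \sum_(I : {set 'I_n} | i \in I) m I.
  rewrite muA big_filter (eq_bigr (fun I => (m I)%:E)) => [|I /atomE//].
  by rewrite sumEFin.
have -> : simple_integral A c = \sum_I of_real k (m I) *: sc I.
  rewrite /simple_integral.
  under eq_bigr do rewrite fineA of_real_sum scaler_suml.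
  rewrite (exchange_big_dep predT)//=; apply: eq_bigr => I _.
  by rewrite scaler_sumr.
have -> : (\int[mu]_x (rnorm (simple A c x))%:E =
    \sum_I (rnorm (sc I))%:E * mu (atom I))%E.
  rewrite (eq_integral (fun x => \sum_(I <- index_enum {set 'I_n})
      ((rnorm (sc I))%:E * (\1_(atom I) x)%:E)%E)%E) => [|x _].
    rewrite ge0_integral_sum//.
    - apply: eq_bigr => I _; rewrite ge0_integralZl_EFin//; last 2 first.
      + by apply/measurable_EFinP; apply: measurable_indic.
      + exact: rnorm_ge0.
      by rewrite integral_indic// setIT.
    - move=> I; apply: measurable_funeM.
      by apply/measurable_EFinP; apply: measurable_indic.
    - by move=> I x _; rewrite mule_ge0 ?lee_fin ?rnorm_ge0// indicE.
  rewrite (bigD1 (sel x))//= big1 => [|J].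
    by rewrite indic_atom eqxx mule1 adde0 simpleE.
  by rewrite indic_atom eq_sym => /negbTE ->; rewrite mule0.
apply: (@le_trans _ _ (\sum_I (m I * rnorm (sc I))%:E)%E).
  rewrite sumEFin lee_fin (le_trans (ler_rnorm_sum _ _ _))// ler_sum// => I _.
  by rewrite rnormZr ger0_norm ?fine_ge0.
(* The atom of the empty index set may have infinite measure, but the simple function vanishes
   there. *)
apply: lee_sum => I _; have [->|[i iI]] := set_0Vmem I.
  by rewrite /sc big_set0 rnorm0 mulr0 mul0e.
by rewrite (atomE i)// -EFinM mulrC.
Qed.

End SimpleFunctions.

Section BochnerLimits.
Context d (T : measurableType d) (R : realType) (k : scalar_kind).
Local Notation K := (scalar_field R k).
Context (mu : {measure set T -> \bar R}).

Definition finite_sets n (A : 'I_n -> set T) :=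
  forall i, measurable (A i) /\ (mu (A i) < +oo)%E.

(* Unlike in [is_bochner], the sets need not be disjoint, which makes sums immediate. *)
Definition bochner_lim (E : normedModType K) (F : T -> E) (y : E) :=
  forall e : R, 0 < e -> exists n (A : 'I_n -> set T) (c : 'I_n -> E),
    [/\ finite_sets A,
        (\int[mu]_x (rnorm (F x - simple A c x))%:E < e%:E)%E &
        rnorm (y - simple_integral mu A c) < e].

Section OneSpace.
Context (E : normedModType K).
Implicit Types (F H : T -> E) (y : E).

Lemma dist_measurableN F : dist_measurable F -> dist_measurable (fun x => - F x).
Proof.
move=> mF c; rewrite (_ : (fun _ => _) = (fun x => (rnorm (F x - c))%:E)) //.
by apply/funext => x; rewrite -rnormN opprD opprK.
Qed.

Lemma dist_measurable_norm F : dist_measurable F ->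
  measurable_fun setT (fun x => (rnorm (F x))%:E).
Proof.
move=> mF; rewrite (_ : (fun _ => _) = (fun x => (rnorm (F x + 0))%:E)) //.
by apply/funext => x; rewrite addr0.
Qed.

Lemma dist_measurable_simple n (A : 'I_n -> set T) (c : 'I_n -> E) :
  finite_sets A -> dist_measurable (simple A c).
Proof.
move=> mA; rewrite (_ : simple A c = fun x => 0 + simple A c x).
  by apply: dist_measurable_sum => [i|c']; [case: (mA i)|exact: measurable_cst].
by apply/funext => x; rewrite add0r.
Qed.

Lemma dist_measurable_subs n (A : 'I_n -> set T) (c : 'I_n -> E) F :
  finite_sets A -> dist_measurable F -> dist_measurable (fun x => F x - simple A c x).
Proof.
move=> mA mF; rewrite (_ : (fun x => _) = fun x => F x + simple A (fun i => - c i) x).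
  by apply: dist_measurable_sum => // i; case: (mA i).
by apply/funext => x; rewrite simpleN.
Qed.

Lemma integral_rnormD F H : dist_measurable F -> dist_measurable H ->
  dist_measurable (fun x => F x + H x) ->
  (\int[mu]_x (rnorm (F x + H x))%:E <=
   \int[mu]_x (rnorm (F x))%:E + \int[mu]_x (rnorm (H x))%:E)%E.
Proof.
move=> mF mH mFH; rewrite -ge0_integralD//; first last.
- exact: dist_measurable_norm.
- by move=> x _; rewrite lee_fin rnorm_ge0.
- exact: dist_measurable_norm.
- by move=> x _; rewrite lee_fin rnorm_ge0.
apply: ge0_le_integral => //.
- by move=> x _; rewrite lee_fin rnorm_ge0.
- exact: dist_measurable_norm.
- by apply: emeasurable_funD; exact: dist_measurable_norm.
- by move=> x _; rewrite -EFinD lee_fin ler_rnormD.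
Qed.

Lemma bochner_lim_norm F y : dist_measurable F -> bochner_lim F y ->
  ((rnorm y)%:E <= \int[mu]_x (rnorm (F x))%:E)%E.
Proof.
move=> mF Fy; apply/lee_addgt0Pr => e e0.
have e20 : 0 < e / 2 by rewrite divr_gt0.
have [n [A [c [mA FA yA]]]] := Fy _ e20.
have h1 : ((rnorm (simple_integral mu A c))%:E <=
    \int[mu]_x (rnorm (F x))%:E + (e / 2)%:E)%E.
  apply: le_trans (simple_integral_le (mu := mu) c mA) _.
  apply: (@le_trans _ _ (\int[mu]_x (rnorm (F x) )%:E +
      \int[mu]_x (rnorm (- (F x - simple A c x)))%:E)%E).
    apply: (@le_trans _ _ (\int[mu]_x (rnorm (F x + - (F x - simple A c x)))%:E)%E).
      by under [in leRHS]eq_integral do rewrite opprB addrC subrK.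
    apply: (@integral_rnormD F (fun x => - (F x - simple A c x))) => //.
      exact/dist_measurableN/dist_measurable_subs.
    under eq_fun do rewrite opprB addrC subrK.
    exact: dist_measurable_simple.
  rewrite leeD2l//; under eq_integral do rewrite rnormN; exact: ltW.
have : ((rnorm y)%:E <= (e / 2)%:E + (rnorm (simple_integral mu A c))%:E)%E.
  rewrite -EFinD lee_fin -[y in leLHS](subrK (simple_integral mu A c)).
  by rewrite (le_trans (ler_rnormD _ _))// lerD2r ltW.
move=> /le_trans; apply.
apply: (le_trans (leeD2l _ h1)).
by rewrite addeCA -EFinD -splitr.
Qed.

Lemma bochner_limD F H y z : dist_measurable F -> dist_measurable H ->
  dist_measurable (fun x => F x + H x) ->
  bochner_lim F y -> bochner_lim H z -> bochner_lim (fun x => F x + H x) (y + z).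
Proof.
move=> mF mH mFH Fy Hz e e0.
have e20 : 0 < e / 2 by rewrite divr_gt0.
have [m [B [b [mB FB yB]]]] := Fy _ e20.
have [n [A [c [mA HA zA]]]] := Hz _ e20.
pose C i := match fintype.split i with inl j => B j | inr j => A j end.
pose a i := match fintype.split i with inl j => b j | inr j => c j end.
have lC (j : 'I_m) : C (lshift n j) = B j by rewrite /C (unsplitK (inl j)).
have rC (j : 'I_n) : C (rshift m j) = A j by rewrite /C (unsplitK (inr j)).
have la (j : 'I_m) : a (lshift n j) = b j by rewrite /a (unsplitK (inl j)).
have ra (j : 'I_n) : a (rshift m j) = c j by rewrite /a (unsplitK (inr j)).
have mC : finite_sets C.
  by move=> i; rewrite /C; case: (fintype.split i) => j; [exact: mB|exact: mA].
have sC x : simple C a x = simple B b x + simple A c x.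
  rewrite /simple big_split_ord /=; congr (_ + _).
    by apply: eq_bigr => i _; rewrite lC la.
  by apply: eq_bigr => i _; rewrite rC ra.
exists (m + n)%N, C, a; split => //.
- apply: (@le_lt_trans _ _ (\int[mu]_x (rnorm (F x - simple B b x))%:E +
      \int[mu]_x (rnorm (H x - simple A c x))%:E)%E); last first.
    by rewrite (splitr e) EFinD lteD.
  under eq_integral do rewrite sC opprD addrACA.
  apply: integral_rnormD; [exact: dist_measurable_subs|exact: dist_measurable_subs|].
  under eq_fun do rewrite addrACA -opprD -sC.
  exact: (dist_measurable_subs a mC mFH).
- rewrite (_ : simple_integral mu C a = simple_integral mu B b + simple_integral mu A c).
    rewrite opprD addrACA (le_lt_trans (ler_rnormD _ _))// (splitr e).
    by rewrite ltrD.
  rewrite /simple_integral big_split_ord /=; congr (_ + _).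
    by apply: eq_bigr => i _; rewrite lC la.
  by apply: eq_bigr => i _; rewrite rC ra.
Qed.

Lemma bochner_lim_simple n (A : 'I_n -> set T) (c : 'I_n -> E) : finite_sets A ->
  bochner_lim (simple A c) (simple_integral mu A c).
Proof.
move=> mA e e0; exists n, A, c; split=> //; last by rewrite subrr rnorm0.
by under eq_integral do rewrite subrr rnorm0; rewrite integral0.
Qed.

Lemma bochner_limB_simple F y n (A : 'I_n -> set T) (c : 'I_n -> E) :
  finite_sets A -> dist_measurable F -> bochner_lim F y ->
  bochner_lim (fun x => F x - simple A c x) (y - simple_integral mu A c).
Proof.
move=> mA mF Fy; have := dist_measurable_subs c mA mF.
have -> : (fun x => F x - simple A c x) = fun x => F x + simple A (fun i => - c i) x.
  by apply/funext => x; rewrite simpleN.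
rewrite (_ : - _ = simple_integral mu A (fun i => - c i)) => [mFA|].
  by apply: bochner_limD => //; [exact: dist_measurable_simple|exact: bochner_lim_simple].
by rewrite /simple_integral -sumrN; apply: eq_bigr => i _; rewrite scalerN.
Qed.

(** The norm bound applied to the difference. It makes any simple function close to [F] in mean
    usable for estimating the integral, which gives uniqueness and all the Riemann sums below. *)
Lemma bochner_lim_approx F y n (A : 'I_n -> set T) (c : 'I_n -> E) :
  finite_sets A -> dist_measurable F -> bochner_lim F y ->
  ((rnorm (y - simple_integral mu A c))%:E <=
   \int[mu]_x (rnorm (F x - simple A c x))%:E)%E.
Proof.
move=> mA mF Fy; apply: bochner_lim_norm; first exact: dist_measurable_subs.
exact: bochner_limB_simple.
Qed.

Lemma bochner_lim_unique F y y' : dist_measurable F ->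
  bochner_lim F y -> bochner_lim F y' -> y = y'.
Proof.
move=> mF Fy Fy'; apply/eqP; rewrite -subr_eq0; apply/eqP.
apply: rnorm_le_eq0 => e e0.
have e20 : 0 < e / 2 by rewrite divr_gt0.
have [n [A [c [mA FA yA]]]] := Fy _ e20.
have := le_lt_trans (bochner_lim_approx c mA mF Fy') FA; rewrite lte_fin => y'A.
rewrite (le_trans (ler_rdist (simple_integral mu A c) _ _))// (splitr e).
by rewrite lerD ?(ltW yA)// rdistC ltW.
Qed.

End OneSpace.

Lemma bochner_lim_linear (E E' : normedModType K) (L : {linear E -> E'}) (C : R)
    (F : T -> E) y : (forall x, rnorm (L x) <= C * rnorm x) ->
  dist_measurable F -> dist_measurable (fun x => L (F x)) ->
  bochner_lim F y -> bochner_lim (fun x => L (F x)) (L y).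
Proof.
move=> LC mF mLF Fy e e0.
pose D := `|C| + 1; have D0 : 0 < D by rewrite ltr_wpDl.
have LD x : rnorm (L x) <= D * rnorm x.
  apply: le_trans (LC x) _; rewrite ler_wpM2r ?rnorm_ge0// /D.
  by rewrite (le_trans (ler_norm C))// lerDl.
have [n [A [c [mA FA yA]]]] := Fy (e / D) (divr_gt0 e0 D0).
have LE x : L (simple A c x) = simple A (L \o c) x.
  by rewrite /simple linear_sum; apply: eq_bigr => i _; rewrite linearZ.
exists n, A, (L \o c); split => //.
- apply: (@le_lt_trans _ _ (\int[mu]_x (D%:E * (rnorm (F x - simple A c x))%:E))%E).
    apply: ge0_le_integral => //.
    + by move=> x _; rewrite lee_fin rnorm_ge0.
    + by apply: dist_measurable_norm; exact: dist_measurable_subs.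
    + apply: measurable_funeM.
      by apply: dist_measurable_norm; exact: dist_measurable_subs.
    + by move=> x _; rewrite -LE -linearB -EFinM lee_fin.
  rewrite ge0_integralZl_EFin//; last 3 first.
  + by move=> x _; rewrite lee_fin rnorm_ge0.
  + by apply: dist_measurable_norm; exact: dist_measurable_subs.
  + exact: ltW.
  rewrite -lte_pdivlMl// -EFinM mulrC.
  exact: FA.
- rewrite (_ : simple_integral mu A (L \o c) = L (simple_integral mu A c)).
    rewrite -linearB (le_lt_trans (LD _))//.
    by rewrite -ltr_pdivlMl// mulrC.
  by rewrite /simple_integral linear_sum; apply: eq_bigr => i _; rewrite linearZ.
Qed.

End BochnerLimits.

(** Sequential and in terms of real norms, so as to cover both the representation spaces and the
    scalars [K^o]: integrals are taken in both. *)
Definition rnorm_complete (R : realType) (k : scalar_kind)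
    (E : normedModType (scalar_field R k)) :=
  forall x : nat -> E,
  (forall e : R, 0 < e -> exists N, forall m n, (N <= m)%N -> (N <= n)%N ->
     rnorm (x m - x n) < e) ->
  exists l, forall e : R, 0 < e -> exists N, forall n, (N <= n)%N ->
    rnorm (x n - l) < e.

Lemma rnorm_complexE (R : realType) (z : R[i]) :
  rnorm (z : (scalar_field R ComplexScalars)^o) =
  Num.sqrt (complex.Re z ^+ 2 + complex.Im z ^+ 2).
Proof. exact: (congr1 (@complex.Re R) (normc_def z)). Qed.

Lemma rnorm_Re (R : realType) (z : R[i]) :
  `|complex.Re z| <= rnorm (z : (scalar_field R ComplexScalars)^o).
Proof. by rewrite rnorm_complexE -sqrtr_sqr ler_wsqrtr// lerDl sqr_ge0. Qed.

Lemma rnorm_Im (R : realType) (z : R[i]) :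
  `|complex.Im z| <= rnorm (z : (scalar_field R ComplexScalars)^o).
Proof. by rewrite rnorm_complexE -sqrtr_sqr ler_wsqrtr// lerDr sqr_ge0. Qed.

Lemma rnorm_ReIm (R : realType) (z : R[i]) :
  rnorm (z : (scalar_field R ComplexScalars)^o) <=
  `|complex.Re z| + `|complex.Im z|.
Proof.
rewrite rnorm_complexE -[leRHS]ger0_norm ?addr_ge0// -sqrtr_sqr ler_wsqrtr//.
rewrite sqrrD !real_normK ?num_real// -addrA lerD2l lerDr.
by rewrite mulrn_wge0// mulr_ge0.
Qed.

Lemma rnorm_complete_scalar (R : realType) (k : scalar_kind) :
  rnorm_complete (scalar_field R k)^o.
Proof.
case: k => x xC.
  exact: (@rnorm_cauchy_cvg R RealScalars R^o x xC).
have cvR (h : R[i] -> R) : (forall z, `|h z| <= rnorm (z : (scalar_field R ComplexScalars)^o)) ->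
    (forall y z, h (y - z) = h y - h z) ->
    exists l, forall e : R, 0 < e -> exists N, forall n, (N <= n)%N ->
      `|h (x n) - l| < e.
  move=> hn hB; apply: (@rnorm_cauchy_cvg R RealScalars R^o (fun n => h (x n))).
  move=> e /xC[N xN]; exists N => m n Nm Nn; rewrite /rnorm /= -hB.
  exact: le_lt_trans (hn _) (xN _ _ Nm Nn).
have [a xa] := cvR _ (@rnorm_Re R) (@raddfB _ _ _).
have [b xb] := cvR _ (@rnorm_Im R) (@raddfB _ _ _).
exists (Complex a b) => e e0.
have e20 : 0 < e / 2 by rewrite divr_gt0.
have [N xN] := xa _ e20; have [N' xN'] := xb _ e20.
exists (maxn N N') => n; rewrite geq_max => /andP[Nn N'n].
rewrite (le_lt_trans (rnorm_ReIm _))// (splitr e) ltrD//.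
  by rewrite raddfB /= xN.
by rewrite raddfB /= xN'.
Qed.

Section Integration.
Context (R : realType) (k : scalar_kind) (G : topologicalGroupType).
Local Notation K := (scalar_field R k).
Context (mu : {measure set (borel G) -> \bar R}).
Context (hG : hausdorff_space G).
Context (mu_fin : forall Q : set G, compact Q -> (mu Q < +oo)%E).

Definition vanishes_off (E : normedModType K) (Q : set G) (F : G -> E) :=
  forall x, ~ Q x -> F x = 0.

Lemma continuous_measurable (h : G -> R) : continuous h ->
  measurable_fun setT (fun x : borel G => (h x)%:E).
Proof.
move=> ch; apply/measurable_EFinP.
apply: (measurability _ (@RGenOInfty.measurableE R)) => _ [_ [x ->] <-].
rewrite setTI; apply: open_borel.
apply: (@open_comp _ _ h) => [y _|]; first exact: ch.
by rewrite set_itvE; exact: open_gt.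
Qed.

Lemma continuous_dist_measurable (E : normedModType K) (F : G -> E) : continuous F ->
  dist_measurable (F : borel G -> E).
Proof.
move=> cF c; apply: continuous_measurable => x.
apply: (@cvg_comp _ _ _ (fun x => F x + c) (@rnorm R k E)); last exact: rnorm_continuous.
by apply: cvgD; [exact: cF|exact: cvg_cst].
Qed.

(** Finitely many translates of the interior of [V] cover [Q], and [seqDU] makes them disjoint. The
    tag [t i] lies in [Q], but not necessarily in its own piece [A i]. *)
Lemma borel_partition Q V : compact Q -> nbhs (1%g : G) V ->
  exists n (A : 'I_n -> set (borel G)) (t : 'I_n -> G),
  [/\ finite_sets mu A, trivIset setT A, (forall i, A i `<=` Q /\ Q (t i)),
      (forall i x, A i x -> V ((t i)^-1 * x)%g) &
      (forall x, Q x -> exists i, A i x)].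
Proof.
move=> cQ V1; have V1' : nbhs (1%g : G) V^° by exact: nbhs_interior.
have [s [sQ Qs]] := compact_translates_cover cQ V1'.
pose F j : set (borel G) := if (j < size s)%N then Q `&` [set x | V^° ((nth 1%g s j)^-1 * x)%g] else set0.
have mF j : measurable (F j).
  rewrite /F; case: ifP => // _; apply: measurableI; first exact: compact_borel.
  by rewrite -lcosetE; apply: open_borel; apply: open_lcoset; exact: open_interior.
have FQ j : F j `<=` Q by rewrite /F; case: ifP => // _ x [].
exists (size s), (fun i => seqDU F i), (fun i => nth 1%g s i); split.
- move=> i; split; first exact: seqDU_measurable.
  apply: le_lt_trans (mu_fin cQ); apply: le_measure.
  + by apply/mem_set; exact: seqDU_measurable.
  + by apply/mem_set; exact: compact_borel.
  + by apply: subset_trans (@FQ i); exact: subset_seqDU.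
- move=> i j _ _ ij; apply: val_inj; apply: (@trivIset_seqDU _ F) => //.
- move=> i; split; last by apply: sQ; exact: mem_nth.
  by apply: subset_trans (@FQ i); exact: subset_seqDU.
- move=> i x Ax; have := subset_seqDU Ax; rewrite /F ltn_ord => -[_].
  exact: interior_subset.
- move=> x Qx; have [t ts tx] := Qs x Qx.
  have : (\bigcup_j F j) x.
    by exists (index t s) => //; rewrite /F index_mem ts nth_index.
  rewrite seqDU_bigcup_eq => -[j _ jx].
  have js : (j < size s)%N.
    by rewrite ltnNge; apply/negP => sj; move: (subset_seqDU jx); rewrite /F ltnNge sj.
  by exists (Ordinal js).
Qed.

Lemma simple_partE (E : normedModType K) n (A : 'I_n -> set (borel G)) (w : 'I_n -> E) i x :
  trivIset setT A -> A i x -> simple A w x = w i.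
Proof.
move=> tA Ax; rewrite /simple (bigD1 i)//= big1 => [|j ji].
  by rewrite addr0 indicE mem_set// scale1r.
rewrite indicE (_ : x \in A j = false) ?scale0r//.
apply/negP => /set_mem Ajx; move/eqP: ji; apply; apply: tA => //.
by exists x.
Qed.

Lemma simple_part0 (E : normedModType K) n (A : 'I_n -> set (borel G)) (w : 'I_n -> E) x :
  (forall i, ~ A i x) -> simple A w x = 0.
Proof.
move=> Ax; rewrite /simple big1// => i _.
by rewrite indicE (_ : x \in A i = false) ?scale0r//; apply/negP => /set_mem /Ax.
Qed.

Section Partitions.
Context (Q : set G) (cQ : compact Q) (n : nat) (A : 'I_n -> set (borel G)).
Hypotheses (mA : finite_sets mu A) (tA : trivIset setT A).
Hypotheses (AQ : forall i, A i `<=` Q) (QA : forall x, Q x -> exists i, A i x).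

(** The pointwise error has two terms because a product [f x *: H x] varies in two ways: the
    variation of [f] costs a constant, that of [H] a multiple of [|f x|]. *)
Lemma partition_integral (E : normedModType K) (F : G -> E) (w : 'I_n -> E)
    (f : G -> K) (a b : R) : continuous F -> vanishes_off Q F ->
  continuous (f : G -> K^o) -> 0 <= a -> 0 <= b ->
  (forall i x, A i x -> rnorm (F x - w i) <= a + b * rnorm (f x : K^o)) ->
  (\int[mu]_x (rnorm (F x - simple A w x))%:E <=
   a%:E * mu Q + b%:E * L1norm mu f)%E.
Proof.
move=> cF FQ cf a0 b0 FA.
have mQ : measurable (Q : set (borel G)) by exact: compact_borel.
have mf : measurable_fun setT (fun x : borel G => (rnorm (f x : K^o))%:E).
  apply: dist_measurable_norm; exact: continuous_dist_measurable.
apply: (@le_trans _ _ (\int[mu]_x (a%:E * (\1_Q x)%:E + b%:E * (rnorm (f x : K^o))%:E))%E).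
  apply: ge0_le_integral => //.
  - by move=> x _; rewrite lee_fin rnorm_ge0.
  - apply: dist_measurable_norm; apply: dist_measurable_subs => //.
    exact: continuous_dist_measurable.
  - apply: emeasurable_funD; apply: measurable_funeM => //.
    by apply/measurable_EFinP; exact: measurable_indic.
  - move=> x _; rewrite -!EFinM -EFinD lee_fin.
    have [Qx|Qx] := pselect (Q x); last first.
      rewrite FQ// simple_part0 => [|i /AQ//]; rewrite subr0 rnorm0.
      by rewrite indicE addr_ge0// mulr_ge0// rnorm_ge0.
    have [i Ax] := QA Qx; rewrite (simple_partE _ tA Ax) indicE mem_set// mulr1.
    exact: FA.
rewrite ge0_integralD//.
- rewrite ge0_integralZl_EFin//.
  + rewrite ge0_integralZl_EFin//; last by move=> x _; rewrite lee_fin rnorm_ge0.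
    by rewrite integral_indic// setIT.
  + by apply/measurable_EFinP; exact: measurable_indic.
- by move=> x _; rewrite mule_ge0// lee_fin.
- by apply: measurable_funeM; apply/measurable_EFinP; exact: measurable_indic.
- by move=> x _; rewrite mule_ge0// lee_fin// rnorm_ge0.
- exact: measurable_funeM.
Qed.

End Partitions.

Lemma is_bochner_lim (E : normedModType K) (F : G -> E) y :
  is_bochner mu F y -> bochner_lim mu (F : borel G -> E) y.
Proof. by move=> Fy e /Fy[n [A [c [mA _ FA yA]]]]; exists n, A, c; split. Qed.

Definition measQ (Q : set G) : R := fine (mu Q).

Lemma measQ_ge0 Q : 0 <= measQ Q. Proof. exact: fine_ge0. Qed.

Lemma measQE Q : compact Q -> mu Q = (measQ Q)%:E.
Proof. by move=> cQ; rewrite fineK// ge0_fin_numE// mu_fin. Qed.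

(** By uniform continuity, tagged partitions give simple functions within [1 / (m + 1)] of [F] in
    mean. Their integrals form a Cauchy sequence, and its limit is the integral. *)
Lemma bochner_exists (E : normedModType K) (F : G -> E) Q : rnorm_complete E ->
  compact Q -> continuous F -> vanishes_off Q F -> exists y, is_bochner mu F y.
Proof.
move=> hE cQ cF FQ.
pose q := measQ Q + 1; have q0 : 0 < q by rewrite ltr_wpDl// measQ_ge0.
have H (m : nat) : exists z : {n : nat & (('I_n -> set (borel G)) * ('I_n -> E))%type},
    [/\ finite_sets mu (projT2 z).1, trivIset setT (projT2 z).1 &
      (\int[mu]_x (rnorm (F x - simple (projT2 z).1 (projT2 z).2 x))%:E <
        (m.+1%:R^-1)%:E)%E].
  pose a : R := m.+1%:R^-1 / q.
  have a0 : 0 < a by rewrite divr_gt0// invr_gt0.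
  have [n [A [t [mA tA AQ AV QA]]]] := borel_partition cQ (unif_cont_mulgr cF cQ a0).
  exists (existT _ n (A, fun i => F (t i))); split => //=.
  apply: le_lt_trans (@partition_integral Q cQ n A mA tA (fun i => (AQ i).1) QA E F
    (fun i => F (t i)) (fun=> 0) a 0 cF FQ _ (ltW a0) (lexx _) _) _.
  - by move=> x; exact: cvg_cst.
  - move=> i x Ax; rewrite mul0r addr0 ltW//.
    by have := AV i x Ax _ (AQ i).2; rewrite mulVKg.
  - rewrite mul0e adde0 measQE// -EFinM lte_fin /a -mulrA gtr_pMr ?invr_gt0//.
    by rewrite mulrC ltr_pdivrMr// mul1r ltrDl.
have [z zP] := choice H.
pose y m := simple_integral mu (projT2 (z m)).1 (projT2 (z m)).2.
have mF := continuous_dist_measurable cF.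
have yC m m' : rnorm (y m - y m') <= m.+1%:R^-1 + m'.+1%:R^-1.
  have [mA _ FA] := zP m; have [mB _ FB] := zP m'.
  rewrite -lee_fin.
  apply: (@le_trans _ _ (\int[mu]_x (rnorm (simple (projT2 (z m)).1 (projT2 (z m)).2 x
      - simple (projT2 (z m')).1 (projT2 (z m')).2 x))%:E)%E).
    apply: bochner_lim_approx => //; first exact: dist_measurable_simple.
    exact: bochner_lim_simple.
  apply: (@le_trans _ _ (\int[mu]_x (rnorm
     (- (F x - simple (projT2 (z m)).1 (projT2 (z m)).2 x) +
       (F x - simple (projT2 (z m')).1 (projT2 (z m')).2 x)))%:E)%E).
    by under [in leRHS]eq_integral do rewrite opprB subrKA.
  apply: le_trans (integral_rnormD mu _ _ _) _.
  - by apply: dist_measurableN; exact: dist_measurable_subs.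
  - exact: dist_measurable_subs.
  - under eq_fun do rewrite opprB subrKA.
    by apply: dist_measurable_subs => //; exact: dist_measurable_simple.
  - under eq_integral do rewrite rnormN.
    by rewrite EFinD leeD// ltW.
have inv_small (e : R) : 0 < e -> exists N, forall m, (N <= m)%N -> m.+1%:R^-1 < e.
  move=> e0; have [N _ NP] := near_infty_natSinv_lt (PosNum e0).
  by exists N => m Nm; apply: NP.
have /hE[l yl] : forall e : R, 0 < e -> exists N, forall m n, (N <= m)%N ->
    (N <= n)%N -> rnorm (y m - y n) < e.
  move=> e e0; have [|N NP] := inv_small (e / 2); first by rewrite divr_gt0.
  exists N => m m' Nm Nm'; rewrite (le_lt_trans (yC m m'))// (splitr e).
  by rewrite ltrD// NP.
exists l => e e0.
have [N NP] := inv_small e e0; have [N' N'P] := yl e e0.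
pose m := maxn N N'.
have [mA tA FA] := zP m.
exists (projT1 (z m)), (projT2 (z m)).1, (projT2 (z m)).2; split => //.
  by apply: lt_trans FA _; rewrite lte_fin NP// leq_maxl.
by rewrite rdistC; apply: N'P; rewrite leq_maxr.
Qed.

Section Properties.
Context (E : normedModType K) (hE : rnorm_complete E).
Implicit Types (F H : G -> E) (Q : set G).

Lemma bochnerP F Q : compact Q -> continuous F -> vanishes_off Q F ->
  bochner_lim mu (F : borel G -> E) (bochner mu F).
Proof.
move=> cQ cF FQ; apply: is_bochner_lim; apply: (@xgetPex _ 0 [set y | is_bochner mu F y]).
exact: (bochner_exists hE cQ).
Qed.

Lemma bochnerE F Q y : compact Q -> continuous F -> vanishes_off Q F ->
  bochner_lim mu (F : borel G -> E) y -> bochner mu F = y.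
Proof.
move=> cQ cF FQ; apply: bochner_lim_unique; last exact: (bochnerP cQ).
exact: continuous_dist_measurable.
Qed.

Lemma bochnerD F H Q : compact Q -> continuous F -> vanishes_off Q F ->
  continuous H -> vanishes_off Q H ->
  bochner mu (fun x => F x + H x) = bochner mu F + bochner mu H.
Proof.
move=> cQ cF FQ cH HQ.
have cFH : continuous (fun x => F x + H x).
  by move=> x; apply: cvgD; [exact: cF|exact: cH].
apply: (bochnerE cQ) => // [x Qx|]; first by rewrite FQ// HQ// addr0.
by apply: bochner_limD; try exact: continuous_dist_measurable; exact: (bochnerP cQ).
Qed.

Lemma bochner_approx F Q n (A : 'I_n -> set (borel G)) (w : 'I_n -> E) (f : G -> K)
    (a b l : R) : compact Q -> finite_sets mu A -> trivIset setT A ->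
  (forall i, A i `<=` Q) -> (forall x, Q x -> exists i, A i x) ->
  continuous F -> vanishes_off Q F ->
  continuous (f : G -> K^o) -> 0 <= a -> 0 <= b -> (L1norm mu f <= l%:E)%E ->
  (forall i x, A i x -> rnorm (F x - w i) <= a + b * rnorm (f x : K^o)) ->
  rnorm (bochner mu F - simple_integral mu A w) <= a * measQ Q + b * l.
Proof.
move=> cQ mA tA AQ QA cF FQ cf a0 b0 fl FA; rewrite -lee_fin.
apply: (le_trans (bochner_lim_approx w mA (continuous_dist_measurable cF) (bochnerP cQ cF FQ))).
apply: (le_trans (partition_integral cQ mA tA AQ QA cF FQ cf a0 b0 FA)).
by rewrite measQE// EFinD !EFinM leeD2l// lee_wpmul2l.
Qed.

(** This is [bochner_approx] with the zero simple function on an arbitrary partition. *)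
Lemma bochner_norm F Q C : compact Q -> continuous F -> vanishes_off Q F ->
  0 <= C -> (forall x, Q x -> rnorm (F x) <= C) -> rnorm (bochner mu F) <= C * measQ Q.
Proof.
move=> cQ cF FQ C0 FC.
have [n [A [t [mA tA AQ _ QA]]]] := borel_partition cQ (@filterT _ (nbhs (1%g : G)) _).
have := @bochner_approx F Q n A (fun=> 0) (fun=> 0) C 0 0 cQ mA tA
  (fun i => (AQ i).1) QA cF FQ.
rewrite /simple_integral big1 => [|i _]; last by rewrite scaler0.
rewrite !mul0r !addr0 !subr0; apply => //; first by move=> x; exact: cvg_cst.
  rewrite /L1norm; under eq_integral do rewrite rnorm0.
  by rewrite integral0.
by move=> i x /(AQ i).1/FC; rewrite subr0.
Qed.

Lemma bochner0 : bochner mu (fun=> 0 : E) = 0.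
Proof.
apply: rnorm_le_eq0 => e e0; rewrite (le_trans (@bochner_norm _ set0 0 _ _ _ _ _))//.
- exact: compact0.
- by move=> x; exact: cvg_cst.
- by rewrite mul0r ltW.
Qed.

End Properties.

Lemma bochner_linear (E E' : normedModType K) (L : {linear E -> E'}) (C : R)
    (F : G -> E) Q : rnorm_complete E -> rnorm_complete E' ->
  (forall x, rnorm (L x) <= C * rnorm x) ->
  compact Q -> continuous F -> vanishes_off Q F ->
  bochner mu (fun x => L (F x)) = L (bochner mu F).
Proof.
move=> hE hE' LC cQ cF FQ.
have cL : continuous L.
  move=> x; apply/cvg_rnormP => e e0; apply/nbhs_rnormP.
  exists (e / (`|C| + 1)) => [|y]; first by rewrite divr_gt0// ltr_wpDl.
  rewrite ltr_pdivlMr ?ltr_wpDl// => xy; rewrite -linearB (le_lt_trans (LC _))//.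
  apply: le_lt_trans xy; rewrite mulrC ler_wpM2l ?rnorm_ge0//.
  by rewrite (le_trans (ler_norm C))// lerDl.
have cLF : continuous (fun x => L (F x)).
  by move=> x; apply: (@cvg_comp _ _ _ F L); [exact: cF|exact: cL].
apply: (bochnerE hE' cQ) => //; first by move=> x /FQ ->; rewrite linear0.
apply: (bochner_lim_linear LC); try exact: continuous_dist_measurable.
exact: (bochnerP hE cQ).
Qed.

End Integration.

Section Integration2.
Context (R : realType) (k : scalar_kind) (G : topologicalGroupType).
Local Notation K := (scalar_field R k).
Context (mu : {measure set (borel G) -> \bar R}).
Context (hG : hausdorff_space G).
Context (mu_fin : forall Q : set G, compact Q -> (mu Q < +oo)%E).
Local Notation Bochner := (bochner mu).

Lemma continuous_scale (E : normedModType K) (f : G -> K) (F : G -> E) :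
  continuous (f : G -> K^o) -> continuous F -> continuous (fun x => f x *: F x).
Proof. by move=> cf cF x; apply: cvgZ; [exact: cf|exact: cF]. Qed.

Lemma continuous_const (E : normedModType K) (y : E) : continuous (fun _ : G => y).
Proof. by move=> x; exact: cvg_cst. Qed.

Lemma vanishes_scale (E : normedModType K) Q (f : G -> K) (F : G -> E) :
  vanishes_off Q (f : G -> K^o) -> vanishes_off Q (fun x => f x *: F x).
Proof. by move=> fQ x /fQ ->; rewrite scale0r. Qed.

Lemma bochner_map (E E' : normedModType K) (L : E -> E') (C : R)
    (F : G -> E) Q : rnorm_complete E -> rnorm_complete E' ->
  (forall a x y, L (a *: x + y) = a *: L x + L y) ->
  (forall x, rnorm (L x) <= C * rnorm x) ->
  compact Q -> continuous F -> vanishes_off Q F ->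
  Bochner (fun x => L (F x)) = L (Bochner F).
Proof.
move=> hE hE' linL.
pose lL := GRing.isLinear.Build K E E' *:%R L linL.
pose L' : {linear E -> E'} := HB.pack L lL.
exact: (bochner_linear hG mu_fin (L := L') hE hE').
Qed.

Section OneSpace.
Context (E : normedModType K) (hE : rnorm_complete E).
Implicit Types (F H : G -> E) (Q : set G).

Lemma bochnerZ (a : K) F Q : compact Q -> continuous F -> vanishes_off Q F ->
  Bochner (fun x => a *: F x) = a *: Bochner F.
Proof.
apply: (bochner_map (C := rnorm (a : K^o))) => // [b x y|x]; last by rewrite rnormZ.
by rewrite scalerDr !scalerA mulrC.
Qed.

Lemma bochnerN F Q : compact Q -> continuous F -> vanishes_off Q F ->
  Bochner (fun x => - F x) = - Bochner F.
Proof.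
move=> cQ cF FQ; rewrite -scaleN1r -(bochnerZ _ cQ)//; congr bochner.
by apply/funext => x; rewrite scaleN1r.
Qed.

Lemma bochnerB F H Q : compact Q -> continuous F -> vanishes_off Q F ->
  continuous H -> vanishes_off Q H ->
  Bochner (fun x => F x - H x) = Bochner F - Bochner H.
Proof.
move=> cQ cF FQ cH HQ; rewrite -(bochnerN cQ)// -(bochnerD hG mu_fin hE cQ)//.
  by move=> x; apply: cvgN; exact: cH.
by move=> x /HQ ->; rewrite oppr0.
Qed.

Lemma continuous_sum I (s : seq I) (F : I -> G -> E) :
  (forall i, continuous (F i)) -> continuous (fun x => \sum_(i <- s) F i x).
Proof.
move=> cF; elim: s => [|i s ih] x.
  by under eq_fun do rewrite big_nil; exact: cvg_cst.
under eq_fun do rewrite big_cons.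
by apply: cvgD; [exact: cF|exact: ih].
Qed.

Lemma bochner_sum I (s : seq I) (F : I -> G -> E) Q : compact Q ->
  (forall i, continuous (F i)) -> (forall i, vanishes_off Q (F i)) ->
  Bochner (fun x => \sum_(i <- s) F i x) = \sum_(i <- s) Bochner (F i).
Proof.
move=> cQ cF FQ; elim: s => [|i s ih].
  by rewrite big_nil; under eq_fun do rewrite big_nil; exact: bochner0.
rewrite big_cons -ih -(bochnerD hG mu_fin hE cQ)//.
- by congr bochner; apply/funext => x; rewrite big_cons.
- exact: continuous_sum.
- by move=> x Qx; rewrite big1// => j _; rewrite FQ.
Qed.

Lemma bochner_scale_norm (f : G -> K) F Q B l : compact Q ->
  continuous (f : G -> K^o) -> vanishes_off Q (f : G -> K^o) -> continuous F ->
  0 <= B -> (forall x, Q x -> rnorm (F x) <= B) -> (L1norm mu f <= l%:E)%E ->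
  rnorm (Bochner (fun x => f x *: F x)) <= B * l.
Proof.
move=> cQ cf fQ cF B0 FB fl.
have [n [A [t [mA tA AQ _ QA]]]] := borel_partition hG mu_fin cQ (@filterT _ (nbhs (1%g : G)) _).
have := @bochner_approx _ _ _ mu hG mu_fin E hE (fun x => f x *: F x) Q n A (fun=> 0) f 0 B l
  cQ mA tA (fun i => (AQ i).1) QA (continuous_scale cf cF) (vanishes_scale _ fQ) cf (lexx _) B0 fl.
rewrite /simple_integral big1 => [|i _]; last by rewrite scaler0.
rewrite subr0 mul0r !add0r; apply => i x /(AQ i).1/FB FxB.
by rewrite subr0 add0r rnormZ mulrC ler_wpM2r// rnorm_ge0.
Qed.

(* Riemann sums for two functions that differ by a left translation can be taken
   with the same weights. *)
Lemma bochner_lcoset (mu_inv : forall (g : G) (A : set (borel G)), measurable A ->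
    mu [set (g * x)%g | x in A] = mu A) g F Q :
  compact Q -> continuous F -> vanishes_off Q F ->
  Bochner (fun x => F (g * x)%g) = Bochner F.
Proof.
move=> cQ cF FQ; apply/eqP; rewrite -subr_eq0; apply/eqP.
apply: rnorm_le_eq0 => e e0.
pose q := measQ mu Q + measQ mu [set (g^-1 * x)%g | x in Q] + 1.
have q0 : 0 < q by rewrite ltr_wpDl// addr_ge0// measQ_ge0.
have a0 : 0 < e / q by rewrite divr_gt0.
have cgQ := compact_lcoset (g := g^-1%g) cQ.
have [n [A [t [mA tA AQ AV QA]]]] := borel_partition hG mu_fin cQ (unif_cont_mulgr cF cQ a0).
have FA i x : A i x -> rnorm (F x - F (t i)) <= e / q + 0 * rnorm (0 : K^o).
  move=> Ax; rewrite mul0r addr0 ltW//.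
  by have := AV i x Ax _ (AQ i).2; rewrite mulVKg.
have cF' : continuous (fun x => F (g * x)%g).
  by move=> x; apply: (@cvg_comp _ _ _ (fun x => (g * x)%g) F); [exact: mulgl_continuous|exact: cF].
have L0 : (L1norm mu (fun=> 0%R : K) <= 0%:E)%E.
  by rewrite /L1norm; under eq_integral do rewrite rnorm0; rewrite integral0.
have h1 := @bochner_approx _ _ _ mu hG mu_fin E hE F Q n A (fun i => F (t i)) (fun=> 0) (e / q) 0 0
  cQ mA tA (fun i => (AQ i).1) QA cF FQ (@continuous_const K^o 0) (ltW a0) (lexx _) L0 FA.
have h2 := @bochner_approx _ _ _ mu hG mu_fin E hE (fun x => F (g * x)%g) [set (g^-1 * x)%g | x in Q] n
  (fun i => [set (g^-1 * x)%g | x in A i]) (fun i => F (t i)) (fun=> 0) (e / q) 0 0 cgQ.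
have : rnorm (Bochner (fun x => F (g * x)%g) - simple_integral mu A (fun i => F (t i)))
    <= e / q * measQ mu [set (g^-1 * x)%g | x in Q] + 0 * 0.
  rewrite (_ : simple_integral mu A _ = simple_integral mu
      (fun i => [set (g^-1 * x)%g | x in A i]) (fun i => F (t i))); last first.
    by apply: eq_bigr => i _; rewrite mu_inv//; case: (mA i).
  apply: h2 => //.
  - move=> i; split; first by apply: measurable_lcoset; case: (mA i).
    by rewrite mu_inv; case: (mA i).
  - move=> i j _ _ [_ [[x Aix <-] [y Ajy /mulgI xy]]]; apply: tA => //.
    by exists x; split => //; rewrite -xy.
  - by move=> i _ [x /(AQ i).1 Qx <-]; exists x.
  - by move=> _ [x /QA[i Ax] <-]; exists i; exists x.
  - move=> x Qx; apply: FQ => Qgx; apply: Qx; exists (g * x)%g => //.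
    by rewrite mulKg.
  - exact: continuous_const.
  - exact: ltW.
  - by move=> i _ [x Ax <-]; rewrite mulVKg; exact: FA.
rewrite mulr0 addr0 => h3; rewrite mulr0 addr0 in h1.
apply: le_trans (ler_rdist (simple_integral mu A (fun i => F (t i))) _ _) _.
rewrite [X in _ + X]rdistC (le_trans (lerD h3 h1))// -mulrDr.
rewrite -mulrA ger_pMr// mulrC ler_pdivrMr// mul1r /q addrC.
by rewrite lerDl.
Qed.

End OneSpace.

(* The weights do not depend on the integrand, so that they can be used
   simultaneously in several Banach spaces. *)
Lemma riemann_sum (f : G -> K) Q V (e l : R) : compact Q ->
  continuous (f : G -> K^o) -> vanishes_off Q (f : G -> K^o) ->
  (L1norm mu f <= l%:E)%E -> nbhs (1%g : G) V -> 0 < e ->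
  exists n (t : 'I_n -> G) (c : 'I_n -> K),
  [/\ (forall i, Q (t i)), \sum_i rnorm (c i : K^o) <= l + e &
    forall (E : normedModType K) (H : G -> E) (e' B : R), rnorm_complete E ->
      continuous H -> 0 <= e' -> 0 <= B ->
      (forall i x, Q x -> V ((t i)^-1 * x)%g -> rnorm (H x - H (t i)) <= e') ->
      (forall x, Q x -> rnorm (H x) <= B) ->
      rnorm (Bochner (fun x => f x *: H x) - \sum_i c i *: H (t i)) <= e' * l + e * B].
Proof.
move=> cQ cf fQ fl V1 e0.
pose q := measQ mu Q + 1; have q0 : 0 < q by rewrite ltr_wpDl// measQ_ge0.
have a0 : 0 < e / q by rewrite divr_gt0.
have eq : e / q * measQ mu Q <= e.
  by rewrite -mulrA ger_pMr// mulrC ler_pdivrMr// mul1r lerDl.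
have [n [A [t [mA tA AQ AV QA]]]] :=
  borel_partition hG mu_fin cQ (filterI (unif_cont_mulgr cf cQ a0) V1).
have fA i x : A i x -> rnorm (f x - f (t i) : K^o) <= e / q.
  by move=> /(AV i x)[/(_ _ (AQ i).2)]; rewrite mulVKg => /ltW.
pose m i := fine (mu (A i)).
exists n, t, (fun i => of_real k (m i) * f (t i)); split.
- by move=> i; case: (AQ i).
(* The sum of the [|c i|] is itself a Riemann sum, for [|f|], hence within [e] of the norm of [f] in
   [L^1]. *)
- pose F x : K^o := of_real k (rnorm (f x : K^o)).
  have cF : continuous F.
    move=> x; apply/cvg_rnormP => d d0.
    have /cvg_rnormP/(_ _ d0) := cf x; apply: filterS => y.
    rewrite /F -of_realB rnorm_of_real; apply: le_lt_trans.
    exact: ler_rnorm_dist.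
  have L0 : (L1norm mu (fun=> 0%R : K) <= 0%:E)%E.
    by rewrite /L1norm; under eq_integral do rewrite rnorm0; rewrite integral0.
  have hK := @rnorm_complete_scalar R k.
  have FQ : vanishes_off Q F by move=> x /fQ fx; rewrite /F fx rnorm0 of_real0.
  have := @bochner_approx _ _ _ mu hG mu_fin K^o hK F Q n A (fun i => F (t i)) (fun=> 0) (e / q) 0 0
    cQ mA tA (fun i => (AQ i).1) QA cF FQ (@continuous_const K^o 0) (ltW a0) (lexx _) L0.
  rewrite !mul0r !addr0 => H.
  have {}H : (forall i x, A i x -> rnorm (F x - F (t i)) <= e / q) ->
      rnorm (Bochner F - simple_integral mu A (fun i => F (t i))) <= e.
    by move=> /H /le_trans; apply.
  have Fl : rnorm (Bochner F) <= l.
    rewrite (_ : Bochner F = Bochner (fun x => F x *: (1 : K^o))).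
      have := @bochner_scale_norm _ hK F (fun=> 1) Q 1 l cQ cF FQ
        (@continuous_const K^o 1) ler01.
      rewrite mul1r; apply; first by move=> x _; rewrite rnorm1.
      rewrite /L1norm; under eq_integral do rewrite rnorm_of_real ger0_norm ?rnorm_ge0//.
      exact: fl.
    by congr bochner; apply/funext => x; rewrite /GRing.scale /= mulr1.
  rewrite (_ : \sum_i _ = rnorm (simple_integral mu A (fun i => F (t i)))).
    rewrite -[simple_integral _ _ _](subrK (Bochner F)).
    rewrite (le_trans (ler_rnormD _ _))// addrC lerD// rdistC; apply: H => i x Ax.
    rewrite /F -of_realB rnorm_of_real.
    exact: le_trans (ler_rnorm_dist _ _) (fA i x Ax).
  rewrite /simple_integral /F.
  under [in RHS]eq_bigr do rewrite /GRing.scale /= -of_realM.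
  rewrite -of_real_sum rnorm_of_real ger0_norm; last first.
    by apply: sumr_ge0 => i _; rewrite mulr_ge0 ?fine_ge0 ?rnorm_ge0.
  by apply: eq_bigr => i _; rewrite rnormM rnorm_of_real ger0_norm// fine_ge0.
- move=> E H e' B hE cH e'0 B0 HV HB.
  have := @bochner_approx _ _ _ mu hG mu_fin E hE (fun x => f x *: H x) Q n A
   (fun i => f (t i) *: H (t i)) f (e / q * B) e' l
    cQ mA tA (fun i => (AQ i).1) QA (continuous_scale cf cH) (vanishes_scale _ fQ) cf
     (mulr_ge0 (ltW a0) B0) e'0 fl.
  rewrite /simple_integral; under eq_bigr do rewrite scalerA.
  move=> h; apply: (le_trans (h _)) => [i x Ax|].
    rewrite -[f x *: H x](subrK (f x *: H (t i))) -addrA -scalerBr -scalerBl.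
    rewrite (le_trans (ler_rnormD _ _))// addrC !rnormZ lerD//.
      by rewrite ler_pM ?rnorm_ge0 ?fA// HB//; case: (AQ i).
    rewrite mulrC ler_wpM2r ?rnorm_ge0// HV//; first exact: (AQ i).1.
    by case: (AV i x Ax).
  by rewrite addrC lerD2l mulrAC ler_wpM2r.
Qed.

End Integration2.

(** * Convolution *)

Section Convolution.
Context (R : realType) (k : scalar_kind) (G : topologicalGroupType).
Local Notation K := (scalar_field R k).
Context (mu : {measure set (borel G) -> \bar R}).
Context (hG : hausdorff_space G).
Context (mu_fin : forall Q : set G, compact Q -> (mu Q < +oo)%E).
Context (mu_inv : forall (g : G) (A : set (borel G)), measurable A ->
    mu [set (g * x)%g | x in A] = mu A).
Local Notation Bochner := (bochner mu).

Lemma Cc_vanishes (f : G -> K) : vanishes_off (supp f) (f : G -> K^o).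
Proof.
move=> x fx; apply/eqP; apply: contrapT => /negP f0; apply: fx.
exact: subset_closure.
Qed.

Lemma vanishes_Cc (f : G -> K) Q : compact Q -> continuous (f : G -> K^o) ->
  vanishes_off Q (f : G -> K^o) -> Cc f.
Proof.
move=> cQ cf fQ; split => //.
apply: (subclosed_compact _ cQ); first exact: closed_closure.
have /closure_id -> := compact_closed hG cQ.
apply: closureS => x /= /eqP fx; apply: contrapT => /fQ; exact: fx.
Qed.

Lemma L1norm_fin (f : G -> K) Q : compact Q -> continuous (f : G -> K^o) ->
  vanishes_off Q (f : G -> K^o) -> exists2 l : R, 0 <= l & (L1norm mu f <= l%:E)%E.
Proof.
move=> cQ cf fQ; have [C C0 fC] := rnorm_compact_bounded cf cQ.
have [n [A [t [mA tA AQ _ QA]]]] := borel_partition hG mu_fin cQ (@filterT _ (nbhs (1%g : G)) _).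
exists (C * measQ mu Q); first by rewrite mulr_ge0// measQ_ge0.
have := @partition_integral R k G mu hG Q cQ n A mA tA (fun i => (AQ i).1) QA K^o f
  (fun=> 0) (fun=> 0) C 0 cf fQ (@continuous_const R k G K^o 0) C0 (lexx _).
rewrite mul0e adde0 (measQE mu_fin cQ) -EFinM /L1norm.
under eq_integral => x _.
  rewrite /simple big1 => [|i _]; last by rewrite scaler0.
  rewrite subr0; over.
apply => i x /(AQ i).1 /fC; by rewrite subr0 rnorm0 mul0r addr0.
Qed.

Section Fubini.
Context (f1 f2 : G -> K) (Q1 Q2 : set G).
Context (cQ1 : compact Q1) (cQ2 : compact Q2).
Context (cf1 : continuous (f1 : G -> K^o)) (cf2 : continuous (f2 : G -> K^o)).
Context (f1Q : vanishes_off Q1 (f1 : G -> K^o)).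
Context (f2Q : vanishes_off Q2 (f2 : G -> K^o)).
Local Notation Q12 := [set (x * y)%g | x in Q1 & y in Q2].

Let f2x x : continuous (fun y => f2 (y^-1 * x)%g : K^o).
Proof.
move=> y; apply: (@cvg_comp _ _ _ (fun y => (y^-1 * x)%g) (f2 : G -> K^o)).
  by apply: cvg_mulg; [exact: (@invg_continuous G)|exact: cvg_cst].
exact: cf2.
Qed.

Lemma f2l (y : G) : continuous (fun x => f2 (y^-1 * x)%g : K^o).
Proof.
move=> x; apply: (@cvg_comp _ _ _ (fun x => (y^-1 * x)%g) (f2 : G -> K^o)).
  exact: mulgl_continuous.
exact: cf2.
Qed.

Lemma convolutionE x : convolution mu f1 f2 x =
  Bochner (fun y => f1 y *: (f2 (y^-1 * x)%g : K^o)).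
Proof. by []. Qed.

Lemma convolution_vanishes : vanishes_off Q12 (convolution mu f1 f2 : G -> K^o).
Proof.
move=> x Qx; rewrite /convolution /integral_Cc (_ : (fun y => _) = fun=> 0).
  exact: bochner0 (@rnorm_complete_scalar R k).
apply/funext => y; have [Qy|/f1Q ->] := pselect (Q1 y); last by rewrite mul0r.
rewrite [X in _ * X]f2Q ?mulr0// => Qyx; apply: Qx; exists y => //.
by exists (y^-1 * x)%g => //; rewrite mulVKg.
Qed.

Lemma convolution_continuous : continuous (convolution mu f1 f2 : G -> K^o).
Proof.
move=> x; apply/cvg_rnormP => e e0.
have [l l0 f1l] := L1norm_fin cQ1 cf1 f1Q.
have cC : compact [set (y * x)%g | y in [set (y^-1)%g | y in Q1]].
  apply: continuous_compact; last exact: compact_invg.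
  by apply: continuous_subspaceT; exact: mulgr_continuous.
have d0 : 0 < e / (l + 1) by rewrite divr_gt0// ltr_wpDl.
have := nbhs_lcoset x (unif_cont_mulgr cf2 cC d0).
apply: filterS => z /= zP.
have hK := @rnorm_complete_scalar R k.
rewrite !convolutionE.
have -> : Bochner (fun y => f1 y *: (f2 (y^-1 * z)%g : K^o)) -
    Bochner (fun y => f1 y *: (f2 (y^-1 * x)%g : K^o)) =
    Bochner (fun y => f1 y *: (f2 (y^-1 * z)%g - f2 (y^-1 * x)%g : K^o)).
  rewrite -(bochnerB hG mu_fin hK cQ1).
  - by congr bochner; apply/funext => y; rewrite scalerBr.
  - exact: (continuous_scale cf1 (@f2x z)).
  - exact: (vanishes_scale (fun y => f2 (y^-1 * z)%g : K^o) f1Q).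
  - exact: (continuous_scale cf1 (@f2x x)).
  - exact: (vanishes_scale (fun y => f2 (y^-1 * x)%g : K^o) f1Q).
apply: le_lt_trans (bochner_scale_norm hG mu_fin hK cQ1 cf1 f1Q _ (ltW d0) _ f1l) _.
- by move=> y; apply: cvgB; exact: f2x.
- move=> y Qy; apply: ltW; have /zP : [set (y * x)%g | y in [set (y^-1)%g | y in Q1]] (y^-1 * x)%g.
    by exists (y^-1)%g => //; exists y.
  by rewrite -mulgA mulVKg.
- by rewrite mulrAC -mulrA gtr_pMr// ltr_pdivrMr ?ltr_wpDl// mul1r ltrDl.
Qed.

Context (E : normedModType K) (hE : rnorm_complete E) (F : G -> E).
Hypothesis cF : continuous F.

Let H y := Bochner (fun z => f2 z *: F (y * z)%g).

(** Left invariance moves [y] from [F] to [f2], which has compact support; its uniform continuity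
    then controls the variation of [H]. *)
Let HE y : H y = Bochner (fun x => f2 (y^-1 * x)%g *: F x).
Proof.
rewrite -(@bochner_lcoset _ _ _ mu hG mu_fin E hE mu_inv y _ [set (y * x)%g | x in Q2]).
- by rewrite /H; congr bochner; apply/funext => z; rewrite mulKg.
- exact: compact_lcoset.
- exact: (continuous_scale (@f2l y) cF).
- move=> x Qx; rewrite (_ : f2 _ = 0) ?scale0r//; apply: f2Q => Qyx; apply: Qx.
  by exists (y^-1 * x)%g => //; rewrite mulVKg.
Qed.

Let H_dist (Q : set G) (B d : R) y y' : compact Q -> 0 <= B -> 0 <= d ->
  (forall x, Q x -> rnorm (F x) <= B) ->
  (forall x, Q2 (y^-1 * x)%g -> Q x) -> (forall x, Q2 (y'^-1 * x)%g -> Q x) ->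
  (forall x, rnorm (f2 (y^-1 * x)%g - f2 (y'^-1 * x)%g : K^o) <= d) ->
  rnorm (H y - H y') <= d * B * measQ mu Q.
Proof.
move=> cQ B0 d0 FB yQ y'Q f2d; rewrite !HE.
have v (z : G) : (forall x, Q2 (z^-1 * x)%g -> Q x) ->
    vanishes_off Q (fun x => f2 (z^-1 * x)%g *: F x).
  move=> zQ x Qx; rewrite (_ : f2 _ = 0) ?scale0r//.
  by apply: f2Q => /zQ.
have c z := continuous_scale (@f2l z) cF.
rewrite -(bochnerB hG mu_fin hE cQ); try by [exact: c|exact: v].
apply: (@bochner_norm _ _ _ _ hG mu_fin E hE _ Q (d * B) cQ).
- by move=> x; apply: cvgB; exact: c.
- by move=> x Qx; rewrite !v// subr0.
- exact: mulr_ge0.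
- by move=> x Qx; rewrite -scalerBl rnormZ ler_pM ?rnorm_ge0// FB.
Qed.

Lemma bochner_translate_continuous : locally_compact [set: G] ->
  continuous (fun y => Bochner (fun z => f2 z *: F (y * z)%g)).
Proof.
move=> /locally_compact_nbhs1[V0 V01 cV0] y; apply/cvg_rnormP => e e0.
pose Q := [set (y * x)%g | x in [set (v * x)%g | v in V0 & x in Q2]].
have cQ : compact Q by apply: compact_lcoset; exact: compact_mulg.
have [B B0 FB] := rnorm_compact_bounded cF cQ.
pose q := B * measQ mu Q + 1; have q0 : 0 < q.
  by rewrite ltr_wpDl// mulr_ge0// measQ_ge0.
have d0 : 0 < e / q by rewrite divr_gt0.
have V1 := near_invg1 (P := fun v => forall x, rnorm (f2 (v * x)%g - f2 x : K^o) < e / q)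
  (unif_cont_mulgl_supp cf2 cQ2 f2Q d0).
have V11 : nbhs (1%g : G) (V0 `&` (fun v => forall x,
    rnorm (f2 (v^-1 * x)%g - f2 x : K^o) < e / q)) by exact: filterI.
have := nbhs_lcoset y V11.
apply: filterS => z [V0z f2z].
apply: (@le_lt_trans _ _ (e / q * B * measQ mu Q)).
  apply: H_dist => //; first exact: ltW.
  - move=> x Qx; exists (y^-1 * x)%g; last by rewrite mulVKg.
    exists (y^-1 * z)%g => //; exists (z^-1 * x)%g => //.
    by rewrite -mulgA mulVKg.
  - move=> x Qx; exists (y^-1 * x)%g; last by rewrite mulVKg.
    exists 1%g; first exact: nbhs_singleton V01.
    by exists (y^-1 * x)%g => //; rewrite mul1g.
  - move=> x; have := f2z (y^-1 * x)%g; rewrite invgM invgK -mulgA mulVKg.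
    exact: ltW.
rewrite -!mulrA gtr_pMr// mulrC ltr_pdivrMr// mul1r ltrDl.
exact: ltr01.
Qed.

(** Fubini without product measures. One system of points [t i] and weights [c i] discretises the
    integral over [y] both for [H], with values in [E], and for the scalar function [f2 (y^-1 * x)],
    uniformly in [x]; a finite sum then commutes with the remaining integral. *)
Lemma bochner_convolution : locally_compact [set: G] ->
  Bochner (fun x => convolution mu f1 f2 x *: F x) =
  Bochner (fun y => f1 y *: Bochner (fun z => f2 z *: F (y * z)%g)).
Proof.
move=> lcG; have cH := bochner_translate_continuous lcG.
have [l l0 f1l] := L1norm_fin cQ1 cf1 f1Q.
have [B2 B20 f2B] := rnorm_compact_bounded cf2 cQ2.
have cQ12 : compact Q12 by exact: compact_mulg.
have [B B0 FB] := rnorm_compact_bounded cF cQ12.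
have [BH BH0 HB] := rnorm_compact_bounded cH cQ1.
have f2B' x : rnorm (f2 x : K^o) <= B2.
  by have [/f2B//|/f2Q ->] := pselect (Q2 x); rewrite rnorm0.
have hK := @rnorm_complete_scalar R k.
pose q := measQ mu Q12; have q0 : 0 <= q := measQ_ge0 mu _.
pose C := ((l + B2) * B * q) + (B * q * l + BH).
apply/eqP; rewrite -subr_eq0; apply/eqP; apply: rnorm_le_eq0 => e e0.
pose d := e / (C + 1).
have C0 : 0 <= C.
  by apply: addr_ge0; [|apply: addr_ge0]; rewrite ?mulr_ge0 ?addr_ge0.
have d0 : 0 < d by rewrite divr_gt0// ltr_wpDl.
have V1 := near_invg1 (P := fun v => forall x, rnorm (f2 (v * x)%g - f2 x : K^o) < d)
  (unif_cont_mulgl_supp cf2 cQ2 f2Q d0).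
have [n [t [c [tQ _ S]]]] := riemann_sum hG mu_fin cQ1 cf1 f1Q f1l V1 d0.
have f2t i x y : Q1 y ->
    (forall z, rnorm (f2 (((t i)^-1 * y)^-1 * z)%g - f2 z : K^o) < d) ->
    rnorm (f2 (y^-1 * x)%g - f2 ((t i)^-1 * x)%g : K^o) <= d.
  by move=> _ /(_ ((t i)^-1 * x)%g); rewrite invgM invgK -mulgA mulVKg => /ltW.
have Ht : rnorm (Bochner (fun y => f1 y *: H y) - \sum_i c i *: H (t i)) <=
    d * (B * q) * l + d * BH.
  have dBq : 0 <= d * (B * q) by exact: mulr_ge0 (ltW d0) (mulr_ge0 B0 q0).
  apply: S => //.
  move=> i y Qy Vy; rewrite mulrA.
  apply: H_dist => //; first exact: ltW.
  - by move=> x Qx; exists y => //; exists (y^-1 * x)%g => //; rewrite mulVKg.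
  - move=> x Qx; exists (t i) => //; exists ((t i)^-1 * x)%g => //.
    by rewrite mulVKg.
  - by move=> x; apply: f2t.
have conv_t x : rnorm (convolution mu f1 f2 x -
    \sum_i c i * f2 ((t i)^-1 * x)%g : K^o) <= d * (l + B2).
  rewrite mulrDr convolutionE; apply: (S K^o (fun y => f2 (y^-1 * x)%g : K^o)) => //.
    exact: ltW.
  by move=> i y Qy Vy; exact: f2t.
(* The discretised convolution: uniformly close to the true one by [conv_t], and its integral
   against [F] is exactly the Riemann sum of [f1 y *: H y]. *)
pose P x := \sum_i c i * f2 ((t i)^-1 * x)%g : K^o.
have cP : continuous (P : G -> K^o).
  apply: (continuous_sum (F := fun i x => c i * f2 ((t i)^-1 * x)%g : K^o)) => i.
  by apply: continuous_scale; [exact: continuous_const|exact: f2l].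
have PQ : vanishes_off Q12 (P : G -> K^o).
  move=> x Qx; rewrite /P big1// => i _; rewrite [X in _ * X]f2Q ?mulr0// => Qtx.
  by apply: Qx; exists (t i) => //; exists ((t i)^-1 * x)%g => //; rewrite mulVKg.
have BP : Bochner (fun x => P x *: F x) = \sum_i c i *: H (t i).
  have cc i : continuous (fun x => f2 ((t i)^-1 * x)%g *: F x).
    exact: continuous_scale (@f2l _) cF.
  have vv i : vanishes_off Q12 (fun x => f2 ((t i)^-1 * x)%g *: F x).
    move=> x Qx; rewrite (_ : f2 _ = 0) ?scale0r//; apply: f2Q => Qtx.
    by apply: Qx; exists (t i) => //; exists ((t i)^-1 * x)%g => //; rewrite mulVKg.
  under eq_bigr do rewrite HE -(bochnerZ hG mu_fin hE _ cQ12 (cc _) (vv _)).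
  rewrite -(bochner_sum hG mu_fin hE _ cQ12).
  - congr bochner; apply/funext => x; rewrite /P scaler_suml.
    by apply: eq_bigr => i _; rewrite scalerA.
  - move=> i; apply: (@continuous_scale _ _ _ _ (fun=> c i)); last exact: cc.
    exact: (@continuous_const R k G K^o).
  - by move=> i x /vv ->; rewrite scaler0.
have Pd : rnorm (Bochner (fun x => convolution mu f1 f2 x *: F x) -
     \sum_i c i *: H (t i)) <= d * (l + B2) * B * q.
  rewrite -BP -(bochnerB hG mu_fin hE cQ12).
  - apply: (@bochner_norm _ _ _ _ hG mu_fin E hE _ _ (d * (l + B2) * B) cQ12).
    + move=> x; apply: cvgB.
        exact: (continuous_scale convolution_continuous cF).
      exact: (continuous_scale cP cF).
    + move=> x Qx; rewrite (_ : convolution _ _ _ _ = 0); last exact: convolution_vanishes.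
      by rewrite (_ : P x = 0) ?scale0r ?subr0//; exact: PQ.
    + exact: mulr_ge0 (mulr_ge0 (ltW d0) (addr_ge0 l0 B20)) B0.
    + move=> x Qx; rewrite -scalerBl rnormZ ler_pM ?rnorm_ge0 ?FB//.
  - exact: (continuous_scale convolution_continuous cF).
  - exact: (vanishes_scale _ convolution_vanishes).
  - exact: (continuous_scale cP cF).
  - exact: (vanishes_scale _ PQ).
apply: le_trans (ler_rdist (\sum_i c i *: H (t i)) _ _) _.
rewrite [X in _ + X]rdistC (le_trans (lerD Pd Ht))//.
rewrite [leLHS](_ : _ = d * C); last by rewrite /C; ring.
by rewrite /d mulrAC -mulrA ger_pMr// ler_pdivrMr ?ltr_wpDl// mul1r lerDl.
Qed.

End Fubini.

End Convolution.

(** * Word balls *)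

Section WordBalls.
Context (G : topologicalGroupType) (S : set G).

Fixpoint word_ball (n : nat) : set G :=
  if n is n'.+1 then [set (x * y)%g | x in S & y in word_ball n'] else [set 1%g].

Lemma compact_word_ball n : compact S -> compact (word_ball n).
Proof.
move=> cS; elim: n => [|n ih] /=; first exact: compact_set1.
exact: compact_mulg.
Qed.

Lemma word_ballD m n x y : word_ball m x -> word_ball n y -> word_ball (m + n) (x * y)%g.
Proof.
elim: m x => [|m ih] x /=; first by move=> ->; rewrite mul1g.
move=> [s Ss [z mz <-]] ny; exists s => //; exists (z * y)%g; first exact: ih.
by rewrite mulgA.
Qed.

Hypothesis S1 : S 1%g.

Lemma word_ball_le m n : (m <= n)%N -> word_ball m `<=` word_ball n.
Proof.
move=> /subnK <-; elim: (n - m)%N => [|l ih]; first by rewrite add0n.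
apply: subset_trans ih _ => x xl; rewrite addSn; exists 1%g => //.
by exists x => //; rewrite mul1g.
Qed.

Lemma word_ballS s : S s -> word_ball 1 s.
Proof. by move=> Ss; exists s => //; exists 1%g => //; rewrite mulg1. Qed.

Lemma word_ballV n x : (forall g, S g -> S g^-1%g) -> word_ball n x -> word_ball n x^-1%g.
Proof.
move=> SV; elim: n x => [|n ih] x /=; first by move=> ->; rewrite invg1.
move=> [s Ss [y ny <-]]; rewrite invgM.
have := word_ballD (ih _ ny) (word_ballS (SV _ Ss)).
by rewrite addn1.
Qed.

Lemma word_ball_cover : generates S -> forall g, exists n, word_ball n g.
Proof.
move=> genS g; have [s sS ->] := genS g.
elim: s sS => [|x s ih] sS; first by exists 0%N; rewrite big_nil.
have [|n ns] := ih; first by move=> y ys; apply: sS; rewrite inE ys orbT.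
exists n.+1; rewrite big_cons; exists x; first by apply: sS; rewrite mem_head.
by exists (\big[*%g/1%g]_(x <- s) x)%g.
Qed.

Context (R : realType) (mu : {measure set (borel G) -> \bar R}).
Hypotheses (hG : hausdorff_space G) (mu_haar : left_haar mu).
Hypotheses (cS : compact S) (SV : forall g, S g -> S g^-1%g) (genS : generates S).

(** The balls increase to [G]; if all were null, continuity from below would make [mu] vanish on
    [G]. *)
Lemma word_ball_pos : exists n, (0 < mu (word_ball n))%E.
Proof.
apply: contrapT => H.
have mu0 n : mu (word_ball n) = 0%E.
  apply/eqP; rewrite eq_le measure_ge0 andbT leNgt; apply/negP => n0.
  by apply: H; exists n.
have mB n : measurable (word_ball n : set (borel G)).
  by apply: compact_borel => //; exact: compact_word_ball.
have : mu (\bigcup_n word_ball n) = 0%E.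
  have nd : nondecreasing_seq (word_ball : (set (borel G))^nat).
    by apply/nondecreasing_seqP => n; apply/subsetPset; exact: word_ball_le.
  have := @nondecreasing_cvg_mu _ _ _ mu _ mB (bigcupT_measurable _ mB) nd.
  rewrite (_ : mu \o _ = cst 0%E); last by apply/funext => n /=; exact: mu0.
  move=> h; have := cvg_unique (@ereal_hausdorff R) h (cvg_cst 0%E); exact.
rewrite (_ : \bigcup_n _ = setT); first by apply/eqP; exact: haar_neq0 mu_haar.
by apply/seteqP; split=> // g _; have [n ng] := word_ball_cover genS g; exists n.
Qed.

(* Steinhaus: a compact set A of positive measure meets its translates by elements
   close to 1, so that A A^-1 is a neighbourhood of 1. *)
Lemma word_ball_nbhs1 : exists n, nbhs (1%g : G) (word_ball n).
Proof.
have [n n0] := word_ball_pos; set A := word_ball n.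
have cA : compact A by exact: compact_word_ball.
have mA : measurable (A : set (borel G)) by exact: compact_borel.
have Afin : (mu A < +oo)%E := haar_compact mu_haar cA.
have AE : mu A = (fine (mu A))%:E by rewrite fineK// ge0_fin_numE.
have A0 : 0 < fine (mu A) by rewrite fine_gt0// n0 Afin.
have : (mu A < (2 * fine (mu A))%:E)%E by rewrite [ltLHS]AE lte_fin ltr_pMl// ltr1n.
(* Outer regularity gives an open [U] around [A] of less than twice its measure, so that [A] and
   [v A], once both inside [U], cannot be disjoint. *)
rewrite {1}(haar_outer mu_haar mA) => /ereal_inf_lt[_ [U [oU AU] <-]] mU.
exists (n + n)%N.
have : \forall v \near (1%g : G), forall x, A x -> U (v * x)%g.
  apply: near_mulg_compact => // x Ax.
  have : nbhs ((1%g, x) : G * G) ((fun z => (z.1 * z.2)%g) @^-1` U).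
    by apply: (@mulg_continuous G (1%g, x)); rewrite /= mul1g; apply: open_nbhs_nbhs; split => //; exact: AU.
  case=> -[B C] /= [B1 Cx] BC; exists (C, B) => //= -[y v] /= [Cy Bv].
  exact: (BC (v, y)).
apply: filterS => v vA.
apply: contrapT => nv.
have vA0 : [set (v * x)%g | x in A] `&` A = set0.
  apply/seteqP; split=> // _ [[x Ax <-] Avx]; apply: nv.
  by rewrite -(mulgK x v); apply: word_ballD => //; exact: word_ballV.
have mvA := measurable_lcoset v mA.
have : (mu ([set (v * x)%g | x in A] `|` A) <= mu U)%E.
  apply: le_measure; [apply/mem_set; exact: measurableU|apply/mem_set; exact: open_borel|].
  by move=> _ [[x Ax <-]|/AU//]; exact: vA.
rewrite (_ : mu (_ `|` _) = (mu A + mu A)%E).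
  by move=> /le_lt_trans/(_ mU); rewrite AE -EFinD lte_fin mulr2n mulrDl mul1r ltxx.
by rewrite measureU//; congr (_ + _)%E; exact: (haar_invariant mu_haar v mA).
Qed.

(** Through this inclusion, bounds on [S] spread to every compact set with constants that depend on
    [M] and [n] but not on the representation. *)
Lemma compact_word_ball_sub Q : compact Q -> exists n, Q `<=` word_ball n.
Proof.
move=> cQ; have [m m1] := word_ball_nbhs1.
have [s [_ sQ]] := compact_translates_cover cQ m1.
have [n ns] : exists n, forall t, t \in s -> word_ball n t.
  elim: s {sQ} => [|x s [n ih]]; first by exists 0%N.
  have [l lx] := word_ball_cover genS x.
  exists (maxn n l) => t; rewrite inE => /orP[/eqP ->|/ih].
    by apply: word_ball_le lx; exact: leq_maxr.
  by apply: word_ball_le; exact: leq_maxl.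
exists (n + m)%N => x /sQ[t ts xt].
by rewrite -(mulVKg t x); apply: word_ballD => //; exact: ns.
Qed.

End WordBalls.

(** * Operator norms, and growth of representations and cocycles along words *)

Section OperatorNorm.
Context (R : realType) (k : scalar_kind).
Local Notation K := (scalar_field R k).
Context (E : normedModType K).

Lemma opnormP (T : E -> E) (C : R) : 0 <= C -> (forall (a : K) x, T (a *: x) = a *: T x) ->
  (opnorm T <= C%:E)%E <-> (forall x, rnorm (T x) <= C * rnorm x).
Proof.
move=> C0 TZ; split=> [TC x|TC].
  have [x0|x0] := eqVneq (rnorm x) 0.
    rewrite (rnorm0_eq0 x0) -{1}(scale0r 0) TZ scale0r rnorm0 mulr0//.
  have xp : 0 < rnorm x by rewrite lt_def x0 rnorm_ge0.
  have := le_trans (ereal_sup_ubound _) TC.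
  move=> /(_ (rnorm (T (of_real k (rnorm x)^-1 *: x)))%:E).
  rewrite lee_fin TZ rnormZr gtr0_norm ?invr_gt0// mulrC ler_pdivrMr//.
  apply; exists (of_real k (rnorm x)^-1 *: x); last by rewrite TZ rnormZr gtr0_norm ?invr_gt0// mulrC.
  by rewrite /= rnormZr gtr0_norm ?invr_gt0// mulVf.
apply: ge_ereal_sup => _ [x x1 <-]; rewrite lee_fin (le_trans (TC x))//.
by rewrite ler_piMr.
Qed.

Lemma opnorm_ge0 (T : E -> E) : (forall (a : K) x, T (a *: x) = a *: T x) -> (0 <= opnorm T)%E.
Proof.
move=> TZ; apply: ereal_sup_ubound; exists 0; first by rewrite /= rnorm0 ler01.
by rewrite -{1}(scale0r 0) TZ scale0r rnorm0.
Qed.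

End OperatorNorm.

Section RepBounds.
Context (R : realType) (k : scalar_kind) (G : topologicalGroupType).
Context (S : set G) (M : R) (M_ge1 : 1 <= M) (r : rep R k G).
Hypothesis rM : forall g, S g -> (opnorm (rep_op r g) <= M%:E)%E.

Lemma rep_op_le g x : S g -> rnorm (rep_op r g x) <= M * rnorm x.
Proof.
move=> /rM; rewrite opnormP//; first exact: le_trans M_ge1.
by move=> a y; rewrite linearZ.
Qed.

Lemma word_ball_rep n g x : word_ball S n g -> rnorm (rep_op r g x) <= M ^+ n * rnorm x.
Proof.
elim: n g x => [|n ih] g x /=; first by move=> ->; rewrite rep1 expr0 mul1r.
move=> [s Ss [y ny <-]]; rewrite repM (le_trans (rep_op_le _ Ss))// exprS -mulrA.
by rewrite ler_wpM2l ?ih// (le_trans ler01).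
Qed.

(** Each letter adds at most [D] and multiplies what precedes by [M]. The bound is crude; what
    matters is that, apart from [D], it involves neither [r] nor [b]. *)
Lemma word_ball_cocycle (b : G -> r) (D : R) n g :
  (forall g h, b (g * h)%g = b g + rep_op r g (b h)) -> 0 <= D ->
  (forall s, S s -> rnorm (b s) <= D) -> word_ball S n g ->
  rnorm (b g) <= n%:R * M ^+ n * D.
Proof.
move=> bM D0 bD; elim: n g => [|n ih] g /=.
  move=> ->; have := bM 1%g 1%g; rewrite mulg1 rep1 => /eqP.
  by rewrite addrC -subr_eq subrr => /eqP <-; rewrite rnorm0 !mul0r.
move=> [s Ss [y ny <-]]; rewrite bM (le_trans (ler_rnormD _ _))//.
rewrite -addn1 natrD !mulrDl mul1r [leLHS]addrC lerD//.
  rewrite (le_trans (rep_op_le _ Ss))// addn1 exprS.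
  rewrite (mulrCA n%:R) -mulrA ler_wpM2l// ?(le_trans ler01)//.
  exact: ih.
by rewrite (le_trans (bD _ Ss))// ler_peMl// exprn_ege1.
Qed.

End RepBounds.

(** * Integrated cocycles *)

Lemma div_mul_le (R : realType) (e q : R) : 0 < e -> 0 <= q -> e / (q + 1) * q <= e.
Proof.
move=> e0 q0; rewrite mulrAC ler_pdivrMr ?ltr_wpDl//.
by rewrite ler_pM2l// lerDl.
Qed.

Section Cocycles.
Context (R : realType) (k : scalar_kind) (G : topologicalGroupType).
Local Notation K := (scalar_field R k).
Context (mu : {measure set (borel G) -> \bar R}) (S : set G) (M : R).
Hypotheses (hG : hausdorff_space G) (lcG : locally_compact [set: G])
  (mu_haar : left_haar mu) (cS : compact S) (SV : forall g, S g -> S g^-1%g)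
  (S1 : S 1%g) (genS : generates S) (M_ge1 : 1 <= M).
Local Notation Bochner := (bochner mu).
Let mu_fin := haar_compact mu_haar.
Let mu_inv := haar_invariant mu_haar.

Definition cocycle (r : rep R k G) (b : G -> r) :=
  continuous b /\ forall g h, b (g * h)%g = b g + rep_op r g (b h).

Definition cocycle_int (r : rep R k G) (b : G -> r) (f : G -> K) : r :=
  Bochner (fun g => f g *: b g).

Definition S_bounded (r : rep R k G) :=
  forall g, S g -> (opnorm (rep_op r g) <= M%:E)%E.

Definition Cc1 (f : G -> K) := Cc f /\ integral_Cc mu f = 1.

Lemma rep_complete (r : rep R k G) : rnorm_complete r.
Proof. exact: rnorm_cauchy_cvg. Qed.

Section OneFunction.
Context (f : G -> K) (fC : Cc f).
Let cf := fC.1.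
Let cQ := fC.2.
Let fQ := @Cc_vanishes R k G f.

(** The support of [f] lies in a word ball, where [b] is bounded. The order of quantifiers is the
    point: [C] is found before the representation. *)
Lemma Cc_bound : exists2 C : R, 0 <= C & forall (r : rep R k G) (b : G -> r) (D : R),
  S_bounded r -> cocycle b -> 0 <= D -> (forall s, S s -> rnorm (b s) <= D) ->
  rnorm (cocycle_int b f) <= C * D.
Proof.
have [l l0 fl] := L1norm_fin hG mu_fin cQ cf fQ.
have [n Qn] := compact_word_ball_sub S1 hG mu_haar cS SV genS cQ.
exists (n%:R * M ^+ n * l) => [|r b D rM [cb bM] D0 bD].
  by rewrite !mulr_ge0// exprn_ge0// (le_trans ler01).
rewrite (le_trans (bochner_scale_norm hG mu_fin (@rep_complete r) cQ cf fQ cb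
    (B := n%:R * M ^+ n * D) _ _ fl))//.
- by rewrite !mulr_ge0// exprn_ge0// (le_trans ler01).
- by move=> x /Qn; exact: (word_ball_cocycle M_ge1 rM bM D0 bD).
- by rewrite mulrAC.
Qed.

Lemma rep_int_linear (r : rep R k G) (a : K) (x y : r) :
  rep_int mu f (a *: x + y) = a *: rep_int mu f x + rep_int mu f y.
Proof.
have hE := @rep_complete r; have cx (z : r) := @rep_strongly_continuous _ _ _ r z.
have c z := continuous_scale cf (cx z).
have v z := vanishes_scale (fun g => rep_op r g z) fQ.
rewrite /rep_int -(bochnerZ hG mu_fin hE a cQ (c x) (v x)).
rewrite -(bochnerD hG mu_fin hE cQ _ _ (c y) (v y)).
- congr bochner; apply/funext => g; rewrite linearP scalerDr !scalerA.
  by rewrite mulrC.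
- by move=> g; apply: cvgZ; [exact: cvg_cst|exact: c].
- by move=> g /v ->; rewrite scaler0.
Qed.

Lemma bochner_cst (E : normedModType K) (y : E) : rnorm_complete E ->
  Bochner (fun g => f g *: y) = integral_Cc mu f *: y.
Proof.
move=> hE; rewrite /integral_Cc.
apply: (@bochner_map _ _ _ mu hG mu_fin K^o E (fun a : K => a *: y) (rnorm y) f
  (supp f) (@rnorm_complete_scalar R k) hE) => //.
  by move=> a b c; rewrite scalerDl scalerA.
by move=> a; rewrite rnormZ mulrC.
Qed.

Lemma rep_bounded_op (r : rep R k G) g : S_bounded r ->
  exists C, forall x, rnorm (rep_op r g x) <= C * rnorm x.
Proof.
move=> rM; have [n ng] := word_ball_cover genS g.
by exists (M ^+ n) => x; exact: (word_ball_rep M_ge1 rM).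
Qed.

Lemma rep_op_bochner (r : rep R k G) g (F : G -> r) Q : S_bounded r ->
  compact Q -> continuous F -> vanishes_off Q F ->
  Bochner (fun x => rep_op r g (F x)) = rep_op r g (Bochner F).
Proof.
move=> rM cQ' cF FQ; have [C gC] := rep_bounded_op g rM.
exact: (bochner_linear hG mu_fin (@rep_complete r) (@rep_complete r) gC cQ').
Qed.

(** Since [f] has integral 1, the affine map [sigma(g)] commutes with averaging: both sides are
    [sigma(g)(sigma(f)0)]. *)
Lemma cocycle_int_translate (r : rep R k G) (b : G -> r) g : S_bounded r ->
  cocycle b -> integral_Cc mu f = 1 ->
  Bochner (fun h => f h *: b (g * h)%g) = b g + rep_op r g (cocycle_int b f).
Proof.
move=> rM [cb bM] f1; have hE := @rep_complete r.
have cfb := continuous_scale cf cb; have vfb := vanishes_scale b fQ.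
rewrite /cocycle_int -(rep_op_bochner g rM cQ cfb vfb) -[X in X + _]scale1r -f1.
rewrite -(bochner_cst _ hE) -(bochnerD hG mu_fin hE cQ).
- by congr bochner; apply/funext => h; rewrite bM scalerDr linearZ.
- by apply: continuous_scale => //; exact: continuous_const.
- exact: (vanishes_scale (fun=> b g) fQ).
- by move=> x; apply: (@cvg_comp _ _ _ _ (rep_op r g)); [exact: cfb|exact: rep_bounded].
- by move=> x /vfb ->; rewrite linear0.
Qed.

(* The cocycle obtained by moving the origin to sigma(f)0 = b(f). *)
Definition moved (r : rep R k G) (b : G -> r) (y : r) (g : G) : r :=
  b g + rep_op r g y - y.

Lemma moved_cocycle (r : rep R k G) (b : G -> r) y : cocycle b -> cocycle (moved b y).
Proof.
move=> [cb bM]; split.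
  move=> g; apply: cvgB; last exact: cvg_cst.
  by apply: cvgD; [exact: cb|exact: rep_strongly_continuous].
move=> g h; rewrite /moved bM repM linearB linearD /=.
rewrite [RHS]addrAC; congr (_ - _); rewrite [b g + rep_op r g y]addrC -!addrA.
by rewrite [RHS]addrC -!addrA addNr addr0.
Qed.

End OneFunction.

(* A cocycle bounded on S by 1 can have any modulus of continuity. After moving the
   origin it is v |-> integral of (f (v^-1 * h) - f h) *: b h, whose modulus at 1
   depends on f only. *)
Lemma moved_equicontinuous (f : G -> K) (e : R) : Cc1 f -> 0 < e ->
  exists2 V, nbhs (1%g : G) V & forall (r : rep R k G) (b : G -> r),
  S_bounded r -> cocycle b -> (forall s, S s -> rnorm (b s) <= 1) ->
  forall v, V v -> rnorm (moved b (cocycle_int b f) v) <= e.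
Proof.
move=> [[cf cQ] f1] e0; have fQ := @Cc_vanishes R k G f.
set Q := supp f in cQ fQ.
have [V0 V01 cV0] := locally_compact_nbhs1 lcG.
(* [C] contains the supports of [f] and of all its translates by [V0], so that one bound [B] for the
   cocycle serves all of them. *)
pose C := [set (x * y)%g | x in V0 & y in Q].
have cC : compact C by exact: compact_mulg.
have QC x : Q x -> C x.
  by exists 1%g; [exact: nbhs_singleton V01|exists x => //; rewrite mul1g].
have [n Cn] := compact_word_ball_sub S1 hG mu_haar cS SV genS cC.
pose B := n%:R * M ^+ n * 1.
have B0 : 0 <= B by rewrite /B mulr1 mulr_ge0// exprn_ge0// (le_trans ler01).
pose q := B * measQ mu C; have q0 : 0 <= q by exact: mulr_ge0 B0 (measQ_ge0 _ _).
have d0 : 0 < e / (q + 1) by rewrite divr_gt0// ltr_wpDl.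
have V1 := near_invg1 (P := fun v => forall x, rnorm (f (v * x)%g - f x : K^o) < e / (q + 1))
  (unif_cont_mulgl_supp cf cQ fQ d0).
exists (V0 `&` (fun v => forall x, rnorm (f (v^-1 * x)%g - f x : K^o) < e / (q + 1))).
  exact: filterI.
move=> r b rM bP b1 v [V0v Vv]; have hE := @rep_complete r; have [cb bM] := bP.
rewrite /moved -(cocycle_int_translate (conj cf cQ) v rM bP f1).
have clf : continuous (fun x => f (v^-1 * x)%g : K^o) by exact: f2l.
have f0 x : ~ C x -> f x = 0 by move=> Cx; apply: fQ => /QC.
have fv0 x : ~ C x -> f (v^-1 * x)%g = 0.
  move=> Cx; apply: fQ => Qvx; apply: Cx.
  by exists v => //; exists (v^-1 * x)%g => //; rewrite mulVKg.
have fbE : Bochner (fun h => f h *: b (v * h)%g) = Bochner (fun h => f (v^-1 * h)%g *: b h).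
  rewrite -(@bochner_lcoset _ _ _ mu hG mu_fin r hE mu_inv v (fun h => f (v^-1 * h)%g *: b h) C).
  - by congr bochner; apply/funext => h; rewrite mulKg.
  - exact: cC.
  - exact: continuous_scale clf cb.
  - by move=> x Cx; rewrite (fv0 x Cx) scale0r.
rewrite fbE /cocycle_int -(bochnerB hG mu_fin hE cC).
- apply: le_trans (@bochner_norm _ _ _ mu hG mu_fin r hE _ C (e / (q + 1) * B) cC _ _ _ _) _.
  + move=> x; apply: cvgB; [exact: (continuous_scale clf cb)|exact: (continuous_scale cf cb)].
  + by move=> x Cx; rewrite (fv0 x Cx) (f0 x Cx) !scale0r subr0.
  + exact: mulr_ge0 (ltW d0) B0.
  + move=> x Cx; rewrite -scalerBl rnormZ; apply: ler_pM; [exact: rnorm_ge0|exact: rnorm_ge0| |].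
      exact: ltW (Vv x).
    exact: (word_ball_cocycle M_ge1 rM bM ler01 b1 (Cn x Cx)).
  + rewrite (_ : _ * B * _ = e / (q + 1) * q); last by rewrite /q; ring.
    exact: div_mul_le.
- exact: continuous_scale clf cb.
- by move=> x Cx; rewrite (fv0 x Cx) scale0r.
- exact: continuous_scale cf cb.
- by move=> x Cx; rewrite (f0 x Cx) scale0r.
Qed.

Section TwoFunctions.
Context (f h : G -> K) (fC : Cc f) (hC : Cc h).

Lemma convolution_Cc : Cc (convolution mu f h).
Proof.
have [cf cQ] := fC; have [ch cQ'] := hC.
apply: (vanishes_Cc hG (compact_mulg cQ cQ')).
  exact: (convolution_continuous hG mu_fin cQ cf ch (@Cc_vanishes R k G f)).
by apply: convolution_vanishes => //; exact: Cc_vanishes.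
Qed.

Let conv (E : normedModType K) (hE : rnorm_complete E) (F : G -> E) (cF : continuous F) :=
  bochner_convolution hG mu_fin mu_inv fC.2 hC.2 fC.1 hC.1
    (@Cc_vanishes R k G f) (@Cc_vanishes R k G h) hE cF lcG.

Lemma integral_convolution :
  integral_Cc mu (convolution mu f h) = integral_Cc mu f * integral_Cc mu h.
Proof.
have hK := @rnorm_complete_scalar R k.
have := @conv K^o hK (fun=> 1) (@continuous_const R k G K^o 1).
rewrite (bochner_cst hC _ hK) (bochner_cst fC _ hK) (bochner_cst convolution_Cc _ hK).
move: (integral_Cc mu f) (integral_Cc mu h) (integral_Cc mu (convolution mu f h)) => a b c.
by rewrite /GRing.scale /= !mulr1.
Qed.

Lemma rep_int_convolution (r : rep R k G) (x : r) : S_bounded r ->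
  rep_int mu (convolution mu f h) x = rep_int mu f (rep_int mu h x).
Proof.
move=> rM; have cx := @rep_strongly_continuous _ _ _ r x.
rewrite /rep_int (conv (@rep_complete r) cx); congr bochner; apply/funext => y.
congr (_ *: _); rewrite -(rep_op_bochner y rM hC.2 (continuous_scale hC.1 cx)
  (vanishes_scale _ (@Cc_vanishes R k G h))).
by congr bochner; apply/funext => z; rewrite repM linearZ.
Qed.

(** The affine identity [sigma(f * h)0 = sigma(f)(sigma(h)0)], with the right-hand side split into
    its translation and linear parts. *)
Lemma cocycle_int_convolution (r : rep R k G) (b : G -> r) : S_bounded r ->
  cocycle b -> integral_Cc mu h = 1 ->
  cocycle_int b (convolution mu f h) =
  cocycle_int b f + rep_int mu f (cocycle_int b h).
Proof.
move=> rM bP h1; have [cb _] := bP; have hE := @rep_complete r.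
rewrite /cocycle_int (conv hE cb).
under eq_fun do rewrite (cocycle_int_translate hC _ rM bP h1) scalerDr.
rewrite (bochnerD hG mu_fin hE fC.2)//.
- exact: (continuous_scale fC.1 cb).
- exact: (vanishes_scale _ (@Cc_vanishes R k G f)).
- exact: (continuous_scale fC.1 (@rep_strongly_continuous _ _ _ r _)).
- exact: (vanishes_scale _ (@Cc_vanishes R k G f)).
Qed.

End TwoFunctions.

(** Seen from the new origin [y], the point [sigma(f)y] becomes [sigma(f)y - y]. *)
Lemma cocycle_int_moved (f : G -> K) (r : rep R k G) (b : G -> r) y : Cc1 f ->
  cocycle b -> cocycle_int (moved b y) f = cocycle_int b f + rep_int mu f y - y.
Proof.
move=> [fC f1] [cb _]; have hE := @rep_complete r.
have cy := @rep_strongly_continuous _ _ _ r y.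
have c1 := continuous_scale fC.1 cb; have c2 := continuous_scale fC.1 cy.
have fQ := @Cc_vanishes R k G f.
rewrite -[X in _ - X](scale1r y) -f1 -(bochner_cst fC y hE) /rep_int /cocycle_int.
rewrite -(bochnerD hG mu_fin hE fC.2 c1 (vanishes_scale _ fQ) c2 (vanishes_scale _ fQ)).
rewrite -(bochnerB hG mu_fin hE fC.2).
- by congr bochner; apply/funext => g; rewrite scalerBr scalerDr.
- by move=> g; apply: cvgD; [exact: c1|exact: c2].
- by move=> g /fQ ->; rewrite !scale0r addr0.
- exact: (continuous_scale fC.1 (@continuous_const R k G r y)).
- exact: vanishes_scale.
Qed.

Lemma coboundary_cocycle (r : rep R k G) (x : r) :
  cocycle (fun g => rep_op r g x - x).
Proof.
have : cocycle (moved (fun _ : G => 0 : r) x).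
  apply: moved_cocycle; split; first exact: (@continuous_const R k G r).
  by move=> g h; rewrite linear0 addr0.
by rewrite (_ : moved _ _ = fun g => rep_op r g x - x)//; apply/funext => g;
  rewrite /moved add0r.
Qed.

Lemma cocycle_int_coboundary (f : G -> K) (r : rep R k G) (x : r) : Cc1 f ->
  cocycle_int (fun g => rep_op r g x - x) f = rep_int mu f x - x.
Proof.
move=> fC1; rewrite (_ : (fun g => _) = moved (fun _ : G => 0 : r) x); last first.
  by apply/funext => g; rewrite /moved add0r.
rewrite cocycle_int_moved//.
  rewrite /cocycle_int (_ : (fun g => _) = fun=> 0); last first.
    by apply/funext => g; rewrite scaler0.
  by rewrite (bochner0 hG mu_fin (@rep_complete r)) add0r.
split; first exact: (@continuous_const R k G r).
by move=> g h; rewrite linear0 addr0.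
Qed.

Lemma rep_int_inv (f : G -> K) (r : rep R k G) (x : r) : Cc1 f -> rep_inv r x ->
  rep_int mu f x = x.
Proof.
move=> fC1 rx; rewrite -[RHS]scale1r -fC1.2 -(bochner_cst fC1.1 x (@rep_complete r)).
by congr bochner; apply/funext => g; rewrite rx.
Qed.

End Cocycles.

(** * Kazhdan projections and contraction *)

Section Preliminaries.
Context (R : realType).

Lemma subr_telescope (V : zmodType) (a b c d : V) :
  a - b = (c - d) + ((a - c) - (b - d)).
Proof. by rewrite opprB addrACA addKr [c + _]addrC subrK. Qed.

Lemma expr34_small (C e : R) : 0 < e -> exists N, forall n, (N <= n)%N ->
  C * (3 / 4) ^+ n < e.
Proof.
move=> e0; have d0 : 0 < e / (`|C| + 1) by rewrite divr_gt0// ltr_wpDl.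
have q0 : 0 <= 3 / 4 :> R by lra.
have q1 : `|3 / 4 : R| < 1 by rewrite ger0_norm//; lra.
have /cvgrPdist_lt/(_ _ d0)[N _ NP] := cvg_expr q1.
exists N => n /NP /=; rewrite sub0r normrN ger0_norm ?exprn_ge0//.
rewrite ltr_pdivlMr ?ltr_wpDl// => /(le_lt_trans _); apply.
rewrite mulrC ler_wpM2l ?exprn_ge0//.
by rewrite (le_trans (ler_norm C))// lerDl.
Qed.

(** The factor [4] is the sum of the geometric series of ratio [3 / 4]. The explicit rate is kept
    because it must be uniform over representations later. *)
Lemma geometric_limit (k : scalar_kind) (E : normedModType (scalar_field R k))
    (x : nat -> E) (C : R) : rnorm_complete E ->
  (forall n, rnorm (x n.+1 - x n) <= C * (3 / 4) ^+ n) ->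
  exists l, forall n, rnorm (x n - l) <= 4 * C * (3 / 4) ^+ n.
Proof.
move=> hE xC; have q0 : 0 <= 3 / 4 :> R by lra.
have C0 : 0 <= C.
  by have := le_trans (rnorm_ge0 _) (xC 0%N); rewrite expr0 mulr1.
(* The exact partial sum, rather than the full series, is what an induction on [m] can carry. *)
have xnm n m : rnorm (x (m + n)%N - x n) <= 4 * C * ((3 / 4) ^+ n - (3 / 4) ^+ (m + n)).
  elim: m => [|m ih]; first by rewrite add0n !subrr rnorm0 mulr0.
  rewrite (le_trans (ler_rdist (x (m + n)%N) _ _))// addSn.
  rewrite (le_trans (lerD (xC _) ih))// exprS; set u := _ ^+ (m + n); lra.
have xnm' n m : (n <= m)%N -> rnorm (x m - x n) <= 4 * C * (3 / 4) ^+ n.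
  move=> /subnK <-; apply: le_trans (xnm _ _) _; rewrite ler_wpM2l ?mulr_ge0//.
  by rewrite gerBl exprn_ge0.
have [l xl] : exists l, forall e : R, 0 < e -> exists N, forall n, (N <= n)%N -> rnorm (x n - l) < e.
  apply: hE => e e0; have e20 : 0 < e / 2 by rewrite divr_gt0.
  have [N NP] := expr34_small (4 * C) e20.
  exists N => m n Nm Nn; apply: le_lt_trans (ler_rdist (x N) _ _) _.
  have h := NP N (leqnn N).
  rewrite [X in _ + X]rdistC (splitr e) ltrD//; apply: le_lt_trans h; exact: xnm'.
exists l => n; apply/ler_addgt0Pl => e /xl[N NP].
pose m := maxn n N; apply: le_trans (ler_rdist (x m) _ _) _.
rewrite addrC lerD//; first by rewrite ltW// NP// leq_maxr.
by rewrite rdistC xnm'// leq_maxl.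
Qed.

Lemma cvge0_lt (u : nat -> \bar R) (e : R) : u @ \oo --> 0%E -> 0 < e ->
  \forall n \near \oo, (u n < e%:E)%E.
Proof.
move=> u0 e0; apply: (u0 [set x | (x < e%:E)%E]).
by apply: open_nbhs_nbhs; split; [exact: open_ereal_lt_ereal|rewrite /= lte_fin].
Qed.

Lemma cvge0_le (u : nat -> \bar R) : (forall n, (0 <= u n)%E) ->
  (forall e : R, 0 < e -> exists N, forall n, (N <= n)%N -> (u n <= e%:E)%E) ->
  u @ \oo --> 0%E.
Proof.
move=> u0 ue; apply/fine_cvgP; split.
  have [N NP] := ue 1 ltr01; exists N => // n Nn.
  by rewrite ge0_fin_numE//; apply: le_lt_trans (NP n Nn) _; rewrite ltry.
apply/cvgrPdist_le => e /ue[N NP]; exists N => // n Nn /=.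
have un := NP n Nn; rewrite sub0r normrN ger0_norm ?fine_ge0// -lee_fin fineK//.
by rewrite ge0_fin_numE//; apply: le_lt_trans un _; rewrite ltry.
Qed.

End Preliminaries.

(** * Fixed points and limit projections obtained from contraction *)

Section LocalCharacterization.
Context (R : realType) (k : scalar_kind) (G : topologicalGroupType).
Local Notation K := (scalar_field R k).
Context (mu : {measure set (borel G) -> \bar R}) (S : set G) (M : R).
Hypotheses (hG : hausdorff_space G) (mu_haar : left_haar mu) (cS : compact S)
  (SV : forall g, S g -> S g^-1%g)
  (S1 : S 1%g) (genS : generates S) (M_ge1 : 1 <= M).
Let M_ge0 : 0 <= M := le_trans ler01 M_ge1.
Implicit Types (r : rep R k G) (f : G -> K).
Local Opaque bochner rep_int cocycle_int.

(** A class only provides one admissible representative; the bound is carried to the others by the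
    isometric equivalence. *)
Lemma members_S_bounded (c : repclass k S M) r : members c r -> S_bounded S M r.
Proof.
have [r0 [_ r0M] ->] := repclassP c; move=> [phi [iso surj equiv]] g Sg.
apply/opnormP => // [a x|y]; first by rewrite linearZ.
have [x <-] := surj y; rewrite -equiv /rnorm !iso.
exact: (rep_op_le M_ge1 r0M).
Qed.

(* One step of the iteration x -> sigma(f)x divides the displacement by 4/3. *)
Definition contracting f r := forall (b : G -> r) (D : R), cocycle b -> 0 <= D ->
  (forall s, S s -> rnorm (b s) <= D) ->
  forall s, S s -> rnorm (moved b (cocycle_int mu b f) s) <= 3 / 4 * D.

Lemma movedD r (b : G -> r) y z g : moved (moved b y) z g = moved b (y + z) g.
Proof. by rewrite /moved linearD opprD !addrA [_ - y + _]addrAC. Qed.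

Lemma contracting_H1 f r : Cc1 mu f -> S_bounded S M r -> contracting f r ->
  H1_vanishes r.
Proof.
move=> fC1 rM fr b cb bM; have bP : cocycle b by [].
have [D D0 bD] := rnorm_compact_bounded cb cS.
have [C C0 CP] := Cc_bound hG mu_haar cS SV S1 genS M_ge1 fC1.1.
pose T x := rep_int mu f x + cocycle_int mu b f.
pose x n := iter n T 0.
(* Seen from [x n], the next iterate is the point [b(f)] of the cocycle moved there, so that the
   contraction hypothesis applies at every step. *)
have xS n : x n.+1 - x n = cocycle_int mu (moved b (x n)) f.
  rewrite (cocycle_int_moved hG mu_haar _ fC1 bP).
  have -> : x n.+1 = T (x n) by [].
  exact: (congr1 (fun z => z - x n) (addrC (rep_int mu f (x n)) _)).
have q0 : 0 <= 3 / 4 :> R by lra.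
have D0n n : 0 <= (3 / 4) ^+ n * D by rewrite mulr_ge0// exprn_ge0.
have bn n s : S s -> rnorm (moved b (x n) s) <= (3 / 4) ^+ n * D.
  elim: n s => [|n ih] s Ss.
    by rewrite expr0 mul1r /moved /= linear0 addr0 subr0 bD.
  have := fr _ _ (moved_cocycle (x n) bP) (D0n n) ih s Ss.
  by rewrite movedD -xS addrC subrK exprS mulrA.
have xC n : rnorm (x n.+1 - x n) <= C * D * (3 / 4) ^+ n.
  rewrite xS -mulrA [D * _]mulrC; apply: CP => //; first exact: moved_cocycle.
  exact: bn.
have [l xl] := geometric_limit (@rep_complete R k G r) xC.
have lP := moved_cocycle l bP.
have bl s : S s -> rnorm (moved b l s) <= 0.
  move=> Ss; apply/ler_addgt0Pl => e e0; rewrite addr0.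
  have [N NP] := expr34_small (D + (M + 1) * (4 * (C * D))) e0.
  have {NP} := NP N (leqnn N) => h; apply: le_trans (ltW h).
  have -> : moved b l s = moved b (x N) s + (rep_op r s (l - x N) - (l - x N)).
    by rewrite -[in LHS](subrK (x N) l) [l - x N + _]addrC -movedD /moved -!addrA.
  rewrite (le_trans (ler_rnormD _ _))// mulrDl lerD//; first by rewrite mulrC bn.
  rewrite (le_trans (ler_rnormB _ _))//.
  have := lerD (rep_op_le M_ge1 rM (l - x N) Ss) (lexx (rnorm (l - x N))).
  move=> /le_trans; apply; rewrite -{2}[rnorm _]mul1r -mulrDl -mulrA.
  by rewrite ler_wpM2l// ?addr_ge0// rdistC.
(* The cocycle seen from [l] vanishes on [S]; the word bound with [D = 0] makes it vanish on all of
   [G]. *)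
exists l => g; have [n ng] := word_ball_cover genS g.
have := word_ball_cocycle M_ge1 rM lP.2 (lexx 0) bl ng; rewrite mulr0 => h.
apply/eqP; rewrite -subr_eq0; apply/eqP; apply: rnorm0_eq0; apply/eqP.
rewrite eq_le rnorm_ge0 andbT; apply: le_trans h.
by rewrite /moved [b g + _]addrC.
Qed.

(** Contraction for the coboundary of [x], that is, for the linear action seen from [x]: the origin
    moves from [x] to [pi(f)x]. *)
Lemma contracting_displacement f r x D : Cc1 mu f -> S_bounded S M r ->
  contracting f r -> 0 <= D -> (forall s, S s -> rnorm (rep_op r s x - x) <= D) ->
  forall s, S s -> rnorm (rep_op r s (rep_int mu f x) - rep_int mu f x) <= 3 / 4 * D.
Proof.
move=> fC1 rM fr D0 xD s Ss.
have := fr _ _ (coboundary_cocycle x) D0 xD s Ss.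
rewrite (cocycle_int_coboundary hG mu_haar x fC1) /moved linearB /=.
set a := rep_op r s (rep_int _ _ _); set y := rep_int _ _ _.
rewrite (_ : rep_op r s x - x + (a - rep_op r s x) - (y - x) = a - y)//.
rewrite opprB [_ - x + _]addrC -!addrA; congr (_ + _).
by rewrite !addKr.
Qed.


Section Converse.
Context (F : repclass k S M -> Prop) (f : G -> K) (fC1 : Cc1 mu f).
Hypothesis fF : forall c r, F c -> members c r -> contracting f r.

Definition limit_projection r (C : R) (T : {linear r -> r}) :=
  [/\ (forall n x, rnorm (iter n (rep_int mu f) x - T x) <= C * (3 / 4) ^+ n * rnorm x),
      (forall x, rep_inv r (T x)) & (forall x, rep_inv r x -> T x = x)].

(** Contraction makes the displacements of the iterates [pi(f)^n x] decay geometrically, and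
    [Cc_bound] turns a small displacement into a small step. The limit has displacement 0, so it is
    invariant. The constant depends on [f] and [M] only, which the norm of the completion
    requires. *)
Lemma limit_projection_exists : exists2 C : R, 0 <= C & forall c r, F c -> members c r ->
  exists T, limit_projection (r := r) C T.
Proof.
have [C C0 CP] := Cc_bound hG mu_haar cS SV S1 genS M_ge1 fC1.1.
have q0 : 0 <= 3 / 4 :> R by lra.
exists (4 * (C * (M + 1))) => [|c r Fc cr]; first by rewrite !mulr_ge0// addr_ge0.
have rM := members_S_bounded cr; have fr := fF Fc cr.
have hE := @rep_complete R k G r.
have disp (x : r) n s : S s -> rnorm (rep_op r s (iter n (rep_int mu f) x) - iter n (rep_int mu f) x)
    <= (3 / 4) ^+ n * ((M + 1) * rnorm x).
  elim: n s => [|n ih] s Ss.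
    rewrite expr0 mul1r (le_trans (ler_rnormB _ _))// mulrDl mul1r lerD2r.
    exact: (rep_op_le M_ge1 rM).
  have D0 : 0 <= (3 / 4) ^+ n * ((M + 1) * rnorm x).
    by rewrite !mulr_ge0 ?exprn_ge0 ?rnorm_ge0// addr_ge0.
  have := contracting_displacement fC1 rM fr D0 ih Ss.
  by rewrite exprS !mulrA.
have step (x : r) n : rnorm (iter n.+1 (rep_int mu f) x - iter n (rep_int mu f) x) <=
    C * ((M + 1) * rnorm x) * (3 / 4) ^+ n.
  have -> : iter n.+1 (rep_int mu f) x = rep_int mu f (iter n (rep_int mu f) x) by [].
  rewrite -(cocycle_int_coboundary hG mu_haar (iter n (rep_int mu f) x) fC1).
  rewrite -mulrA [X in C * X]mulrC.
  apply: (CP r _ _ rM (coboundary_cocycle _)); last by move=> s Ss; exact: disp.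
  by rewrite !mulr_ge0 ?exprn_ge0 ?rnorm_ge0// addr_ge0.
have [T TP] := choice (fun x => geometric_limit hE (step x)).
have Tlim (x y : r) : (forall e : R, 0 < e -> exists N, forall n, (N <= n)%N ->
    rnorm (iter n (rep_int mu f) x - y) <= e) -> T x = y.
  move=> xy; apply/eqP; rewrite -subr_eq0; apply/eqP; apply: rnorm_le_eq0 => e e0.
  have e20 : 0 < e / 2 by rewrite divr_gt0.
  have [N NP] := expr34_small (4 * (C * ((M + 1) * rnorm x))) e20.
  have [N' N'P] := xy _ e20.
  pose n := maxn N N'.
  apply: le_trans (ler_rdist (iter n (rep_int mu f) x) _ _) _.
  rewrite (splitr e) lerD//; last by rewrite N'P// leq_maxr.
  rewrite rdistC; apply: le_trans (TP x n) _; apply: ltW; apply: NP.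
  exact: leq_maxl.
have iter_lin n a (x y : r) : iter n (rep_int mu f) (a *: x + y) =
    a *: iter n (rep_int mu f) x + iter n (rep_int mu f) y.
  elim: n => [//|n ih].
  have iS z : iter n.+1 (rep_int mu f) z = rep_int mu f (iter n (rep_int mu f) z) by [].
  by rewrite !iS ih (rep_int_linear hG mu_haar fC1.1).
have linT a x y : T (a *: x + y) = a *: T x + T y.
  apply: Tlim => e e0.
  pose Cx := 4 * (C * ((M + 1) * rnorm x)); pose Cy := 4 * (C * ((M + 1) * rnorm y)).
  have [N NP] := expr34_small (rnorm (a : K^o) * Cx + Cy) e0.
  exists N => n Nn; rewrite iter_lin opprD addrACA -scalerBr.
  apply: le_trans (ler_rnormD _ _) _; apply: le_trans (ltW (NP n Nn)).
  rewrite rnormZ mulrDl; apply: lerD; last exact: TP.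
  by rewrite -mulrA; apply: ler_wpM2l; [exact: rnorm_ge0|exact: TP].
pose lT := GRing.isLinear.Build K r r *:%R T linT.
pose T' : {linear r -> r} := HB.pack T lT.
exists T'; split.
- move=> n x; apply: le_trans (TP x n) _.
  by rewrite (_ : 4 * _ * _ = 4 * (C * (M + 1)) * (3 / 4) ^+ n * rnorm x)//; ring.
- move=> x; have Tx s : S s -> rep_op r s (T x) = T x.
    move=> Ss; apply/eqP; rewrite -subr_eq0; apply/eqP; apply: rnorm_le_eq0 => e e0.
    have [N NP] := expr34_small
      ((M + 1) * rnorm x + (M + 1) * (4 * (C * ((M + 1) * rnorm x)))) e0.
    have h := ltW (NP N (leqnn N)); apply: le_trans h.
    set z := iter N (rep_int mu f) x.
    have -> : rep_op r s (T x) - T x = (rep_op r s z - z) +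
        (rep_op r s (T x - z) - (T x - z)).
      by rewrite linearB; exact: subr_telescope.
    rewrite (le_trans (ler_rnormD _ _))// mulrDl lerD//.
      by rewrite mulrC; exact: disp.
    rewrite (le_trans (ler_rnormB _ _))//.
    have := lerD (rep_op_le M_ge1 rM (T x - z) Ss) (lexx (rnorm (T x - z))).
    move=> /le_trans; apply; rewrite -{2}[rnorm (T x - z)]mul1r -mulrDl -mulrA.
    by rewrite ler_wpM2l// ?addr_ge0// rdistC; exact: TP.
  move=> g; have [s sS ->] := genS g.
  elim: s sS => [|h s ih] sS; first by rewrite big_nil rep1.
  rewrite big_cons repM ih; last by move=> y ys; apply: sS; rewrite inE ys orbT.
  by apply: Tx; apply: sS; rewrite mem_head.
- move=> x xinv; apply: Tlim => e e0; exists 0%N => n _.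
  rewrite (_ : iter n _ x = x) ?subrr ?rnorm0 ?ltW//.
  elim: n => [//|n ih]; rewrite -[RHS](rep_int_inv hG mu_haar fC1 xinv).
  by rewrite -[in RHS]ih.
Qed.

End Converse.

End LocalCharacterization.

Section Bounds.
Context (R : realType).
Implicit Types e t : R.

Lemma quarters_le e t : e / 4 * t + e / 4 * t <= e / 2 * t.
Proof. lra. Qed.

Lemma halves_le e t : e / 2 * t + e / 2 * t <= e * t.
Proof. lra. Qed.

Lemma quarter_half_le e t : e / 4 * t + e / 2 * t <= 3 / 4 * e * t.
Proof. lra. Qed.

(** Error estimate for the square of an operator within [d] of a projection [T] of norm at most
    [C + 1]; [t] is the norm of [x] and [u] that of [T x]. *)
Lemma idempotent_bound (C d t u : R) : 0 <= d -> d <= 1 -> 0 <= t ->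
  u <= (C + 1) * t ->
  (C + 1 + d) * (d * t) + d * u <= d * (2 * (C + 1) + 1) * t.
Proof.
move=> d0 d1 t0 uC; have h6 := ler_wpM2l d0 uC.
have h7 : d * (d * t) <= d * t by apply: ler_piMl => //; rewrite mulr_ge0.
lra.
Qed.

End Bounds.

(** * From a Kazhdan projection to contracted displacements, and from contraction back to a Kazhdan
    projection *)

Section KazhdanProjections.
Context (R : realType) (k : scalar_kind) (G : topologicalGroupType).
Local Notation K := (scalar_field R k).
Context (mu : {measure set (borel G) -> \bar R}) (S : set G) (M : R).
Hypotheses (hG : hausdorff_space G) (lcG : locally_compact [set: G])
  (mu_haar : left_haar mu) (cS : compact S) (SV : forall g, S g -> S g^-1%g)
  (S1 : S 1%g) (genS : generates S) (M_ge1 : 1 <= M).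
Let M_ge0 : 0 <= M := le_trans ler01 M_ge1.
Let mu_fin := haar_compact mu_haar.
Implicit Types (r : rep R k G) (f : G -> K).
Context (F : repclass k S M -> Prop).

Lemma CcB f h : Cc f -> Cc h -> Cc (f \- h).
Proof.
move=> [cf cQ] [ch cQ']; have cQQ : compact (supp f `|` supp h) by exact: compactU.
apply: (vanishes_Cc hG cQQ).
  by move=> x; apply: (@cvgB K K^o); [exact: cf|exact: ch].
move=> x Qx /=; rewrite (_ : f x = 0); last by apply: Cc_vanishes => ?; apply: Qx; left.
rewrite (_ : h x = 0) ?subr0//; last by apply: Cc_vanishes => ?; apply: Qx; right.
Qed.

Lemma rep_intB f h r (x : r) : Cc f -> Cc h ->
  rep_int mu (f \- h) x = rep_int mu f x - rep_int mu h x.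
Proof.
move=> [cf cQ] [ch cQ']; have cQQ : compact (supp f `|` supp h) by exact: compactU.
have cx := @rep_strongly_continuous _ _ _ r x.
have v (u : G -> K) : supp u `<=` supp f `|` supp h ->
    vanishes_off (supp f `|` supp h) (fun g => u g *: rep_op r g x).
  move=> uQ; apply: vanishes_scale => g Qg; apply: (@Cc_vanishes R k G u) => /uQ.
  exact: Qg.
rewrite /rep_int -(bochnerB hG mu_fin (@rep_complete R k G r) cQQ).
- by congr bochner; apply/funext => g; rewrite -scalerBl.
- exact: (continuous_scale cf cx).
- by apply: v => g; left.
- exact: (continuous_scale ch cx).
- by apply: v => g; right.
Qed.

Local Opaque bochner rep_int cocycle_int.

Lemma rep_intZ f r (a : K) (x : r) : Cc f ->
  rep_int mu f (a *: x) = a *: rep_int mu f x.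
Proof.
move=> fC; rewrite -[X in rep_int mu f X]addr0 (rep_int_linear hG mu_haar fC).
have := rep_int_linear hG mu_haar fC 1 (0 : r) 0.
rewrite scale1r addr0 scale1r => /eqP; rewrite -subr_eq subrr => /eqP <-.
by rewrite addr0.
Qed.

Lemma seminormP f (e : R) : Cc f -> 0 <= e ->
  (seminorm mu F f <= e%:E)%E <->
  (forall c r (x : r), F c -> members c r -> rnorm (rep_int mu f x) <= e * rnorm x).
Proof.
move=> fC e0; have Z r (a : K) (x : r) := rep_intZ a x fC.
split=> [fe c r x Fc cr|fe].
  apply: ((opnormP e0 (Z r)).1 _ x); apply: le_trans fe.
  by apply: ereal_sup_ubound; right; exists c, r; split.
apply: ge_ereal_sup => _ [->|[c [r [Fc cr ->]]]]; first by rewrite lee_fin.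
by apply: (opnormP e0 (Z r)).2 => x; exact: fe Fc cr.
Qed.

Lemma seminorm_ge0 f : (0 <= seminorm mu F f)%E.
Proof. by apply: ereal_sup_ubound; left. Qed.

(** Both [f] and the image [T] are compared with a late term of a sequence representing [P]. How
    late depends on the representation, but [f] does not. *)
Lemma kazhdan_close (P : completion mu F) (e : R) : kazhdan_projection P -> 0 < e ->
  exists2 f, Cc1 mu f & forall c r (T : {linear r -> r}), F c -> members c r ->
    is_image P T -> forall x, rnorm (rep_int mu f x - T x) <= e * rnorm x.
Proof.
move=> [_ clP _] e0; have e20 : 0 < e / 2 by rewrite divr_gt0.
have [f [fC f1] fP] := clP _ e20; exists f => // c r T Fc cr imT x.
have [p [pC pCauchy] PE] := completionP P.
have Pp : sequences P p.
  rewrite PE; split; first by split.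
  rewrite /cauchy_equiv; apply: cvge0_le => [n|d d0]; first exact: seminorm_ge0.
  exists 0%N => n _; apply/(seminormP (CcB (pC n) (pC n)) (ltW d0)) => c' r' x' _ _.
  by rewrite rep_intB// subrr rnorm0 mulr_ge0 ?rnorm_ge0// ltW.
have [N1 _ N1P] := fP p Pp.
have [N2 _ N2P] := cvge0_lt (imT p Pp) e20.
pose n := maxn N1 N2.
have h1 : rnorm (rep_int mu (p n \- f) x) <= e / 2 * rnorm x.
  apply: ((seminormP (CcB (pC n) fC) (ltW e20)).1 _ c r x Fc cr).
  by apply: ltW; apply: N1P; exact: leq_maxl.
have h2 : rnorm (rep_int mu (p n) x - T x) <= e / 2 * rnorm x.
  have TZ (a : K) y : (rep_int mu (p n) \- T) (a *: y) = a *: (rep_int mu (p n) \- T) y.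
    by rewrite /= rep_intZ// linearZ -scalerBr.
  apply: ((opnormP (ltW e20) TZ).1 _ x); apply: ltW; apply: N2P; exact: leq_maxr.
rewrite rep_intB// in h1; rewrite (splitr e) mulrDl.
apply: le_trans (ler_rdist (rep_int mu (p n) x) _ _) (lerD _ h2).
by rewrite rdistC.
Qed.

(** A spectral gap argument. Subtracting the invariant vector [T x] leaves displacements unchanged
    and gives [x'] with [T x' = 0]. The displacement of [x'] bounds its norm ([h0]), and an [f]
    close enough to the projection makes [pi(f)x'] as small as wanted. *)
Lemma kazhdan_local (eta : R) : has_kazhdan_projection mu F -> 0 < eta ->
  exists2 f, Cc1 mu f & forall c r (x : r) (D : R), F c -> members c r -> 0 <= D ->
    (forall s, S s -> rnorm (rep_op r s x - x) <= D) ->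
    forall s, S s -> rnorm (rep_op r s (rep_int mu f x) - rep_int mu f x) <= eta * D.
Proof.
move=> [P KP] eta0.
(* The tolerance is [1 / 2]: [pi(f0)] at least halves [x'] but moves it by at most [C * D], whence
   the bound [2 * C * D] for its norm. *)
have [f0 f0C f0P] := kazhdan_close KP (divr_gt0 ltr01 (ltr0Sn R 1)).
have [C C0 CP] := Cc_bound hG mu_haar cS SV S1 genS M_ge1 f0C.1.
pose q := (M + 1) * (2 * C); have q0 : 0 <= q by rewrite !mulr_ge0// addr_ge0.
have e0 : 0 < eta / (q + 1) by rewrite divr_gt0// ltr_wpDl.
have [f fC fP] := kazhdan_close KP e0; exists f => // c r x D Fc cr D0 xD s Ss.
have rM := members_S_bounded M_ge1 cr.
have [_ _ KP3] := KP; have [T imT [_ Tidem Trange]] := KP3 c r Fc cr.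
have Tinv y : rep_inv r (T y) by rewrite -Trange; exists y.
pose x' := x - T x.
have Tx' : T x' = 0 by rewrite linearB /= Tidem subrr.
have h0 : rnorm x' <= 2 * C * D.
  have h := f0P c r T Fc cr imT x'.
  rewrite Tx' subr0 in h.
  have x'D t : S t -> rnorm (rep_op r t x' - x') <= D.
    move=> St; rewrite linearB /= Tinv opprB subrKA.
    exact: xD.
  have := CP r _ D rM (coboundary_cocycle x') D0 x'D.
  rewrite (cocycle_int_coboundary hG mu_haar x' f0C) => h1.
  have := le_trans (ler_rdist (rep_int mu f0 x') x' 0) (lerD _ _).
  rewrite !subr0 rdistC => /(_ _ _ h1 h); lra.
have fx : rep_int mu f x = rep_int mu f x' + T x.
  rewrite -[in LHS](subrK (T x) x) -[x - T x]scale1r (rep_int_linear hG mu_haar fC.1).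
  by rewrite scale1r (rep_int_inv hG mu_haar fC (Tinv x)).
rewrite fx linearD /= Tinv opprD addrACA subrr addr0.
have h1 := fP c r T Fc cr imT x'; rewrite Tx' subr0 in h1.
rewrite (le_trans (ler_rnormB _ _))//.
have := lerD (rep_op_le M_ge1 rM (rep_int mu f x') Ss) (lexx (rnorm (rep_int mu f x'))).
move=> /le_trans; apply; rewrite -{2}[rnorm (rep_int _ _ _)]mul1r -mulrDl.
have M10 : 0 <= M + 1 by rewrite addr_ge0.
apply: le_trans (ler_wpM2l M10 h1) _.
apply: le_trans (ler_wpM2l M10 (ler_wpM2l (ltW e0) h0)) _.
rewrite [leLHS](_ : _ = eta / (q + 1) * q * D); last by rewrite /q; ring.
by apply: ler_wpM2r => //; exact: div_mul_le.
Qed.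

Section FromContracting.
Context (f : G -> K) (fC1 : Cc1 mu f).
Hypothesis fF : forall c r, F c -> members c r -> contracting mu S f r.

(** Index shift: [p n] is the convolution power of exponent [n + 1] and acts as [iter n.+1] of
    [pi(f)]. *)
Let p n := iter n (convolution mu f) f.

Let pS n : p n.+1 = convolution mu f (p n). Proof. by []. Qed.

Let pC1 n : Cc1 mu (p n).
Proof.
elim: n => [//|n [pC p1]]; rewrite pS; split.
  exact: (convolution_Cc hG mu_haar fC1.1 pC).
by rewrite (integral_convolution hG lcG mu_haar fC1.1 pC) fC1.2 p1 mulr1.
Qed.

Let p_iter n r (x : r) : S_bounded S M r ->
  rep_int mu (p n) x = iter n.+1 (rep_int mu f) x.
Proof.
move=> rM; elim: n => [//|n ih]; rewrite pS.
rewrite (rep_int_convolution hG lcG mu_haar genS M_ge1 fC1.1 (pC1 n).1 x rM) ih.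
exact: erefl.
Qed.

Lemma kazhdan_of_contracting : has_kazhdan_projection mu F.
Proof.
have [C C0 TF] := limit_projection_exists hG mu_haar cS SV S1 genS M_ge1 fC1 fF.
have q0 : 0 <= 3 / 4 :> R by lra.
(* Uniform convergence to the limit projections characterises the sequences in the class of [p], by
   [mem_UC] and [UC_mem]. Each property of the projection is then checked on the operators [T]. *)
pose UC (q : nat -> G -> K) := forall e : R, 0 < e -> exists N, forall n, (N <= n)%N ->
  forall c r (T : {linear r -> r}) (x : r), F c -> members c r ->
  limit_projection mu f C T -> rnorm (rep_int mu (q n) x - T x) <= e * rnorm x.
have UCp : UC p.
  move=> e e0; have [N NP] := expr34_small C e0.
  exists N => n Nn c r T x Fc cr [TC _ _].
  rewrite (p_iter n x (members_S_bounded M_ge1 cr)).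
  apply: le_trans (TC n.+1 x) _; apply: ler_wpM2r; first exact: rnorm_ge0.
  by apply: ltW; apply: NP; exact: leqW.
have UC_dist (q q' : nat -> G -> K) : (forall n, Cc (q n)) -> (forall n, Cc (q' n)) ->
    UC q -> UC q' -> forall e : R, 0 < e -> exists N, forall m n, (N <= m)%N ->
    (N <= n)%N -> (seminorm mu F (q m \- q' n)%R < e%:E)%E.
  move=> qC q'C uq uq' e e0; have e40 : 0 < e / 4 by rewrite divr_gt0.
  have [N1 N1P] := uq _ e40; have [N2 N2P] := uq' _ e40.
  exists (maxn N1 N2) => m n; rewrite !geq_max => /andP[N1m _] /andP[_ N2n].
  have e2e : ((e / 2)%:E < e%:E)%E by rewrite lte_fin; lra.
  apply: le_lt_trans e2e; apply/(seminormP (CcB (qC m) (q'C n))); first lra.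
  move=> c r x Fc cr; have [T TP] := TF c r Fc cr; rewrite rep_intB//.
  have h1 := N1P m N1m c r T x Fc cr TP; have h2 := N2P n N2n c r T x Fc cr TP.
  apply: le_trans (ler_rdist (T x) _ _) _; rewrite [X in _ + X]rdistC.
  exact: le_trans (lerD h1 h2) (quarters_le _ _).
have pC n := (pC1 n).1.
have pCauchy : cauchy_Cc mu F p by split; [exact: pC|exact: UC_dist].
have mem_UC q : cauchy_Cc mu F q -> cauchy_equiv mu F p q -> UC q.
  move=> [qC _] pq e e0; have e20 : 0 < e / 2 by rewrite divr_gt0.
  have [N1 N1P] := UCp _ e20; have [N2 _ N2P] := cvge0_lt pq e20.
  exists (maxn N1 N2) => n; rewrite geq_max => /andP[N1n N2n] c r T x Fc cr TP.
  have h1 := N1P n N1n c r T x Fc cr TP.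
  have := (seminormP (CcB (pC n) (qC n)) (ltW e20)).1 (ltW (N2P n N2n)) c r x Fc cr.
  rewrite rep_intB// => h2.
  apply: le_trans (ler_rdist (rep_int mu (p n) x) _ _) _; rewrite rdistC.
  exact: le_trans (lerD h2 h1) (halves_le _ _).
have UC_mem q : (forall n, Cc (q n)) -> UC q -> cauchy_Cc mu F q /\ cauchy_equiv mu F p q.
  move=> qC uq; split; first by split=> //; exact: UC_dist.
  apply: cvge0_le => [n|e e0]; first exact: seminorm_ge0.
  have [N NP] := UC_dist _ _ pC qC UCp uq e e0.
  by exists N => n Nn; apply: ltW; exact: NP.
pose P : completion mu F := Completion (ex_intro2 _ _ p pCauchy erefl).
exists P; split.
- move=> q [[qC qCauchy] pq]; have uq := mem_UC q (conj qC qCauchy) pq.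
  have qqC n : Cc (convolution mu (q n) (q n)) := convolution_Cc hG mu_haar (qC n) (qC n).
  apply: (UC_mem _ qqC) => e e0.
  (* The bound 1 on [d] absorbs the quadratic term in [idempotent_bound]. *)
  pose d := Num.min 1 (e / (2 * (C + 1) + 1)).
  have C10 : 0 < 2 * (C + 1) + 1 by lra.
  have d0 : 0 < d by rewrite lt_min ltr01 divr_gt0.
  have d1 : d <= 1 by rewrite ge_min lexx.
  have de : d * (2 * (C + 1) + 1) <= e by rewrite -ler_pdivlMr// ge_min lexx orbT.
  have [N NP] := uq d d0; exists N => n Nn c r T x Fc cr TP.
  have [TC Tinv Tid] := TP.
  have rM := members_S_bounded M_ge1 cr.
  rewrite (rep_int_convolution hG lcG mu_haar genS M_ge1 (qC n) (qC n) x rM).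
  have TB y : rnorm (T y) <= (C + 1) * rnorm y.
    have := TC 0%N y; rewrite expr0 mulr1 /= => h.
    rewrite -[T y](subrK y) (le_trans (ler_rnormD _ _))// mulrDl mul1r lerD2r.
    by rewrite rdistC.
  set y := rep_int mu (q n) x.
  have h1 : rnorm (y - T x) <= d * rnorm x := NP n Nn c r T x Fc cr TP.
  have h2 := NP n Nn c r T (y - T x) Fc cr TP.
  have h3 := NP n Nn c r T (T x) Fc cr TP; rewrite (Tid (T x) (Tinv x)) in h3.
  have qB : rep_int mu (q n) (y - T x) = rep_int mu (q n) y - rep_int mu (q n) (T x).
    have := rep_int_linear hG mu_haar (qC n) (-1) (T x) y.
    by rewrite !scaleN1r addrC => ->; rewrite addrC.
  have h4 : rnorm (rep_int mu (q n) (y - T x)) <= (C + 1 + d) * (d * rnorm x).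
    rewrite -[rep_int _ _ _](subrK (T (y - T x))) (le_trans (ler_rnormD _ _))//.
    apply: (@le_trans _ _ ((C + 1 + d) * rnorm (y - T x))).
      by rewrite mulrDl addrC lerD.
    by apply: ler_wpM2l => //; rewrite !addr_ge0// ltW.
  rewrite qB in h4.
  have h5 := ler_rdist (rep_int mu (q n) (T x)) (rep_int mu (q n) y) (T x).
  apply: le_trans h5 _; apply: le_trans (lerD h4 h3) _.
  apply: le_trans (idempotent_bound (ltW d0) d1 (rnorm_ge0 x) (TB x)) _.
  by apply: ler_wpM2r => //; exact: rnorm_ge0.
- move=> e e0; have [N NP] := UC_dist _ _ pC pC UCp UCp e e0.
  have e20 : 0 < e / 2 by rewrite divr_gt0.
  have [N1 N1P] := UCp _ e20.
  pose n0 := N1.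
  exists (p N1); first exact: pC1.
  move=> q [[qC qCauchy] pq]; have uq := mem_UC q (conj qC qCauchy) pq.
  have e40 : 0 < e / 4 by rewrite divr_gt0.
  have [N2 N2P] := uq _ e40; exists N2 => // n Nn /=.
  have e34 : ((3 / 4 * e)%:E < e%:E)%E by rewrite lte_fin; lra.
  apply: le_lt_trans e34; apply/(seminormP (CcB (qC n) (pC N1))); first lra.
  move=> c r x Fc cr; have [T TP] := TF c r Fc cr; rewrite rep_intB//.
  have h1 := N1P N1 (leqnn _) c r T x Fc cr TP; have h2 := N2P n Nn c r T x Fc cr TP.
  apply: le_trans (ler_rdist (T x) _ _) _; rewrite [X in _ + X]rdistC.
  exact: le_trans (lerD h2 h1) (quarter_half_le _ _).
- move=> c r Fc cr; have [T TP] := TF c r Fc cr; have [TC Tinv Tid] := TP.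
  exists T.
    move=> q [[qC qCauchy] pq]; have uq := mem_UC q (conj qC qCauchy) pq.
    have TZ n (a : K) y : (rep_int mu (q n) \- T) (a *: y) = a *: (rep_int mu (q n) \- T) y.
      by rewrite /= rep_intZ// linearZ -scalerBr.
    apply: cvge0_le => [n|e e0]; first exact: opnorm_ge0 (TZ n).
    have [N NP] := uq e e0; exists N => n Nn.
    by apply/(opnormP (ltW e0) (TZ n)) => x; exact: NP Fc cr TP.
  split.
  + move=> x; apply/cvg_rnormP => e e0; apply/nbhs_rnormP.
    exists (e / (C + 1)) => [|y]; first by rewrite divr_gt0// ltr_wpDl.
    rewrite ltr_pdivlMr ?ltr_wpDl// => xy; rewrite -linearB.
    have := TC 0%N (y - x); rewrite expr0 mulr1 /= => h.
    apply: le_lt_trans xy; rewrite mulrC mulrDl mul1r.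
    rewrite -[T (y - x)](subrK (y - x)) (le_trans (ler_rnormD _ _))// lerD2r.
    by rewrite (rdistC (T (y - x))); exact: h.
  + by move=> x; exact: (Tid _ (Tinv x)).
  + apply/seteqP; split=> [_ [x _ <-]|x xinv]; first exact: Tinv.
    by exists x => //; exact: Tid.
Qed.

End FromContracting.

End KazhdanProjections.

(** * Ultraproducts *)

(* The axioms are only required on the subspace ss_mem, so that a limit along an
   ultrafilter, which is meaningful for bounded families only, is a seminorm. *)
Record seminormed_space (R : realType) (k : scalar_kind) := SeminormedSpace {
  ss_space :> lmodType (scalar_field R k) ;
  ss_mem : ss_space -> Prop ;
  ss_norm : ss_space -> R ;
  ss_mem0 : ss_mem 0 ;
  ss_memP : forall a x y, ss_mem x -> ss_mem y -> ss_mem (a *: x + y) ;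
  ss_norm_ge0 : forall x, ss_mem x -> 0 <= ss_norm x ;
  ss_normD : forall x y, ss_mem x -> ss_mem y ->
    ss_norm (x + y) <= ss_norm x + ss_norm y ;
  ss_normZ : forall a x, ss_mem x ->
    ss_norm (a *: x) = rnorm (a : (scalar_field R k)^o) * ss_norm x ;
  ss_complete : forall x : nat -> ss_space, (forall n, ss_mem (x n)) ->
    (forall e : R, 0 < e -> exists N, forall m n, (N <= m)%N -> (N <= n)%N ->
       ss_norm (x m - x n) < e) ->
    exists2 l, ss_mem l & forall e : R, 0 < e -> exists N, forall n, (N <= n)%N ->
      ss_norm (x n - l) < e
}.

Section Separation.
Context (R : realType) (k : scalar_kind) (V : seminormed_space R k).
Local Notation K := (scalar_field R k).
Local Notation P := (@ss_mem R k V).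
Local Notation N := (@ss_norm R k V).
Implicit Types (x y z : V) (a : K).

Let PD x y : P x -> P y -> P (x + y).
Proof. by move=> Px Py; rewrite -[x]scale1r; exact: ss_memP. Qed.

Let PZ a x : P x -> P (a *: x).
Proof. by move=> Px; rewrite -[X in P X]addr0; apply: ss_memP => //; exact: ss_mem0. Qed.

Let PN x : P x -> P (- x).
Proof. by rewrite -scaleN1r; exact: PZ. Qed.

Let N0 : N 0 = 0.
Proof. by rewrite -(scale0r 0) ss_normZ ?rnorm0 ?mul0r//; exact: ss_mem0. Qed.

Let NN x : P x -> N (- x) = N x.
Proof. by move=> Px; rewrite -scaleN1r ss_normZ// rnormN rnorm1 mul1r. Qed.

Definition ss_equiv x y := P y /\ N (y - x) = 0.

(** The quotient of the subspace [ss_mem] by its null vectors; a point is an equivalence class,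
    itself a predicate on [V]. *)
Definition separated : Type := {A : V -> Prop | exists2 x, P x & A = ss_equiv x}.

Definition ss_class x (Px : P x) : separated := exist _ _ (ex_intro2 _ _ x Px erefl).

Definition ss_repr (q : separated) : V := sval (cid2 (svalP q)).

Lemma ss_reprP q : P (ss_repr q).
Proof. by rewrite /ss_repr; case: cid2. Qed.

Let equivS x y : P x -> P y -> N (y - x) = 0 -> N (x - y) = 0.
Proof. by move=> Px Py <-; rewrite -NN ?opprB//; apply: PD => //; exact: PN. Qed.

Let equivT x y z : P x -> P y -> P z -> N (x - y) = 0 -> N (y - z) = 0 -> N (x - z) = 0.
Proof.
move=> Px Py Pz xy yz; apply/eqP; rewrite eq_le ss_norm_ge0 ?andbT; last first.
  by apply: PD => //; exact: PN.
rewrite -(subrKA y) (le_trans (ss_normD _ _)) ?xy ?yz ?addr0//.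
  by apply: PD => //; exact: PN.
by apply: PD => //; exact: PN.
Qed.

Lemma ss_classP x y (Px : P x) (Py : P y) : N (x - y) = 0 -> ss_class Px = ss_class Py.
Proof.
move=> xy; apply: eq_exist; apply/funext => z; apply/propext.
rewrite /ss_equiv; split=> -[Pz zx]; split => //; first exact: equivT zx xy.
by apply: equivT zx _ => //; exact: equivS.
Qed.

Lemma ss_class_eq x y (Px : P x) (Py : P y) : ss_class Px = ss_class Py -> N (x - y) = 0.
Proof.
move=> /(congr1 sval) /= /(congr1 (fun A => A x)) xy.
have : ss_equiv y x by rewrite -xy /ss_equiv subrr.
by case.
Qed.

Lemma ss_reprK q : ss_class (ss_reprP q) = q.
Proof.
have : sval q = ss_equiv (ss_repr q) by rewrite /ss_repr; case: cid2.
move: (ss_reprP q); move: (ss_repr q) => x Px.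
by case: q => A AP /= e; apply: eq_exist.
Qed.

Lemma ss_class_repr x (Px : P x) : N (ss_repr (ss_class Px) - x) = 0.
Proof. exact: (ss_class_eq (ss_reprK (ss_class Px))). Qed.

HB.instance Definition _ := gen_eqMixin separated.
HB.instance Definition _ := gen_choiceMixin separated.

(** A total version of [ss_class]: vectors outside [ss_mem] go to the class of 0, which removes the
    membership proof from terms. *)
Definition ss_pi x : separated :=
  match pselect (P x) with left Px => ss_class Px | right _ => ss_class (ss_mem0 V) end.

Lemma ss_piE x (Px : P x) : ss_pi x = ss_class Px.
Proof. by rewrite /ss_pi; case: pselect => // Px'; apply: ss_classP; rewrite subrr. Qed.

Lemma ss_pi_eq x y : P x -> P y -> N (x - y) = 0 -> ss_pi x = ss_pi y.
Proof. by move=> Px Py xy; rewrite (ss_piE Px) (ss_piE Py); exact: ss_classP. Qed.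

Lemma ss_piK q : ss_pi (ss_repr q) = q.
Proof. by rewrite (ss_piE (ss_reprP q)) ss_reprK. Qed.

Lemma ss_repr_pi x : P x -> N (ss_repr (ss_pi x) - x) = 0.
Proof. by move=> Px; rewrite (ss_piE Px) ss_class_repr. Qed.

Let sadd p q := ss_pi (ss_repr p + ss_repr q).
Let sopp p := ss_pi (- ss_repr p).
Let sscale a p := ss_pi (a *: ss_repr p).

Let N0D x y : P x -> P y -> N x = 0 -> N y = 0 -> N (x + y) = 0.
Proof.
move=> Px Py x0 y0; apply/eqP; rewrite eq_le; apply/andP; split; last first.
  by apply: ss_norm_ge0; exact: PD.
by rewrite (le_trans (ss_normD Px Py))// x0 y0 addr0.
Qed.

Let saddE x y : P x -> P y -> sadd (ss_pi x) (ss_pi y) = ss_pi (x + y).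
Proof.
move=> Px Py; have Rx := ss_reprP (ss_pi x); have Ry := ss_reprP (ss_pi y).
apply: ss_pi_eq; [exact: PD|exact: PD|].
rewrite opprD addrACA; apply: N0D; try exact: ss_repr_pi.
  by apply: PD => //; exact: PN.
by apply: PD => //; exact: PN.
Qed.

Let sscaleE a x : P x -> sscale a (ss_pi x) = ss_pi (a *: x).
Proof.
move=> Px; have Rx := ss_reprP (ss_pi x); apply: ss_pi_eq; [exact: PZ|exact: PZ|].
rewrite -scalerBr ss_normZ ?ss_repr_pi ?mulr0//.
by apply: PD => //; exact: PN.
Qed.

Let soppE x : P x -> sopp (ss_pi x) = ss_pi (- x).
Proof.
move=> Px; have Rx := ss_reprP (ss_pi x); apply: ss_pi_eq; [exact: PN|exact: PN|].
by rewrite -opprD NN ?ss_repr_pi//; apply: PD => //; exact: PN.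
Qed.

Let sepP q : exists2 x, P x & q = ss_pi x.
Proof. by exists (ss_repr q); [exact: ss_reprP|rewrite ss_piK]. Qed.

Let saddA : associative sadd.
Proof.
move=> p q r; have [x Px ->] := sepP p; have [y Py ->] := sepP q.
have [z Pz ->] := sepP r; rewrite !saddE ?addrA//; exact: PD.
Qed.

Let saddC : commutative sadd.
Proof. by move=> p q; rewrite /sadd addrC. Qed.

Let sadd0 : left_id (ss_pi 0) sadd.
Proof.
by move=> p; have [x Px ->] := sepP p; rewrite saddE ?add0r//; exact: ss_mem0.
Qed.

Let saddN : left_inverse (ss_pi 0) sopp sadd.
Proof.
by move=> p; have [x Px ->] := sepP p; rewrite soppE// saddE ?addNr//; exact: PN.
Qed.

HB.instance Definition _ := GRing.isZmodule.Build separated saddA saddC sadd0 saddN.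

Lemma ss_piD x y : P x -> P y -> ss_pi (x + y) = ss_pi x + ss_pi y.
Proof. by move=> Px Py; rewrite -saddE. Qed.

Let sscaleA a b p : sscale a (sscale b p) = sscale (a * b) p.
Proof.
by have [x Px ->] := sepP p; rewrite !sscaleE ?scalerA//; exact: PZ.
Qed.

Let sscale1 : left_id 1 sscale.
Proof. by move=> p; have [x Px ->] := sepP p; rewrite sscaleE ?scale1r. Qed.

Let sscaleDr : right_distributive sscale +%R.
Proof.
move=> a p q; have [x Px ->] := sepP p; have [y Py ->] := sepP q.
rewrite -(ss_piD Px Py) (sscaleE a (PD Px Py)) (sscaleE a Px) (sscaleE a Py).
by rewrite scalerDr (ss_piD (PZ a Px) (PZ a Py)).
Qed.

Let sscaleDl p : {morph sscale^~ p : a b / a + b}.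
Proof.
move=> a b; have [x Px ->] := sepP p.
rewrite /= (sscaleE _ Px) (sscaleE a Px) (sscaleE b Px).
by rewrite scalerDl (ss_piD (PZ a Px) (PZ b Px)).
Qed.

HB.instance Definition _ := @GRing.Zmodule_isLmodule.Build K separated sscale
  sscaleA sscale1 sscaleDr sscaleDl.

Lemma ss_piZ a x : P x -> ss_pi (a *: x) = a *: ss_pi x.
Proof. by move=> Px; rewrite -sscaleE. Qed.

Let snorm p := N (ss_repr p).

Let snormE x : P x -> snorm (ss_pi x) = N x.
Proof.
move=> Px; have Rx := ss_reprP (ss_pi x); apply/eqP; rewrite eq_le /snorm.
have Px' : P (x - ss_repr (ss_pi x)) by apply: PD => //; exact: PN.
have Px'' : P (ss_repr (ss_pi x) - x) by apply: PD => //; exact: PN.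
apply/andP; split.
  rewrite -[ss_repr _](subrK x) (le_trans (ss_normD Px'' Px))//.
  by rewrite ss_repr_pi// add0r.
rewrite -[x in leLHS](subrK (ss_repr (ss_pi x))) (le_trans (ss_normD Px' Rx))//.
by rewrite (equivS _ _ (ss_repr_pi Px))// add0r.
Qed.

Let Knorm p : K := of_real k (snorm p).

Let KnormD p q : Knorm (p + q) <= Knorm p + Knorm q.
Proof.
have [x Px ->] := sepP p; have [y Py ->] := sepP q.
rewrite /Knorm -(ss_piD Px Py) (snormE (PD Px Py)) (snormE Px) (snormE Py).
by rewrite -of_realD ler_of_real ss_normD.
Qed.

Let KnormZ (a : K) p : Knorm (a *: p) = `|a| * Knorm p.
Proof.
have [x Px ->] := sepP p.
rewrite /Knorm -(ss_piZ a Px) (snormE (PZ a Px)) (snormE Px) ss_normZ// of_realM.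
congr (_ * _).
by rewrite -(@rnormE R k K^o).
Qed.

Let Knorm0 p : Knorm p = 0 -> p = 0.
Proof.
have [x Px ->] := sepP p; rewrite /Knorm snormE// => x0.
apply: ss_pi_eq => //; first exact: ss_mem0.
by rewrite subr0 -[LHS](of_realK k) x0; case: k.
Qed.

HB.instance Definition _ := @Lmodule_isNormed.Build K separated Knorm KnormD KnormZ Knorm0.

Lemma rnorm_ss_pi x : P x -> rnorm (ss_pi x : separated) = N x.
Proof. by move=> Px; rewrite -snormE// -[RHS](of_realK k). Qed.

(** Centres [q n] of balls of radius [1 / (n + 1)] belonging to the filter form a Cauchy sequence;
    the limit of its lift to [V] gives the limit of the filter. *)
Lemma ss_pi_complete (F : set_system separated) : ProperFilter F -> cauchy F -> cvg F.
Proof.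
move=> FF Fc; have Fe (e : R) : 0 < e -> exists q, F (fun z : separated => rnorm (z - q) < e).
  move=> e0; have e0' : 0 < of_real k e by rewrite of_real_gt0.
  have /cauchyP/(_ _ e0')[q Fq] := Fc; exists q; apply: filterS Fq => z /=.
  by rewrite -ball_normE /= rnormE ltr_of_real rdistC.
have n0 n : 0 < (n.+1%:R : R)^-1 by rewrite invr_gt0.
have [q qP] := choice (fun n => Fe _ (n0 n)).
have qmn m n : rnorm (q m - q n) < m.+1%:R^-1 + n.+1%:R^-1.
  have [z [zm zn]] := filter_ex (filterI (qP m) (qP n)).
  apply: le_lt_trans (ler_rdist z _ _) _; rewrite (rdistC (q m)).
  exact: ltrD.
pose x n := ss_repr (q n).
have xP n : P (x n) by exact: ss_reprP.
have NE y z : P y -> P z -> N (y - z) = rnorm (ss_pi y - ss_pi z : separated).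
  move=> Py Pz; rewrite -(rnorm_ss_pi (PD Py (PN Pz))) (ss_piD Py (PN Pz)).
  by rewrite -scaleN1r (ss_piZ (-1) Pz) scaleN1r.
have inv_small (e : R) : 0 < e -> exists M, forall m, (M <= m)%N -> m.+1%:R^-1 < e.
  move=> e0; have [M _ MP] := near_infty_natSinv_lt (PosNum e0).
  by exists M => m Mm; apply: MP.
have [|l Pl xl] := ss_complete xP.
  move=> e e0; have [|M MP] := inv_small (e / 2); first by rewrite divr_gt0.
  exists M => m n Mm Mn; rewrite (NE _ _ (xP m) (xP n)) !ss_piK.
  by apply: lt_trans (qmn m n) _; rewrite (splitr e) ltrD// MP.
apply/cvg_ex; exists (ss_pi l); apply/cvg_rnormP => e e0.
have e20 : 0 < e / 2 by rewrite divr_gt0.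
have [M MP] := inv_small _ e20; have [M' M'P] := xl _ e20.
pose n := maxn M M'; apply: filterS (qP n) => z zq.
apply: le_lt_trans (ler_rdist (q n) _ _) _; rewrite (splitr e) ltrD//.
  by apply: lt_trans zq _; apply: MP; exact: leq_maxl.
by rewrite -(ss_piK (q n)) -(NE _ _ (xP n) Pl); apply: M'P; exact: leq_maxr.
Qed.

HB.instance Definition _ := Uniform_isComplete.Build separated ss_pi_complete.

End Separation.

(** The interface to the quotient: the construction of limit representations uses only these three
    properties. *)
Lemma seminormed_separation (R : realType) (k : scalar_kind) (V : seminormed_space R k) :
  exists (E : completeNormedModType (scalar_field R k)) (f : V -> E),
  [/\ (forall a x y, ss_mem x -> ss_mem y -> f (a *: x + y) = a *: f x + f y),
      (forall x, ss_mem x -> rnorm (f x) = ss_norm x) &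
      (forall q, exists2 x, ss_mem x & f x = q)].
Proof.
exists (separated V : completeNormedModType _), (@ss_pi R k V); split.
- move=> a x y Px Py; rewrite -(ss_piZ a Px) ss_piD//.
  by rewrite -[a *: x]addr0; apply: ss_memP => //; exact: ss_mem0.
- by move=> x Px; exact: rnorm_ss_pi.
- by move=> q; exists (ss_repr q); [exact: ss_reprP|exact: ss_piK].
Qed.

(** A named dependent product, able to carry the pointwise module structure of a family of spaces
    that varies with [j]. *)
Definition dprod (J : Type) (V : J -> Type) := forall j, V j.

Section DependentProduct.
Context (K : pzRingType) (J : Type) (V : J -> lmodType K).
Local Notation X := (dprod V).

HB.instance Definition _ := gen_eqMixin X.
HB.instance Definition _ := gen_choiceMixin X.

Let add (x y : X) : X := fun j => x j + y j.
Let zero : X := fun j => 0.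
Let opp (x : X) : X := fun j => - x j.
Let scale (a : K) (x : X) : X := fun j => a *: x j.

Let addA : associative add.
Proof. by move=> x y z; apply: (@functional_extensionality_dep J V) => j; exact: addrA. Qed.
Let addC : commutative add.
Proof. by move=> x y; apply: (@functional_extensionality_dep J V) => j; exact: addrC. Qed.
Let add0 : left_id zero add.
Proof. by move=> x; apply: (@functional_extensionality_dep J V) => j; exact: add0r. Qed.
Let addN : left_inverse zero opp add.
Proof. by move=> x; apply: (@functional_extensionality_dep J V) => j; exact: addNr. Qed.

HB.instance Definition _ := GRing.isZmodule.Build X addA addC add0 addN.

Let dscalerA a b x : scale a (scale b x) = scale (a * b) x.
Proof. by apply: (@functional_extensionality_dep J V) => j; exact: scalerA. Qed.
Let scale1 : left_id 1 scale.
Proof. by move=> x; apply: (@functional_extensionality_dep J V) => j; exact: scale1r. Qed.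
Let scaleDr : right_distributive scale +%R.
Proof. by move=> a x y; apply: (@functional_extensionality_dep J V) => j; exact: scalerDr. Qed.
Let scaleDl x : {morph scale^~ x : a b / a + b}.
Proof. by move=> a b; apply: (@functional_extensionality_dep J V) => j; exact: scalerDl. Qed.

HB.instance Definition _ := @GRing.Zmodule_isLmodule.Build K X scale
  dscalerA scale1 scaleDr scaleDl.

End DependentProduct.

(** * Limits of norms along an ultrafilter *)

Section UltraLimits.
Context (R : realType) (J : Type) (U : set_system J) (FU : UltraFilter U).

Lemma ultra_bounded_cvg (u : J -> R) (C : R) : (\forall j \near U, `|u j| <= C) ->
  exists l : R, u j @[j --> U] --> l.
Proof.
move=> uC; have cC : compact `[- C, C]%classic by exact: segment_compact.
have FF : ProperFilter (u @ U) by exact: fmap_proper_filter.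
have [|l [_ lu]] := cC (u @ U) FF.
  by apply: filterS uC => j /=; rewrite ler_norml in_itv.
exists l => A lA; have [//|UA] := in_ultra_setVsetC (u @^-1` A) FU.
by have [y []] := lu (~` A) A UA lA.
Qed.

Lemma ultra_pos (A : set J) : U A -> exists j, A j.
Proof. by move=> UA; have [j Aj] := filter_ex UA; exists j. Qed.

Section Seminorm.
Context (k : scalar_kind) (E : J -> completeNormedModType (scalar_field R k)).
Local Notation K := (scalar_field R k).
Local Notation X := (dprod (E : J -> lmodType K)).
Implicit Types (x y : X).

Definition unorm x : R := lim ((fun j => rnorm (x j)) @ U).

Definition ubounded x := exists C, \forall j \near U, rnorm (x j) <= C.

Lemma unorm_cvg x : ubounded x -> rnorm (x j) @[j --> U] --> unorm x.
Proof.
move=> [C xC]; have [|l xl] := @ultra_bounded_cvg (fun j => rnorm (x j)) C.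
  by apply: filterS xC => j; rewrite ger0_norm ?rnorm_ge0.
by rewrite /unorm (cvg_lim _ xl).
Qed.

Lemma unorm_le x C : (\forall j \near U, rnorm (x j) <= C) -> unorm x <= C.
Proof.
move=> xC; have xb : ubounded x by exists C.
by apply: limr_le => //; exact: cvgP (unorm_cvg xb).
Qed.

Lemma unorm_lt x C : ubounded x -> unorm x < C -> \forall j \near U, rnorm (x j) < C.
Proof. by move=> xb xC; apply: (cvgr_lt _ (unorm_cvg xb)). Qed.

Lemma unorm_ge0 x : ubounded x -> 0 <= unorm x.
Proof.
move=> xb; apply: limr_ge; first exact: cvgP (unorm_cvg xb).
by apply: nearW => j; exact: rnorm_ge0.
Qed.

Lemma uboundedP a x y : ubounded x -> ubounded y -> ubounded (a *: x + y).
Proof.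
move=> [C xC] [D yD]; exists (rnorm (a : K^o) * C + D).
apply: filterS2 xC yD => j xjC yjD; apply: le_trans (ler_rnormD _ _) _.
by rewrite rnormZ lerD// ler_wpM2l// rnorm_ge0.
Qed.

Lemma unormD x y : ubounded x -> ubounded y -> unorm (x + y) <= unorm x + unorm y.
Proof.
move=> xb yb; have xyb : ubounded (x + y) by rewrite -[x]scale1r; exact: uboundedP.
have h : rnorm (x j) + rnorm (y j) @[j --> U] --> unorm x + unorm y.
  by apply: cvgD; exact: unorm_cvg.
apply/ler_addgt0Pr => e e0; apply: unorm_le.
have : \forall j \near U, rnorm (x j) + rnorm (y j) < unorm x + unorm y + e.
  by apply: (cvgr_lt _ h); rewrite ltrDl.
by apply: filterS => j /ltW; apply: le_trans; exact: ler_rnormD.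
Qed.

Lemma unormZ a x : ubounded x -> unorm (a *: x) = rnorm (a : K^o) * unorm x.
Proof.
move=> xb; have h : rnorm (a : K^o) * rnorm (x j) @[j --> U] --> rnorm (a : K^o) * unorm x.
  by apply: cvgM; [exact: cvg_cst|exact: unorm_cvg].
rewrite -[RHS](cvg_lim (@Rhausdorff R) h) /unorm; congr (lim (_ @ U)).
by apply/funext => j; rewrite rnormZ.
Qed.

Context (D : X -> Prop) (D0 : D 0) (DP : forall a x y, D x -> D y -> D (a *: x + y)).
Hypothesis Db : forall x, D x -> ubounded x.

(* The ultraproduct itself is in general neither separable nor a continuous
   representation; the closure of a suitable subspace is both. *)
Definition uclosure x := forall e : R, 0 < e ->
  exists2 d, D d & \forall j \near U, rnorm (x j - d j) <= e.

Lemma uclosure_sub d : D d -> uclosure d.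
Proof.
move=> Dd e e0; exists d => //; apply: nearW => j.
by rewrite subrr rnorm0 ltW.
Qed.

Lemma uclosure_bounded x : uclosure x -> ubounded x.
Proof.
move=> /(_ 1 ltr01)[d Dd xd]; have [C dC] := Db Dd; exists (1 + C).
apply: filterS2 xd dC => j xdj dj; rewrite -[x j](subrK (d j)).
by rewrite (le_trans (ler_rnormD _ _))// lerD.
Qed.

Lemma uclosureP a x y : uclosure x -> uclosure y -> uclosure (a *: x + y).
Proof.
move=> xP yP e e0.
pose q := rnorm (a : K^o) + 1; have q0 : 0 < q by rewrite ltr_wpDl ?rnorm_ge0.
have e1 : 0 < e / 2 / q by rewrite !divr_gt0.
have e2 : 0 < e / 2 by rewrite divr_gt0.
have [d Dd xd] := xP _ e1; have [d' Dd' yd] := yP _ e2.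
exists (a *: d + d'); first exact: DP.
apply: filterS2 xd yd => j xdj ydj.
have -> : (a *: x + y) j - (a *: d + d') j = a *: (x j - d j) + (y j - d' j).
  by rewrite scalerBr addrACA -opprD.
apply: le_trans (ler_rnormD _ _) _; rewrite (splitr e) lerD// rnormZ.
apply: le_trans (ler_wpM2l (rnorm_ge0 _) xdj) _.
by rewrite [leLHS]mulrC; exact: div_mul_le e2 (rnorm_ge0 _).
Qed.

(** The usual proof that ultraproducts are complete. Along a fast subsequence each increment is
    small on a set of [U], but countably many such sets may have an intersection outside [U]. At
    each [j] the increments that are too large are therefore dropped: the series converges for every
    [j], and each partial sum is unchanged on a set of [U]. *)
Lemma uclosure_complete (x : nat -> X) : (forall n, uclosure (x n)) ->
  (forall e : R, 0 < e -> exists N, forall m n, (N <= m)%N -> (N <= n)%N ->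
     unorm (x m - x n) < e) ->
  exists2 l, uclosure l & forall e : R, 0 < e -> exists N, forall n, (N <= n)%N ->
    unorm (x n - l) < e.
Proof.
move=> xP xC.
have subP y z : uclosure y -> uclosure z -> uclosure (y - z).
  by move=> yP zP; rewrite addrC -scaleN1r; exact: uclosureP.
have q0 : 0 < 3 / 4 :> R by lra.
have [s sP] := choice (fun i => xC ((3 / 4) ^+ i) (exprn_gt0 i q0)).
(* A nondecreasing majorant of [s], so that [z i] and [z i.+1] are both past the threshold for
   [(3 / 4) ^+ i]. *)
pose s' := fix s' i := if i is i'.+1 then maxn (s' i') (s i) else s 0%N.
have ss' i : (s i <= s' i)%N by case: i => //= i; exact: leq_maxr.
have s'S i : (s' i <= s' i.+1)%N by exact: leq_maxl.
pose z i := x (s' i).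
have zS i : unorm (z i.+1 - z i) < (3 / 4) ^+ i.
  by apply: sP; [exact: leq_trans (ss' i) (s'S i)|exact: ss'].
pose A i := [set j | rnorm (z i.+1 j - z i j) < (3 / 4) ^+ i].
have UA i : U (A i).
  apply: (unorm_lt (x := z i.+1 - z i)) => //; apply: uclosure_bounded.
  exact: subP (xP _) (xP _).
pose w j := fix w i : E j := if i is i'.+1 then
  w i' + (if `[< A i' j >] then z i j - z i' j else 0) else z 0%N j.
have wS j i : rnorm (w j i.+1 - w j i) <= 1 * (3 / 4) ^+ i.
  rewrite /= addrC addKr mul1r; case: asboolP => [/ltW//|_].
  by rewrite rnorm0 exprn_ge0// ltW.
pose l : X := fun j => sval (cid (geometric_limit (@rnorm_cauchy_cvg R k (E j)) (wS j))).
have lP j i : rnorm (w j i - l j) <= 4 * 1 * (3 / 4) ^+ i.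
  by rewrite /l; case: cid.
have wz i : \forall j \near U, w j i = z i j.
  elim: i => [|i ih]; first by apply: nearW.
  apply: filterS2 ih (UA i) => j ih Aj /=.
  by rewrite ih asboolT// addrC subrK.
have zl i : \forall j \near U, rnorm ((z i - l) j) <= 4 * (3 / 4) ^+ i.
  apply: filterS (wz i) => j wzj; have := lP j i.
  by rewrite mulr1 wzj.
have lU : uclosure l.
  move=> e e0; have e20 : 0 < e / 2 by rewrite divr_gt0.
  have [i iP] := expr34_small 4 e20; have {}iP := ltW (iP i (leqnn i)).
  have [d Dd zd] := xP (s' i) _ e20; exists d => //.
  apply: filterS2 zd (zl i) => j zdj zlj.
  apply: le_trans (ler_rdist (z i j) _ _) _; rewrite (splitr e) lerD//.
  by rewrite rdistC; exact: le_trans zlj iP.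
exists l => // e e0; have e20 : 0 < e / 2 by rewrite divr_gt0.
have [i iP] := expr34_small 4 e20; have {}iP := iP i (leqnn i).
have qi : 0 <= (3 / 4 : R) ^+ i by rewrite exprn_ge0// ltW.
exists (s i) => n sn.
have xb y z' : uclosure y -> uclosure z' -> ubounded (y - z').
  by move=> yP zP; apply: uclosure_bounded; exact: subP.
have -> : x n - l = (x n - z i) + (z i - l) by rewrite subrKA.
apply: le_lt_trans (unormD (xb _ _ (xP n) (xP _)) (xb _ _ (xP _) lU)) _.
rewrite (splitr e); apply: ltr_leD.
  by apply: lt_le_trans (sP i n (s' i) sn (ss' i)) _; rewrite (le_trans _ (ltW iP))// ler_peMl// ler1n.
exact: le_trans (unorm_le (zl i)) (ltW iP).
Qed.

Definition ultraproduct_closure : seminormed_space R k :=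
  @SeminormedSpace R k X uclosure unorm (uclosure_sub D0) uclosureP
    (fun x xP => unorm_ge0 (uclosure_bounded xP))
    (fun x y xP yP => unormD (uclosure_bounded xP) (uclosure_bounded yP))
    (fun a x xP => unormZ a (uclosure_bounded xP)) uclosure_complete.

End Seminorm.

End UltraLimits.

(** * Limits of representations and cocycles *)

Section LimitRep.
Context (R : realType) (k : scalar_kind) (G : topologicalGroupType).
Local Notation K := (scalar_field R k).
Context (mu : {measure set (borel G) -> \bar R}) (S : set G) (M : R).
Hypotheses (hG : hausdorff_space G) (lcG : locally_compact [set: G])
  (mu_haar : left_haar mu) (cS : compact S) (SV : forall g, S g -> S g^-1%g)
  (S1 : S 1%g) (genS : generates S) (M_ge1 : 1 <= M).
Let M_ge0 : 0 <= M := le_trans ler01 M_ge1.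
Context (J : Type) (U : set_system J) (FU : UltraFilter U).
Context (r : J -> rep R k G) (rM : forall j, S_bounded S M (r j)).
Local Notation X := (dprod ((fun j => rep_space (r j)) : J -> lmodType K)).
Implicit Types (x y : X) (g h : G).

Definition act g x : X := fun j => rep_op (r j) g (x j).

Context (D : X -> Prop) (D0 : D 0) (DP : forall a x y, D x -> D y -> D (a *: x + y)).
Hypothesis Db : forall x, D x -> ubounded U x.
Hypothesis Dact : forall g x, D x -> D (act g x).
Hypothesis Dcont : forall x, D x -> forall e : R, 0 < e ->
  exists2 V, nbhs (1%g : G) V & forall v j, V v -> rnorm (act v x j - x j) <= e.
Hypothesis Dsep : exists (T : countType) (s : T -> X), (forall t, D (s t)) /\
  forall x, D x -> forall e : R, 0 < e -> exists t,
    \forall j \near U, rnorm (x j - s t j) <= e.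

Lemma actP g a x y : act g (a *: x + y) = a *: act g x + act g y.
Proof.
apply: (@functional_extensionality_dep J (fun j => rep_space (r j))) => j.
exact: linearP.
Qed.

Lemma act1 x : act 1%g x = x.
Proof.
apply: (@functional_extensionality_dep J (fun j => rep_space (r j))) => j.
exact: rep1.
Qed.

Lemma actM g h x : act (g * h)%g x = act g (act h x).
Proof.
apply: (@functional_extensionality_dep J (fun j => rep_space (r j))) => j.
exact: repM.
Qed.

Lemma act_le_compact Q : compact Q -> exists2 C : R, 0 < C &
  forall g x j, Q g -> rnorm (act g x j) <= C * rnorm (x j).
Proof.
move=> cQ; have [n Qn] := compact_word_ball_sub S1 hG mu_haar cS SV genS cQ.
exists (M ^+ n) => [|g x j /Qn]; first by rewrite exprn_gt0// (lt_le_trans ltr01).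
exact: (word_ball_rep M_ge1 (rM j)).
Qed.

Lemma act_le g : exists2 C : R, 0 < C & forall x j, rnorm (act g x j) <= C * rnorm (x j).
Proof.
have [C C0 CP] := act_le_compact (@compact_set1 _ g).
by exists C => // x j; exact: CP.
Qed.

Lemma unorm_scale x y (C : R) : 0 <= C -> ubounded U y ->
  (\forall j \near U, rnorm (x j) <= C * rnorm (y j)) -> unorm U x <= C * unorm U y.
Proof.
move=> C0 yb xy; apply/ler_addgt0Pr => e e0.
have d0 : 0 < e / (C + 1) by rewrite divr_gt0// ltr_wpDl.
have yU : unorm U y < unorm U y + e / (C + 1) by rewrite ltrDl.
apply: unorm_le; apply: filterS2 xy (unorm_lt FU yb yU) => j xyj yj.
apply: le_trans xyj _; apply: le_trans (ler_wpM2l C0 (ltW yj)) _.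
rewrite mulrDr lerD2l mulrC; exact: div_mul_le.
Qed.

Local Notation P := (uclosure U D).

Lemma act_closure g x : P x -> P (act g x).
Proof.
move=> xP e e0; have [C C0 CP] := act_le g.
have eC : 0 < e / C by rewrite divr_gt0.
have [d Dd xd] := xP _ eC; exists (act g d); first exact: Dact.
apply: filterS xd => j xdj.
have := CP (x - d) j => h; rewrite /act -linearB; apply: le_trans h _.
by rewrite mulrC -ler_pdivlMr.
Qed.

(** The operators act coordinatewise on the closure of [D] and pass to the quotient because word
    bounds hold uniformly in [j]. Continuity at 1 is uniform in [j] on [D] by [Dcont]; density and a
    bound on a compact neighbourhood of 1 extend it. Separability comes from [Dsep]. *)
Theorem limit_rep : exists (r' : rep R k G) (f : X -> r'),
  [/\ admissible S M r',
     (forall a x y, D x -> D y -> f (a *: x + y) = a *: f x + f y),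
     (forall x, D x -> rnorm (f x) = unorm U x),
     (forall g x, D x -> f (act g x) = rep_op r' g (f x)) &
     (forall q (e : R), 0 < e -> exists2 x, D x & rnorm (q - f x) <= e)].
Proof.
have [E [f [fP0 fN0 fS0]]] := seminormed_separation (ultraproduct_closure FU D0 DP Db).
have fP a x y : P x -> P y -> f (a *: x + y) = a *: f x + f y by exact: fP0.
have fN x : P x -> rnorm (f x) = unorm U x by exact: fN0.
have fS q : exists2 x, P x & f x = q by exact: fS0.
have Pb x : P x -> ubounded U x by exact: uclosure_bounded.
have PDsub x : D x -> P x by exact: uclosure_sub.
have PP a x y : P x -> P y -> P (a *: x + y) by exact: uclosureP.
have PB x y : P x -> P y -> P (x - y).
  by move=> Px Py; rewrite addrC -scaleN1r; exact: PP.
have fB x y : P x -> P y -> f (x - y) = f x - f y.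
  by move=> Px Py; rewrite addrC -scaleN1r fP// scaleN1r addrC.
have [sec secP] := choice (fun q => let: ex_intro2 x Px xq := fS q in
  ex_intro (fun x => P x /\ f x = q) x (conj Px xq)).
(* Independent of the section: two representatives of [q] differ by a vector of seminorm 0, and
   [act g] keeps it so. *)
pose op g q := f (act g (sec q)).
have op_f g x : P x -> op g (f x) = f (act g x).
  move=> Px; have [Ps fs] := secP (f x); have [C C0 CP] := act_le g.
  have PA y : P y -> P (act g y) by exact: act_closure.
  apply/eqP; rewrite -subr_eq0; apply/eqP; apply: rnorm0_eq0; apply/eqP.
  rewrite eq_le rnorm_ge0 andbT /op -(fB _ _ (PA _ Ps) (PA _ Px)).
  have Py := PB _ _ Ps Px.
  have -> : act g (sec (f x)) - act g x = act g (sec (f x) - x).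
    by rewrite -!(scaleN1r (act g x)) -!(scaleN1r x) addrC -actP addrC.
  rewrite (fN _ (PA _ Py)).
  apply: le_trans (unorm_scale (ltW C0) (Pb _ Py) (nearW _ (CP _))) _.
  by rewrite -(fN _ Py) (fB _ _ Ps Px) fs subrr rnorm0 mulr0.
have op_lin g a p q : op g (a *: p + q) = a *: op g p + op g q.
  have [x Px <-] := fS p; have [y Py <-] := fS q.
  rewrite -(fP _ _ _ Px Py) !op_f//; last exact: PP.
  by rewrite actP fP//; exact: act_closure.
have op_le g : exists2 C : R, 0 < C & forall q, rnorm (op g q) <= C * rnorm q.
  have [C C0 CP] := act_le g; exists C => // q; have [x Px <-] := fS q.
  rewrite op_f// (fN _ (act_closure g Px)) (fN _ Px).
  by apply: unorm_scale (ltW C0) (Pb _ Px) _; apply: nearW.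
have opB g p q : op g (p - q) = op g p - op g q.
  by rewrite addrC -scaleN1r op_lin scaleN1r addrC.
pose opL g : {linear E -> E} := HB.pack (op g) (GRing.isLinear.Build K E E *:%R (op g) (op_lin g)).
have op_cont g : continuous (opL g).
  have [C C0 CP] := op_le g => q; apply/cvg_rnormP => e e0; apply/nbhs_rnormP.
  exists (e / C) => [|p]; first by rewrite divr_gt0.
  rewrite ltr_pdivlMr// => pq; have := CP (p - q); rewrite opB => h.
  by apply: le_lt_trans h _; rewrite mulrC.
have op1 q : opL 1%g q = q.
  by have [x Px <-] := fS q; rewrite /= op_f// act1.
have opM g h q : opL (g * h)%g q = opL g (opL h q).
  have [x Px <-] := fS q; rewrite /= op_f// op_f//.
  by rewrite op_f ?actM//; exact: act_closure.
have dense_D q (e : R) : 0 < e -> exists2 x, D x & rnorm (q - f x) <= e.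
  move=> e0; have [x Px <-] := fS q; have [d Dd xd] := Px e e0.
  exists d => //; rewrite -(fB _ _ Px (PDsub _ Dd)) (fN _ (PB _ _ Px (PDsub _ Dd))).
  exact: unorm_le.
have op_cont1 q (e : R) : 0 < e -> \forall v \near (1%g : G), rnorm (op v q - q) <= e.
  move=> e0; have [V0 V01 cV0] := locally_compact_nbhs1 lcG.
  have [C C0 CP] := act_le_compact cV0.
  (* Three errors of [e / (C + 2)]: approximating [q] by [f x], once more after applying [op v]
     (with a factor [C]), and moving [x] by [v]. *)
  have q0 : 0 < C + 2 by rewrite addr_gt0.
  have d0 : 0 < e / (C + 2) by rewrite divr_gt0.
  have [x Dx qx] := dense_D q _ d0; have Px := PDsub _ Dx.
  have [V V1 VP] := Dcont Dx d0.
  near=> v.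
  have Vv : V v by near: v.
  have V0v : V0 v by near: v.
  have [y Py yq] := fS q.
  have h1 : rnorm (op v q - f (act v x)) <= C * (e / (C + 2)).
    rewrite -yq op_f// -(fB _ _ (act_closure v Py) (act_closure v Px)).
    have -> : act v y - act v x = act v (y - x).
      by rewrite -(scaleN1r (act v x)) -(scaleN1r x) addrC -actP addrC.
    rewrite (fN _ (act_closure v (PB _ _ Py Px))).
    apply: le_trans (unorm_scale (ltW C0) (Pb _ (PB _ _ Py Px)) (nearW _ _)) _.
      by move=> j; exact: CP.
    apply: ler_wpM2l; first exact: ltW.
    by rewrite -(fN _ (PB _ _ Py Px)) (fB _ _ Py Px) yq.
  have h2 : rnorm (f (act v x) - f x) <= e / (C + 2).
    rewrite -(fB _ _ (act_closure v Px) Px) (fN _ (PB _ _ (act_closure v Px) Px)).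
    by apply: unorm_le; apply: nearW => j; exact: VP.
  have h3 : rnorm (f x - q) <= e / (C + 2) by rewrite rdistC.
  apply: le_trans (ler_rdist (f (act v x)) _ _) _.
  apply: le_trans (lerD h1 (le_trans (ler_rdist (f x) _ _) (lerD h2 h3))) _.
  rewrite [leLHS](_ : _ = e / (C + 2) * (C + 2)); last by ring.
  by rewrite divfK// gt_eqF.
have op_scont q : continuous (fun g => opL g q).
  move=> g; apply/cvg_rnormP => e e0; have [C C0 CP] := op_le g.
  have d0 : 0 < e / 2 / C by rewrite !divr_gt0.
  have := nbhs_lcoset g (op_cont1 q _ d0).
  apply: filterS => h /= hq.
  have -> : op h q - op g q = op g (op (g^-1 * h)%g q - q).
    by rewrite opB -[in LHS](mulVKg g h); congr (_ - _); exact: opM.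
  apply: le_lt_trans (CP _) _.
  apply: le_lt_trans (ler_wpM2l (ltW C0) hq) _.
  by rewrite mulrC divfK ?gt_eqF// ltr_pdivrMr// mulr_natr mulr2n ltrDl.
pose r' := @Rep R k G E opL op_cont op1 opM op_scont.
exists r', f; split.
- split.
    have [T [s [Ds sP]]] := Dsep.
    exists (range (fun t => f (s t))); first exact: sub_countable (card_image_le _ _) (countableP _).
    move=> O [q Oq] oO.
    have /nbhs_rnormP[e e0 eO] : nbhs (q : E) O by apply: open_nbhs_nbhs.
    have e40 : 0 < e / 4 by rewrite divr_gt0.
    have [x Dx qx] := dense_D q _ e40; have [t xt] := sP x Dx _ e40.
    exists (f (s t)); split; last by exists t.
    apply: eO; rewrite rdistC; apply: le_lt_trans (ler_rdist (f x) _ _) _.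
    have h : rnorm (f x - f (s t)) <= e / 4.
      rewrite -(fB _ _ (PDsub _ Dx) (PDsub _ (Ds t))).
      rewrite (fN _ (PB _ _ (PDsub _ Dx) (PDsub _ (Ds t)))).
      exact: unorm_le.
    apply: le_lt_trans (lerD qx h) _.
    by rewrite -mulrDl ltr_pdivrMr// mulr_natr !mulrS; lra.
  move=> g Sg; apply/opnormP => // [a q|q]; first by rewrite linearZ.
  have [x Px <-] := fS q; rewrite /= op_f// (fN _ (act_closure g Px)) (fN _ Px).
  apply: unorm_scale => //; first exact: Pb.
  by apply: nearW => j; exact: (rep_op_le M_ge1 (rM j)).
- by move=> a x y Dx Dy; apply: fP; exact: PDsub.
- by move=> x Dx; apply: fN; exact: PDsub.
- by move=> g x Dx; rewrite /= op_f//; exact: PDsub.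
- exact: dense_D.
Unshelve. all: by end_near. Qed.

End LimitRep.

Lemma dist_quarters (R : realType) (p p' q q' e : R) : `|p - q'| <= e / 4 ->
  `|p' - q| <= e / 4 -> `|q - q'| <= e / 4 -> `|p - p'| <= 3 / 4 * e.
Proof. rewrite !ler_norml; lra. Qed.

Lemma net_error (R : realType) (a b ep eta : R) : 0 <= a -> ep <= 1 ->
  ep * b <= eta / 2 -> 3 * a <= eta / 2 -> a + ep * b + (1 + ep) * a <= eta.
Proof.
move=> a0 ep1 h1 h2; have h3 := ler_wpM2r a0 ep1; rewrite mul1r in h3.
rewrite mulrDl mul1r; lra.
Qed.

Lemma dist_four (R : realType) (p1 p2 p3 p4 p5 e : R) : `|p1 - p2| <= e / 4 ->
  `|p2 - p3| <= e / 4 -> `|p3 - p4| <= e / 4 -> `|p4 - p5| <= e / 4 ->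
  `|p1 - p5| <= e.
Proof. rewrite !ler_norml; lra. Qed.

(** * Riemann sums on a net fixed before the test function *)

Section Nets.
Context (R : realType) (k : scalar_kind) (G : topologicalGroupType).
Local Notation K := (scalar_field R k).
Context (mu : {measure set (borel G) -> \bar R}).
Hypotheses (hG : hausdorff_space G)
  (mu_fin : forall Q : set G, compact Q -> (mu Q < +oo)%E).

(* The points of the net depend on Q and V only, not on f. *)
Lemma net_sum (Q V : set G) : compact Q -> nbhs (1%g : G) V ->
  exists m (t : 'I_m -> G), (forall l, Q (t l)) /\
  forall (f : G -> K) (e : R), test_fun mu Q f -> 0 < e ->
  exists c : 'I_m -> K, (forall l, rnorm (c l : K^o) <= 1 + e) /\
  forall (E : normedModType K) (H : G -> E) (e' B : R), rnorm_complete E ->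
    continuous H -> 0 <= e' -> 0 <= B ->
    (forall x y, Q x -> Q y -> V (y^-1 * x)%g -> rnorm (H x - H y) <= e') ->
    (forall x, Q x -> rnorm (H x) <= B) ->
    rnorm (bochner mu (fun x => f x *: H x) - \sum_l c l *: H (t l)) <=
      e' + e * B + (1 + e) * e'.
Proof.
move=> cQ V1; have [s [sQ Qs]] := compact_translates_cover cQ V1.
exists (size s), (fun l => nth 1%g s l); split.
  by move=> l; apply: sQ; exact: mem_nth.
move=> f e [[cf cf'] fQ f1] e0.
have f0 : vanishes_off Q (f : G -> K^o).
  by move=> x Qx; apply: Cc_vanishes => /fQ.
have [n [u [c [uQ cB cP]]]] := riemann_sum hG mu_fin cQ cf f0 f1 V1 e0.
(* Each node [u i] of a Riemann sum for [f] is moved to a nearby point of the net, and the weights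
   that meet at one point are added up. *)
have idx i : exists l : 'I_(size s), V ((nth 1%g s l)^-1 * u i)%g.
  have [t ts tu] := Qs _ (uQ i).
  by exists (Ordinal (etrans (index_mem t s) ts)); rewrite /= nth_index.
have [p pP] := choice idx.
exists (fun l => \sum_(i | p i == l) c i); split.
  move=> l; apply: le_trans cB; apply: le_trans (ler_rnorm_sum _ _ _) _.
  rewrite [leRHS](bigID (fun i => p i == l)) /= lerDl sumr_ge0// => i _.
  exact: rnorm_ge0.
move=> E H e' B hE cH e'0 B0 HV HB.
have h1 : rnorm (bochner mu (fun x => f x *: H x) - \sum_i c i *: H (u i)) <= e' * 1 + e * B.
  by apply: cP => // i x Qx Vx; exact: HV.
rewrite mulr1 in h1.
apply: le_trans (ler_rdist (\sum_i c i *: H (u i)) _ _) (lerD h1 _).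
have -> : \sum_l (\sum_(i | p i == l) c i) *: H (nth 1%g s l) =
    \sum_i c i *: H (nth 1%g s (p i)).
  under eq_bigr do rewrite scaler_suml.
  rewrite (exchange_big_dep predT)//=; apply: eq_bigr => i _.
  by rewrite (big_pred1 (p i))// => l; rewrite eq_sym.
rewrite -sumrB; apply: le_trans (ler_rnorm_sum _ _ _) _.
apply: (@le_trans _ _ (\sum_i rnorm (c i : K^o) * e')); last first.
  by rewrite -mulr_suml ler_wpM2r.
apply: ler_sum => i _; rewrite -scalerBr rnormZ ler_wpM2l ?rnorm_ge0//.
by apply: HV => //; apply: sQ; exact: mem_nth.
Qed.

End Nets.

Section UltraScalars.
Context (R : realType) (k : scalar_kind).
Local Notation K := (scalar_field R k).
Context (J : Type) (U : set_system J) (FU : UltraFilter U).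

Lemma ultra_scalar_cvg (u : J -> K) (C : R) :
  (\forall j \near U, rnorm (u j : K^o) <= C) ->
  exists l : K, forall e : R, 0 < e -> \forall j \near U, rnorm (u j - l : K^o) <= e.
Proof.
case: k u => u uC.
  have [l ul] := ultra_bounded_cvg FU uC; exists l => e e0.
  have /cvgrPdist_le/(_ _ e0) := ul; apply: filterS => j.
  by rewrite distrC.
have bnd (h : R[i] -> R) : (forall z, `|h z| <= rnorm (z : (scalar_field R ComplexScalars)^o)) ->
    exists l : R, h (u j) @[j --> U] --> l.
  move=> hn; apply: (@ultra_bounded_cvg _ _ _ FU _ C).
  by apply: filterS uC => j; apply: le_trans.
have [a ua] := bnd _ (@rnorm_Re R); have [b ub] := bnd _ (@rnorm_Im R).
exists (Complex a b) => e e0; have e20 : 0 < e / 2 by rewrite divr_gt0.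
have /cvgrPdist_le/(_ _ e20) h1 := ua; have /cvgrPdist_le/(_ _ e20) h2 := ub.
apply: filterS2 h1 h2 => j h1 h2.
rewrite (le_trans (rnorm_ReIm _))// (splitr e) lerD//.
  by rewrite raddfB /= distrC.
by rewrite raddfB /= distrC.
Qed.

Lemma ultra_forall (T : finType) (A : T -> set J) : (forall t, U (A t)) ->
  \forall j \near U, forall t, A t j.
Proof. by move=> UA; apply: filter_forall. Qed.

End UltraScalars.

(** * The limit representation as an accumulation point *)

Section Accumulation.
Context (R : realType) (k : scalar_kind) (G : topologicalGroupType).
Local Notation K := (scalar_field R k).
Context (mu : {measure set (borel G) -> \bar R}) (S : set G) (M : R).
Hypotheses (hG : hausdorff_space G) (mu_haar : left_haar mu) (cS : compact S)
  (SV : forall g, S g -> S g^-1%g)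
  (S1 : S 1%g) (genS : generates S) (M_ge1 : 1 <= M).
Let mu_fin := haar_compact mu_haar.
Context (J : Type) (U : set_system J) (FU : UltraFilter U).
Context (r : J -> rep R k G) (rM : forall j, S_bounded S M (r j)).
Local Notation X := (dprod ((fun j => rep_space (r j)) : J -> lmodType K)).
Implicit Types (x y : X) (g h : G).
Context (D : X -> Prop) (D0 : D 0) (DP : forall a x y, D x -> D y -> D (a *: x + y)).
Hypothesis Db : forall x, D x -> ubounded U x.
Hypothesis Dact : forall g x, D x -> D (act g x).
Hypothesis Dcont : forall x, D x -> forall e : R, 0 < e ->
  exists2 V, nbhs (1%g : G) V & forall v j, V v -> rnorm (act v x j - x j) <= e.
Context (r' : rep R k G) (rM' : S_bounded S M r') (f : X -> r').
Hypothesis fP : forall a x y, D x -> D y -> f (a *: x + y) = a *: f x + f y.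
Hypothesis fN : forall x, D x -> rnorm (f x) = unorm U x.
Hypothesis fact : forall g x, D x -> f (act g x) = rep_op r' g (f x).
Hypothesis fdense : forall q (e : R), 0 < e -> exists2 x, D x & rnorm (q - f x) <= e.

Lemma dprod_sum I (s : seq I) (y : I -> X) j :
  (\sum_(a <- s) y a) j = \sum_(a <- s) y a j.
Proof.
by elim: s => [|a s ih]; rewrite ?big_nil// !big_cons -ih.
Qed.

Lemma limit_sum I (s : seq I) (c : I -> K) (y : I -> X) : (forall a, D (y a)) ->
  D (\sum_(a <- s) c a *: y a) /\
  f (\sum_(a <- s) c a *: y a) = \sum_(a <- s) c a *: f (y a).
Proof.
move=> Dy; elim: s => [|a s [Ds fs]].
  rewrite !big_nil; split=> //.
  by have := fP (-1) D0 D0; rewrite scaler0 addr0 scaleN1r addNr.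
by rewrite !big_cons -fs; split; [exact: DP|exact: fP].
Qed.

(* Coefficients at which the convergence fails would have a limit along U, by
   compactness, at which it fails too. *)
Lemma limit_uniform (I : finType) (y : I -> X) (e : R) : (forall a, D (y a)) -> 0 < e ->
  \forall j \near U, forall c : I -> K, (forall a, rnorm (c a : K^o) <= 2) ->
    `|rnorm (\sum_a c a *: y a j) - rnorm (\sum_a c a *: f (y a))| <= e.
Proof.
move=> Dy e0.
set A := fun j => forall c : I -> K, _.
have [//|bad] := in_ultra_setVsetC (A : set J) FU.
have exc j : exists c : I -> K, (~` (A : set J)) j ->
    (forall a, rnorm (c a : K^o) <= 2) /\
    e < `|rnorm (\sum_a c a *: y a j) - rnorm (\sum_a c a *: f (y a))|.
  have [Aj|Aj] := pselect (A j); first by exists (fun=> 0).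
  have [c nc] : exists c : I -> K, ~ ((forall a, rnorm (c a : K^o) <= 2) ->
    `|rnorm (\sum_a c a *: y a j) - rnorm (\sum_a c a *: f (y a))| <= e).
    by apply/existsNP.
  exists c => _; move/not_implyP: nc => [c2 /negP]; rewrite -ltNge => ce.
  by split.
have [c cP] := choice exc.
have lim a : exists l : K, forall d : R, 0 < d -> \forall j \near U, rnorm (c j a - l : K^o) <= d.
  apply: (ultra_scalar_cvg FU (C := 2)); apply: filterS bad => j /cP[c2 _].
  exact: c2.
have [l lP] := choice lim.
have yb a : \forall j \near U, rnorm (y a j) <= unorm U (y a) + 1.
  have yU : unorm U (y a) < unorm U (y a) + 1 by rewrite ltrDl.
  by apply: filterS (unorm_lt FU (Db (Dy a)) yU) => j /ltW.
have n0 a : 0 <= unorm U (y a) by rewrite -(fN (Dy a)) rnorm_ge0.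
pose B := \sum_a (unorm U (y a) + 1).
have B0 : 0 <= B by apply: sumr_ge0 => a _; rewrite addr_ge0.
have e40 : 0 < e / 4 by rewrite divr_gt0.
have d0 : 0 < e / 4 / (B + 1) by rewrite divr_gt0// ltr_wpDl.
have [Dl fl] := limit_sum (index_enum I) l Dy.
have := unorm_cvg FU (Db Dl); rewrite -(fN Dl) fl => /cvgrPdist_le/(_ _ e40) hl.
have near_l : \forall j \near U, forall a, rnorm (c j a - l a : K^o) <= e / 4 / (B + 1).
  by apply: ultra_forall => a; exact: lP.
have near_b : \forall j \near U, forall a, rnorm (y a j) <= unorm U (y a) + 1.
  exact: ultra_forall.
have [j [/cP[c2 ce] [hlj [clj ybj]]]] :=
  ultra_pos FU (filterI bad (filterI hl (filterI near_l near_b))).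
have sum_le (E : normedModType K) (z : I -> E) : (forall a, rnorm (z a) <= unorm U (y a) + 1) ->
    `|rnorm (\sum_a c j a *: z a) - rnorm (\sum_a l a *: z a)| <= e / 4.
  move=> zb; apply: le_trans (ler_rnorm_dist _ _) _; rewrite -sumrB.
  apply: le_trans (ler_rnorm_sum _ _ _) _.
  apply: le_trans (div_mul_le e40 B0); rewrite mulr_sumr; apply: ler_sum => a _.
  by rewrite -scalerBl rnormZ ler_pM ?rnorm_ge0.
have h1 := sum_le _ (fun a => y a j) ybj.
have h2 : `|rnorm (\sum_a c j a *: f (y a)) - rnorm (\sum_a l a *: f (y a))| <= e / 4.
  by apply: sum_le => a; rewrite (fN (Dy a)) lerDl.
rewrite dprod_sum in hlj.
have hlj' : `|rnorm (\sum_a l a *: f (y a)) - rnorm (\sum_a l a *: y a j)| <= e / 4 := hlj.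
have := lt_le_trans ce (dist_quarters h1 h2 hlj').
by rewrite -subr_gt0 -{2}[e]mul1r -mulrBl pmulr_lgt0// subr_gt0 ltNge; lra.
Qed.

(** After approximating [q i] by [f (d i)], all integrals against test functions are, up to small
    errors, combinations of the finitely many vectors [act (t l) (d i)], with the same coefficients
    in [r j] and in [r']. Only these coefficients depend on the test functions, and [limit_uniform]
    is uniform in them. *)
Lemma limit_accumulation n (q : 'I_n -> r') (Q : set G) (e : R) : compact Q -> 0 < e ->
  \forall j \near U, exists x' : 'I_n -> r j, forall h : 'I_n -> G -> K,
    (forall i, test_fun mu Q (h i)) ->
    `|rnorm (\sum_i rep_int mu (h i) (x' i)) - rnorm (\sum_i rep_int mu (h i) (q i))| <= e.
Proof.
move=> cQ e0.
have [N QN] := compact_word_ball_sub S1 hG mu_haar cS SV genS cQ.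
pose C := M ^+ N; have C0 : 0 < C by rewrite exprn_gt0// (lt_le_trans ltr01).
have CP (rho : rep R k G) (z : rho) g : S_bounded S M rho -> Q g ->
    rnorm (rep_op rho g z) <= C * rnorm z.
  by move=> rhoM Qg; exact: (word_ball_rep M_ge1 rhoM z (QN g Qg)).
pose eta := e / 4 / n.+1%:R.
have eta0 : 0 < eta by rewrite !divr_gt0.
have n_eta : \sum_(i < n) eta <= e / 4.
  rewrite sumr_const card_ord -[X in X <= _]mulr_natr /eta mulrAC ler_pdivrMr//.
  by rewrite ler_pM2l ?divr_gt0// ler_nat.
have eC : 0 < eta / C by rewrite divr_gt0.
have [d dP] : exists d : 'I_n -> X, forall i, D (d i) /\ rnorm (q i - f (d i)) <= eta / C.
  have ex i : exists d, D d /\ rnorm (q i - f d) <= eta / C.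
    by have [d Dd qd] := fdense (q i) eC; exists d.
  by have [d dP] := choice ex; exists d.
have Dd i : D (d i) := (dP i).1.
(* The factor 3 is that of [net_error]: the oscillation [C * e2] on a piece counts once for the
   Riemann sum and at most twice for moving its nodes to the net. *)
pose e2 := eta / 2 / (3 * C); have e20 : 0 < e2 by rewrite !divr_gt0// mulr_gt0.
have [V V1 VP] : exists2 V, nbhs (1%g : G) V & forall i v j, V v ->
    rnorm (act v (d i) j - d i j) <= e2.
  have [V VP] := choice (fun i => let: ex_intro2 V V1 VV := Dcont (Dd i) e20 in
    ex_intro (fun V => nbhs (1%g : G) V /\ forall v j, V v -> rnorm (act v (d i) j - d i j) <= e2)
      V (conj V1 VV)).
  exists [set v | forall i, V i v].
    by apply: filter_forall => i; case: (VP i).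
  by move=> i v j Vv; apply: (VP i).2.
have [m [t [tQ tP]]] := net_sum k hG mu_fin cQ V1.
have y_D (a : 'I_n * 'I_m) : D (act (t a.2) (d a.1)) by exact: Dact.
have e40 : 0 < e / 4 by rewrite divr_gt0.
have unif := limit_uniform (y := fun a : 'I_n * 'I_m => act (t a.2) (d a.1)) y_D e40.
have n0 i : 0 <= unorm U (d i) by rewrite -(fN (Dd i)) rnorm_ge0.
pose B := \sum_i (unorm U (d i) + 1).
have B0 : 0 <= B by apply: sumr_ge0 => i _; rewrite addr_ge0.
have le_B i : unorm U (d i) + 1 <= B.
  by rewrite /B (bigD1 i)//= lerDl sumr_ge0// => j _; rewrite addr_ge0.
have e2_eta : 3 * (C * e2) <= eta / 2.
  by rewrite mulrA /e2 mulrC divfK// mulf_neq0// gt_eqF.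
have near_b : \forall j \near U, forall i, rnorm (d i j) <= B.
  apply: ultra_forall => i.
  have yU : unorm U (d i) < unorm U (d i) + 1 by rewrite ltrDl.
  by apply: filterS (unorm_lt FU (Db (Dd i)) yU) => j /ltW /le_trans; apply.
apply: filterS2 unif near_b => j unif_j dB.
exists (fun i => d i j) => h hQ.
(* At most 1, so that the weights are bounded by 2 as in [limit_uniform]. The set of [j] was fixed
   without it. *)
pose ep := Num.min 1 (eta / 2 / (C * B + 1)).
have CB0 : 0 <= C * B by rewrite mulr_ge0// ltW.
have ep0 : 0 < ep by rewrite lt_min ltr01 !divr_gt0// ltr_wpDl.
have ep1 : ep <= 1 by rewrite ge_min lexx.
have epCB : ep * (C * B) <= eta / 2.
  have h2 : 0 < eta / 2 by rewrite divr_gt0.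
  apply: le_trans (div_mul_le h2 CB0); apply: ler_wpM2r => //.
  by rewrite ge_min lexx orbT.
have [c cP] := choice (fun i => tP (h i) ep (hQ i) ep0).
have c2 i l : rnorm (c i l : K^o) <= 2.
  by apply: le_trans ((cP i).1 l) _; rewrite -[leRHS]/(1 + 1) lerD2l.
have err (rho : rep R k G) (z : 'I_n -> rho) : S_bounded S M rho ->
    (forall i, rnorm (z i) <= B) ->
    (forall i v, V v -> rnorm (rep_op rho v (z i) - z i) <= e2) ->
    rnorm (\sum_i rep_int mu (h i) (z i) -
           \sum_i \sum_l c i l *: rep_op rho (t l) (z i)) <= e / 4.
  move=> rhoM zB zV; rewrite -sumrB; apply: le_trans (ler_rnorm_sum _ _ _) _.
  apply: le_trans n_eta; apply: ler_sum => i _.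
  have Ce0 : 0 <= C * e2 by rewrite mulr_ge0// ltW.
  have zQ g : Q g -> rnorm (rep_op rho g (z i)) <= C * B.
    move=> Qg; apply: le_trans (CP rho (z i) g rhoM Qg) _.
    by rewrite ler_wpM2l// ltW.
  have zV' g g' : Q g -> Q g' -> V (g'^-1 * g)%g ->
      rnorm (rep_op rho g (z i) - rep_op rho g' (z i)) <= C * e2.
    move=> _ Qg' Vg; rewrite -{1}(mulVKg g' g) repM -linearB.
    by apply: le_trans (CP rho _ g' rhoM Qg') _; rewrite ler_pM2l// zV.
  have := (cP i).2 rho (fun g => rep_op rho g (z i)) (C * e2) (C * B)
    (@rep_complete R k G rho) (@rep_strongly_continuous _ _ _ rho (z i)) Ce0 CB0 zV' zQ.
  move=> /le_trans; apply.
  exact: (net_error Ce0 ep1 epCB e2_eta).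
have h1 : rnorm (\sum_i rep_int mu (h i) (d i j) -
    \sum_i \sum_l c i l *: rep_op (r j) (t l) (d i j)) <= e / 4.
  apply: (err (r j) (fun i => d i j) (rM j) dB) => i v; exact: VP.
have h2 : rnorm (\sum_i rep_int mu (h i) (f (d i)) -
    \sum_i \sum_l c i l *: rep_op r' (t l) (f (d i))) <= e / 4.
  apply: (err r' (fun i => f (d i)) rM') => [i|i v Vv].
    by rewrite fN//; apply: le_trans (le_B i); rewrite lerDl.
  rewrite -(fact _ (Dd i)) addrC -scaleN1r -(fP _ (Dd i) (Dact v (Dd i))).
  rewrite fN; last exact: DP (Dd i) (Dact v (Dd i)).
  by apply: unorm_le; apply: nearW => j'; rewrite scaleN1r addrC; exact: VP.
have h3 := unif_j (fun a => c a.1 a.2) (fun a => c2 a.1 a.2).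
have h4 : rnorm (\sum_i rep_int mu (h i) (f (d i)) - \sum_i rep_int mu (h i) (q i)) <= e / 4.
  rewrite -sumrB; apply: le_trans (ler_rnorm_sum _ _ _) _.
  apply: le_trans n_eta; apply: ler_sum => i _.
  have [hC hs l1] := hQ i; rewrite rdistC.
  have hQ' : vanishes_off Q (h i : G -> K^o).
    by move=> x Qx; apply: Cc_vanishes => /hs.
  have lin := rep_int_linear hG mu_haar hC (-1) (f (d i)) (q i).
  rewrite !scaleN1r [X in rep_int mu (h i) X]addrC [RHS]addrC in lin; rewrite -lin.
  have zQ g : Q g -> rnorm (rep_op r' g (q i - f (d i))) <= C * (eta / C).
    move=> Qg; apply: le_trans (CP r' _ g rM' Qg) _.
    by rewrite ler_pM2l//; case: (dP i).
  have Ce0 : 0 <= C * (eta / C) by rewrite mulr_ge0// ltW.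
  have := bochner_scale_norm hG mu_fin (@rep_complete R k G r') cQ hC.1 hQ'
    (@rep_strongly_continuous _ _ _ r' (q i - f (d i))) Ce0 zQ l1.
  by rewrite mulr1 mulrC divfK// gt_eqF.
rewrite !pair_big /= in h1 h2.
have {}h2 : rnorm (\sum_i rep_int mu (h i) (f (d i)) -
    \sum_p c p.1 p.2 *: f (act (t p.2) (d p.1))) <= e / 4.
  rewrite (eq_bigr (fun p : 'I_n * 'I_m => c p.1 p.2 *: rep_op r' (t p.2) (f (d p.1))))//.
  by move=> p _; rewrite fact.
(* Four quarters of [e]: discretisation in [r j], convergence along [U], discretisation in [r'], and
   the replacement of [q]. *)
apply: (dist_four _ h3).
- exact: le_trans (ler_rnorm_dist _ _) h1.
- rewrite distrC; exact: le_trans (ler_rnorm_dist _ _) h2.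
- exact: le_trans (ler_rnorm_dist _ _) h4.
Qed.

End Accumulation.

Lemma dense_scalar_rat (R : realType) (k : scalar_kind) :
  exists s : rat * rat -> scalar_field R k, forall (a : scalar_field R k) (e : R), 0 < e ->
  exists q, rnorm (a - s q : (scalar_field R k)^o) <= e.
Proof.
have near_rat (x e : R) : 0 < e -> exists q, `|x - ratr q| <= e.
  move=> e0; have /rat_in_itvoo[q /itvP qe] : x - e < x + e by lra.
  exists q; rewrite ler_norml.
  have h1 : x - e < ratr q by rewrite qe.
  have h2 : ratr q < x + e by rewrite qe.
  by apply/andP; split; lra.
case: k.
  exists (fun q => ratr q.1) => a e /(near_rat a)[q qP]; exists (q, 0).
  exact: qP.
exists (fun q => Complex (ratr q.1) (ratr q.2)) => a e e0.
have e20 : 0 < e / 2 by rewrite divr_gt0.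
have [p pP] := near_rat (complex.Re a) _ e20.
have [q qP] := near_rat (complex.Im a) _ e20.
exists (p, q); apply: le_trans (rnorm_ReIm _) _; rewrite !raddfB /=.
by rewrite (splitr e) lerD.
Qed.

Lemma separable_seq (T : ptopologicalType) : separable T ->
  exists s : nat -> T, forall (x : T) (A : set T), nbhs x A -> exists n, A (s n).
Proof.
move=> [D /countable_injP[i iP] dD].
exists (fun n => xget point [set x | D x /\ i x = n]) => x A.
rewrite nbhsE => -[B [oB Bx] BA].
have [y [By Dy]] := dD B (ex_intro _ x Bx) oB.
exists (i y); apply: BA; case: xgetP => [z _ [Dz izy]|/(_ y) H]; last by case: H.
by rewrite (iP z y (mem_set Dz) (mem_set Dy) izy).
Qed.

Lemma addDB_sub (V : zmodType) (p a b c d : V) :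
  (p + a - b) - (p + c - d) = (a - c) - (b - d).
Proof.
rewrite [p + a]addrC [p + c]addrC [a + p - b]addrAC [c + p - d]addrAC.
by rewrite opprD addrACA subrr addr0 !opprB [d - c]addrC addrACA [- b + d]addrC.
Qed.

Lemma dist_thirds (R : realType) (a b c d e : R) : `|a - b| <= e / 3 ->
  `|c - d| <= e / 3 -> `|d - b| <= e / 3 -> `|a - c| <= e.
Proof. rewrite !ler_norml; lra. Qed.

(** * Limits of equicontinuous cocycles *)

Section CocycleLimit.
Context (R : realType) (k : scalar_kind) (G : topologicalGroupType).
Local Notation K := (scalar_field R k).
Context (mu : {measure set (borel G) -> \bar R}) (S : set G) (M : R).
Hypotheses (hG : hausdorff_space G) (lcG : locally_compact [set: G])
  (sepG : separable G)
  (mu_haar : left_haar mu) (cS : compact S) (SV : forall g, S g -> S g^-1%g)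
  (S1 : S 1%g) (genS : generates S) (M_ge1 : 1 <= M).
Let mu_fin := haar_compact mu_haar.
Context (J : Type) (U : set_system J) (FU : UltraFilter U).
Context (r : J -> rep R k G) (rM : forall j, S_bounded S M (r j)).
Local Notation X := (dprod ((fun j => rep_space (r j)) : J -> lmodType K)).
Context (c : forall j, G -> r j) (cC : forall j, cocycle (c j)).
Context (C0 : R) (C0_ge0 : 0 <= C0) (cC0 : forall j s, S s -> rnorm (c j s) <= C0).
Hypothesis c_eq : forall e : R, 0 < e ->
  exists2 V, nbhs (1%g : G) V & forall j v, V v -> rnorm (c j v) <= e.
Implicit Types (x y : X) (g h : G).

Let tot g : X := fun j => c j g.

(** The subspace [D] to which [limit_rep] is applied. It is invariant, because [act g (tot h)] is
    [tot (g * h) - tot g]. *)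
Definition span x := exists s : seq (K * G), x = \sum_(p <- s) p.1 *: tot p.2.

Lemma span_ind (P : X -> Prop) : P 0 -> (forall a g x, P x -> P (a *: tot g + x)) ->
  forall x, span x -> P x.
Proof.
move=> P0 PD x [s ->]; elim: s => [|p s ih]; first by rewrite big_nil.
by rewrite big_cons; exact: PD.
Qed.

Lemma span0 : span 0.
Proof. by exists [::]; rewrite big_nil. Qed.

Lemma spanP a x y : span x -> span y -> span (a *: x + y).
Proof.
move=> [s ->] [s' ->]; exists ([seq (a * p.1, p.2) | p <- s] ++ s').
rewrite big_cat big_map scaler_sumr; congr (_ + _); apply: eq_bigr => p _.
by rewrite scalerA.
Qed.

Lemma span_tot g : span (tot g).
Proof. by exists [:: (1, g)]; rewrite big_seq1 scale1r. Qed.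

Lemma act0 g : act g (0 : X) = 0.
Proof.
apply: (@functional_extensionality_dep J (fun j => rep_space (r j))) => j.
exact: linear0.
Qed.

Lemma totM g h : tot (g * h)%g = 1 *: tot g + act g (tot h).
Proof.
rewrite scale1r.
apply: (@functional_extensionality_dep J (fun j => rep_space (r j))) => j.
exact: (cC j).2.
Qed.

Lemma tot_le g : exists2 C : R, 0 <= C & forall j, rnorm (tot g j) <= C.
Proof.
have [n ng] := word_ball_cover genS g.
exists (n%:R * M ^+ n * C0) => [|j].
  by rewrite !mulr_ge0// exprn_ge0// (le_trans ler01).
exact: (word_ball_cocycle M_ge1 (rM j) (cC j).2 C0_ge0 (@cC0 j) ng).
Qed.

Lemma span_bounded x : span x -> ubounded U x.
Proof.
move: x; apply: span_ind => [|a g x xb].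
  by exists 0; apply: nearW => j; rewrite rnorm0.
apply: uboundedP => //; have [C _ CP] := tot_le g.
by exists C; exact: nearW.
Qed.

Lemma span_act g x : span x -> span (act g x).
Proof.
move: x; apply: span_ind => [|a h x gx]; first by rewrite act0; exact: span0.
rewrite actP; apply: spanP => //.
have -> : act g (tot h) = (-1) *: tot g + tot (g * h)%g.
  by rewrite totM scaleN1r scale1r addKr.
by apply: spanP; exact: span_tot.
Qed.

Lemma act_le_rep g : exists2 C : R, 0 < C & forall (rho : rep R k G) (z : rho),
  S_bounded S M rho -> rnorm (rep_op rho g z) <= C * rnorm z.
Proof.
have [n ng] := word_ball_cover genS g.
exists (M ^+ n) => [|rho z rhoM]; first by rewrite exprn_gt0// (lt_le_trans ltr01).
exact: (word_ball_rep M_ge1 rhoM).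
Qed.

Lemma tot_equicontinuous g (e : R) : 0 < e -> exists2 V, nbhs (1%g : G) V &
  forall j v, V v -> rnorm (tot (g * v)%g j - tot g j) <= e.
Proof.
move=> e0; have [C C1 CP] := act_le_rep g.
have [V V1 VP] := c_eq (divr_gt0 e0 C1); exists V => // j v Vv.
rewrite /tot (cC j).2 addrC addKr.
by apply: le_trans (CP _ _ (rM j)) _; rewrite mulrC -ler_pdivlMr// VP.
Qed.

(** On a generator, [act v (tot g) - tot g] is [tot (v * g) - tot g - tot v]. Writing [v * g] as
    [g * (g^-1 * v * g)], equicontinuity at 1 applies to [v] and to its conjugate. *)
Lemma span_continuous x : span x -> forall e : R, 0 < e ->
  exists2 V, nbhs (1%g : G) V & forall v j, V v -> rnorm (act v x j - x j) <= e.
Proof.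
move: x; apply: span_ind => [e e0|a g x ih e e0].
  exists setT => [|v j _]; first exact: filterT.
  by rewrite act0 subr0 rnorm0 ltW.
have e20 : 0 < e / 2 by rewrite divr_gt0.
have [V V1 VP] := ih _ e20.
have d0 : 0 < e / 2 / (rnorm (a : K^o) + 1) by rewrite divr_gt0// ltr_wpDl// rnorm_ge0.
have [W W1 WP] : exists2 W, nbhs (1%g : G) W & forall v j, W v ->
    rnorm (act v (tot g) j - tot g j) <= e / 2 / (rnorm (a : K^o) + 1).
  have d20 := divr_gt0 d0 (ltr0Sn R 1).
  have [W W1 WP] := tot_equicontinuous g d20; have [W' W'1 W'P] := c_eq d20.
  exists [set v | W' v /\ W (g^-1 * v * g)%g].
    apply: filterI => //.
    have : (g^-1 * v * g)%g @[v --> (1%g : G)] --> (1%g : G).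
      have h1 : (g^-1 * v)%g @[v --> (1%g : G)] --> (g^-1)%g.
        by rewrite -[X in _ --> X]mulg1; exact: mulgl_continuous.
      by rewrite -[X in _ --> X](mulVg g); apply: cvg_mulg => //; exact: cvg_cst.
    exact.
  move=> v j [W'v Wv]; have -> : act v (tot g) j - tot g j =
      (tot (g * (g^-1 * v * g))%g j - tot g j) - tot v j.
    rewrite !mulgA mulgV mul1g addrAC; congr (_ - _).
    by apply/eqP; rewrite eq_sym subr_eq addrC; apply/eqP; exact: (cC j).2.
  apply: le_trans (ler_rnormB _ _) _; rewrite [leRHS]splitr.
  by apply: lerD; [exact: WP|exact: W'P].
exists (V `&` W) => [|v j [Vv Wv]]; first exact: filterI.
have -> : act v (a *: tot g + x) j - (a *: tot g + x) j =
    a *: (act v (tot g) j - tot g j) + (act v x j - x j).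
  by rewrite actP scalerBr opprD addrACA.
apply: le_trans (ler_rnormD _ _) _; rewrite (splitr e) lerD ?VP// rnormZ.
apply: le_trans (div_mul_le e20 (rnorm_ge0 (a : K^o))); rewrite mulrC.
by apply: ler_wpM2r; [exact: rnorm_ge0|exact: WP].
Qed.

(** Rational coefficients and a dense sequence in [G] suffice, because equicontinuity makes [tot]
    continuous uniformly in [j]. *)
Lemma span_separable : exists (T : countType) (s : T -> X), (forall t, span (s t)) /\
  forall x, span x -> forall e : R, 0 < e -> exists t,
    \forall j \near U, rnorm (x j - s t j) <= e.
Proof.
have [q qP] := dense_scalar_rat R k; have [u uP] := separable_seq sepG.
pose s (t : seq ((rat * rat) * nat)) : X := \sum_(p <- t) q p.1 *: tot (u p.2).
exists (seq ((rat * rat) * nat)), s; split.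
  move=> t; exists [seq (q p.1, u p.2) | p <- t].
  by rewrite big_map.
suff H x : span x -> forall e : R, 0 < e -> exists t, forall j, rnorm (x j - s t j) <= e.
  by move=> x xD e /(H x xD)[t tP]; exists t; exact: nearW.
move: x; apply: span_ind => [e e0|a g x ih e e0].
  exists [::] => j; rewrite /s big_nil subr0 rnorm0; exact: ltW.
have e20 : 0 < e / 2 by rewrite divr_gt0.
have e40 : 0 < e / 2 / 2 by rewrite divr_gt0.
have [t tP] := ih _ e20; have [C C1 CP] := tot_le g.
have [p pP] := qP a _ (divr_gt0 e40 (ltr_wpDl C1 ltr01)).
have [V V1 VP] := tot_equicontinuous g (divr_gt0 e40 (ltr_wpDl (rnorm_ge0 (q p : K^o)) ltr01)).
have [n nV] := uP _ _ (nbhs_lcoset g V1).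
have un j := VP j _ nV; rewrite mulVKg in un.
exists ((p, n) :: t) => j; rewrite /s big_cons /=.
have -> : (a *: tot g + x) j - (q p *: tot (u n) + \sum_(p <- t) q p.1 *: tot (u p.2)) j =
    ((a - q p) *: tot g j + q p *: (tot g j - tot (u n) j)) + (x j - s t j).
  rewrite -[LHS]/(a *: tot g j + x j - (q p *: tot (u n) j + s t j)).
  by rewrite scalerBl scalerBr subrKA opprD addrACA.
apply: le_trans (ler_rnormD _ _) _; rewrite (splitr e) lerD ?tP//.
apply: le_trans (ler_rnormD _ _) _; rewrite (splitr (e / 2)) !rnormZ lerD//.
  apply: le_trans (div_mul_le e40 C1).
  by apply: ler_pM; rewrite ?rnorm_ge0//; exact: CP.
apply: le_trans (div_mul_le e40 (rnorm_ge0 (q p : K^o))); rewrite mulrC rdistC.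
by apply: ler_wpM2r; [exact: rnorm_ge0|exact: un].
Qed.

(** The tolerance [d] comes before [V], so that equicontinuity can supply a [V] for it; points and
    weights then serve the whole family and its limit simultaneously. *)
Lemma cocycle_riemann_sum (f : G -> K) (e : R) : Cc f -> 0 < e ->
  exists2 d : R, 0 < d & forall V, nbhs (1%g : G) V ->
  exists n (t : 'I_n -> G) (a : 'I_n -> K), forall (rho : rep R k G) (b : G -> rho),
    S_bounded S M rho -> cocycle b -> (forall s, S s -> rnorm (b s) <= C0) ->
    (forall v, V v -> rnorm (b v) <= d) ->
    rnorm (cocycle_int mu b f - \sum_i a i *: b (t i)) <= e.
Proof.
move=> [cf cQ] e0; have fQ := @Cc_vanishes R k G f; set Q := supp f in cQ fQ.
have [N QN] := compact_word_ball_sub S1 hG mu_haar cS SV genS cQ.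
have [l l0 fl] := L1norm_fin hG mu_fin cQ cf fQ.
pose C := M ^+ N; have C1 : 0 < C by rewrite exprn_gt0// (lt_le_trans ltr01).
pose B := N%:R * M ^+ N * C0.
have B0 : 0 <= B by rewrite !mulr_ge0// ltW.
have e20 : 0 < e / 2 by rewrite divr_gt0.
have d0 : 0 < e / 2 / (C * l + 1) by rewrite divr_gt0// ltr_wpDl// mulr_ge0// ltW.
exists (e / 2 / (C * l + 1)) => // V V1.
have e10 : 0 < e / 2 / (B + 1) by rewrite divr_gt0// ltr_wpDl.
have [n [t [a [tQ _ aP]]]] := riemann_sum hG mu_fin cQ cf fQ fl V1 e10.
exists n, t, a => rho b rhoM bC bS bV; have [cb bM] := bC.
have c0 : 0 <= C * (e / 2 / (C * l + 1)) by rewrite mulr_ge0// ltW.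
have bt i (x : G) : Q x -> V ((t i)^-1 * x)%g ->
    rnorm (b x - b (t i)) <= C * (e / 2 / (C * l + 1)).
  move=> Qx Vx; rewrite -{1}(mulVKg (t i) x) bM addrC addKr.
  apply: le_trans (word_ball_rep M_ge1 rhoM _ (QN _ (tQ i))) _.
  by rewrite ler_pM2l// bV.
have bQ (x : G) : Q x -> rnorm (b x) <= B.
  by move=> Qx; exact: (word_ball_cocycle M_ge1 rhoM bM C0_ge0 bS (QN x Qx)).
apply: le_trans (aP rho b _ B (@rep_complete R k G rho) cb c0 B0 bt bQ) _.
have h1 : e / 2 / (C * l + 1) * (C * l) <= e / 2.
  by apply: div_mul_le => //; rewrite mulr_ge0// ltW.
have h2 := div_mul_le e20 B0.
by rewrite [leRHS](splitr e); apply: lerD; rewrite // [C * (_ / _)]mulrC -mulrA.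
Qed.

Lemma moved_le (rho : rep R k G) (b : G -> rho) (y z : rho) s (d : R) : S_bounded S M rho ->
  S s -> rnorm (y - z) <= d ->
  `|rnorm (moved b y s) - rnorm (moved b z s)| <= (M + 1) * d.
Proof.
move=> rhoM Ss yz; apply: le_trans (ler_rnorm_dist _ _) _.
have -> : moved b y s - moved b z s = rep_op rho s (y - z) - (y - z).
  by rewrite [rep_op rho s (y - z)]linearB; exact: addDB_sub.
apply: le_trans (ler_rnormB _ _) _; rewrite mulrDl mul1r lerD//.
apply: le_trans (rep_op_le M_ge1 rhoM _ Ss) _.
by rewrite ler_wpM2l// (le_trans ler01).
Qed.

Theorem limit_cocycle : exists (r' : rep R k G) (c' : G -> r'),
  [/\ admissible S M r', cocycle c', (forall s, S s -> rnorm (c' s) <= C0),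
     (forall n (q : 'I_n -> r') (Q : set G) (e : R), compact Q -> 0 < e ->
       \forall j \near U, exists x' : 'I_n -> r j, forall h : 'I_n -> G -> K,
       (forall i, test_fun mu Q (h i)) ->
       `|rnorm (\sum_i rep_int mu (h i) (x' i)) -
         rnorm (\sum_i rep_int mu (h i) (q i))| <= e) &
     (forall f s (e : R), Cc f -> S s -> 0 < e -> \forall j \near U,
       `|rnorm (moved (c j) (cocycle_int mu (c j) f) s) -
         rnorm (moved c' (cocycle_int mu c' f) s)| <= e)].
Proof.
have [r' [f [r'M fP fN fact fdense]]] := limit_rep hG lcG mu_haar cS SV S1 genS M_ge1 FU rM
  span0 spanP span_bounded span_act span_continuous span_separable.
have rM' : S_bounded S M r' := r'M.2.
have fsum := limit_sum span0 spanP fP.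
pose c' g := f (tot g).
have c'_eq (e : R) V : (forall j v, V v -> rnorm (c j v) <= e) ->
    forall v, V v -> rnorm (c' v) <= e.
  move=> ce v Vv; rewrite /c' (fN _ (span_tot v)); apply: unorm_le.
  by apply: nearW => j; exact: ce.
have c'M g h : c' (g * h)%g = c' g + rep_op r' g (c' h).
  rewrite /c' totM (fP _ _ _ (span_tot g) (span_act g (span_tot h))) scale1r.
  by rewrite fact//; exact: span_tot.
have c'C : cocycle c'.
  split=> // g; apply/cvg_rnormP => e e0; have [C C1 CP] := act_le_rep g.
  have e20 : 0 < e / 2 by rewrite divr_gt0.
  have [V V1 VP] := c_eq (divr_gt0 e20 C1).
  have gV := nbhs_lcoset g V1; apply: filterS gV => y Vy.
  have -> : c' y - c' g = rep_op r' g (c' (g^-1 * y)%g).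
    by rewrite -{1}(mulVKg g y) c'M addrC addKr.
  apply: le_lt_trans (CP _ _ rM') _; rewrite mulrC -ltr_pdivlMr//.
  apply: le_lt_trans (c'_eq _ _ VP _ Vy) _.
  by rewrite ltr_pM2r ?invr_gt0// ltr_pdivrMr// ltr_pMr// ltr1n.
have c'S s : S s -> rnorm (c' s) <= C0.
  by apply: c'_eq => j v; exact: cC0.
exists r', c'; split=> //.
  move=> n q Q e cQ e0; apply: (limit_accumulation hG mu_haar cS SV S1 genS M_ge1 FU rM
    span0 spanP span_bounded span_act span_continuous rM' fP fN fact fdense) => //.
move=> f0 s e f0C Ss e0; have M1 : 0 < M + 1 by rewrite ltr_wpDl// (le_trans ler01).
have d0 : 0 < e / 3 / (M + 1) by rewrite !divr_gt0.
have e30 : 0 < e / 3 by rewrite divr_gt0.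
have [d d1 dP] := cocycle_riemann_sum f0C d0; have [V V1 VP] := c_eq d1.
have [n [t [a aP]]] := dP V V1.
pose y : X := \sum_i a i *: tot (t i).
have [Dy fy] := fsum _ (index_enum 'I_n) a (fun i => tot (t i)) (fun i => span_tot (t i)).
(* The value at [s] of the cocycle moved to the Riemann sum [y]. It lies in the span, so the norms
   of its coordinates converge to the norm of its image. *)
pose z : X := 1 *: (-1 *: y + act s y) + tot s.
have Dz : span z.
  apply: spanP (span_tot s); apply: spanP => //; exact: span_act.
have fz : f z = moved c' (\sum_i a i *: c' (t i)) s.
  rewrite /z (fP _ _ _ _ (span_tot s)); last by apply: spanP => //; exact: span_act.
  rewrite (fP _ _ _ Dy (span_act s Dy)) scale1r scaleN1r fact// fy.
  by rewrite /moved addrC [- _ + _]addrC addrA.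
have h1 j : `|rnorm (moved (c j) (cocycle_int mu (c j) f0) s) - rnorm (z j)| <= e / 3.
  have -> : z j = moved (c j) (\sum_i a i *: c j (t i)) s.
    have <- : y j = \sum_i a i *: c j (t i) by rewrite /y dprod_sum.
    rewrite -[z j]/(1 *: (-1 *: y j + rep_op (r j) s (y j)) + c j s).
    by rewrite scale1r scaleN1r /moved addrC [- _ + _]addrC addrA.
  apply: le_trans (moved_le _ (rM j) Ss (aP (r j) (c j) (rM j) (cC j) (@cC0 j) (VP j))) _.
  by rewrite mulrC divfK// gt_eqF.
have h2 : `|rnorm (moved c' (cocycle_int mu c' f0) s) - rnorm (f z)| <= e / 3.
  rewrite fz; apply: le_trans (moved_le _ rM' Ss (aP r' c' rM' c'C c'S (c'_eq _ _ VP))) _.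
  by rewrite mulrC divfK// gt_eqF.
have := unorm_cvg FU (span_bounded Dz); rewrite -(fN _ Dz) => /cvgrPdist_le/(_ _ e30).
apply: filterS => j h3; move: (h1 j) h2 h3.
exact: dist_thirds.
Qed.

End CocycleLimit.

(** * The strong neighbourhood *)

(** By directedness the tails, cut down to [A], generate a proper filter. Containing all tails turns
    limits along [U] into accumulation points of the net; [A] keeps the indices where contraction
    fails. *)
Lemma tail_ultrafilter (I : Type) (le : I -> I -> Prop) (A : I -> Prop) :
  directed le -> (forall i, exists2 j, le i j & A j) ->
  exists U : set_system I, UltraFilter U /\ forall i, U [set j | le i j /\ A j].
Proof.
move=> [[i0] lexx letr ledir] frequently.
pose F : set_system I := fun B => exists i, [set j | le i j /\ A j] `<=` B.
have FF : ProperFilter F.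
  split; first by move=> [i iF]; have [j ij Aj] := frequently i; exact: (iF j).
  split.
  - by exists i0.
  - move=> B B' [i iB] [i' iB']; have [l il i'l] := ledir i i'.
    exists l => j [lj Aj]; split; [apply: iB|apply: iB']; split=> //; exact: letr lj.
  - by move=> B B' BB' [i iB]; exists i => j /iB; exact: BB'.
have [U [FU sFU]] := ultraFilterLemma FF.
by exists U; split=> // i; apply: sFU; exists i.
Qed.

(** Used to normalise a failing cocycle to bound 1 on [S]. For [D = 0], division by [D] is replaced
    by division by [m]. *)
Lemma rescale_gt (R : realType) (D m : R) : 0 <= D -> 3 / 4 * D < m ->
  exists t : R, [/\ 0 < t, t * D <= 1 & 3 / 4 < t * m].
Proof.
move=> D0 Dm; have m0 : 0 < m by apply: le_lt_trans Dm; rewrite mulr_ge0.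
have [->|Dn0] := eqVneq D 0.
  by exists m^-1; rewrite invr_gt0 mulr0 mulVf ?gt_eqF// ler01; split=> //; lra.
have Dp : 0 < D by rewrite lt_def Dn0.
by exists D^-1; rewrite invr_gt0 mulVf// lexx [_ * m]mulrC ltr_pdivlMr.
Qed.

Lemma rep_equiv_refl (R : realType) (k : scalar_kind) (G : topologicalGroupType)
  (r : rep R k G) : rep_equiv r r.
Proof. by exists idfun; split=> // y; exists y. Qed.

Section StrongNeighbourhood.
Context (R : realType) (k : scalar_kind) (G : topologicalGroupType).
Local Notation K := (scalar_field R k).
Context (mu : {measure set (borel G) -> \bar R}) (S : set G) (M : R).
Hypotheses (hG : hausdorff_space G) (lcG : locally_compact [set: G])
  (sepG : separable G)
  (mu_haar : left_haar mu) (cS : compact S) (SV : forall g, S g -> S g^-1%g)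
  (S1 : S 1%g) (genS : generates S) (M_ge1 : 1 <= M).
Let mu_fin := haar_compact mu_haar.

Lemma rep_int_equiv (r r' : rep R k G) (phi : {linear r -> r'}) (f : G -> K) (x : r) :
  (forall x, `|phi x| = `|x|) -> (forall g x, phi (rep_op r g x) = rep_op r' g (phi x)) ->
  Cc f -> rep_int mu f (phi x) = phi (rep_int mu f x).
Proof.
move=> iso equiv fC.
have cx := @rep_strongly_continuous _ _ _ r x.
have phiC y : rnorm (phi y) <= 1 * rnorm y by rewrite mul1r /rnorm iso.
rewrite /rep_int -(bochner_linear hG mu_fin (@rep_complete R k G r) (@rep_complete R k G r')
  phiC fC.2 (continuous_scale fC.1 cx) (vanishes_scale _ (@Cc_vanishes R k G f))).
by congr bochner; apply/funext => g; rewrite linearZ equiv.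
Qed.

(** A basic neighbourhood containing [p] is in general centred at another representation [r0]. The
    vectors witnessing that [p] belongs to it are pulled back to [r'] and approximated in [r j]. *)
Lemma limit_accumulation_point (I : Type) (le : I -> I -> Prop) (net : I -> repclass k S M)
    (p : repclass k S M) (U : set_system I) (FU : UltraFilter U)
    (r : I -> rep R k G) (r' : rep R k G) :
  (forall i, U [set j | le i j]) -> (forall i, members (net i) (r i)) ->
  members p = rep_equiv r' ->
  (forall n (q : 'I_n -> r') (Q : set G) (e : R), compact Q -> 0 < e ->
    \forall j \near U, exists x' : 'I_n -> r j, forall h : 'I_n -> G -> K,
    (forall i, test_fun mu Q (h i)) ->
    `|rnorm (\sum_i rep_int mu (h i) (x' i)) -
      rnorm (\sum_i rep_int mu (h i) (q i))| <= e) ->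
  accumulation_point (rep_basis mu (S := S) (M := M)) le net p.
Proof.
move=> Ule rP pE lim V [W [[c0 [r0 [n [x0 [Q [e [_ cQ e0 ->]]]]]]] Wp WV]] i.
have [r'' [x'' []]] := Wp; rewrite pE => -[phi [iso surj equiv]].
have [q qP] := choice (fun i => surj (x'' i)).
set s := ereal_sup _ => se.
(* The supremum witnessing membership of [p] is strictly below [e]; the slack [d] is what the
   approximation along the net may cost. *)
have [d d0 sd] : exists2 d : R, 0 < d & (s + d%:E < e%:E)%E.
  move: s se => [a|//|_]; last by exists 1; [exact: ltr01|exact: ltNyr].
  rewrite lte_fin => ae; exists ((e - a) / 2); first by rewrite divr_gt0// subr_gt0.
  by rewrite -EFinD lte_fin; lra.
have [j [[x' xP] ij]] := ultra_pos FU (filterI (lim n q Q d cQ d0) (Ule i)).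
exists j => //; apply: WV; exists (r j), x'; split; first exact: rP.
apply: le_lt_trans sd; apply: ge_ereal_sup => _ [h hQ <-].
have sh : (`|rnorm (\sum_i rep_int mu (h i) (x'' i)) -
    rnorm (\sum_i rep_int mu (h i) (x0 i))|%:E <= s)%E.
  by apply: ereal_sup_ubound; exists h.
apply: le_trans (leeD2r _ sh); rewrite -EFinD lee_fin.
have -> : rnorm (\sum_i rep_int mu (h i) (x'' i)) = rnorm (\sum_i rep_int mu (h i) (q i)).
  rewrite -(_ : phi (\sum_i rep_int mu (h i) (q i)) = \sum_i rep_int mu (h i) (x'' i)).
    by rewrite /rnorm iso.
  rewrite linear_sum; apply: eq_bigr => l _; rewrite -qP rep_int_equiv//.
  by case: (hQ l).
apply: le_trans (ler_distD (rnorm (\sum_i rep_int mu (h i) (q i))) _ _) _.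
by rewrite addrC lerD2l; exact: xP.
Qed.

Lemma noncontracting_normalised (f : G -> K) (r : rep R k G) : Cc f ->
  ~ contracting mu S f r -> exists (b : G -> r) s,
  [/\ cocycle b, (forall t, S t -> rnorm (b t) <= 1), S s &
      3 / 4 < rnorm (moved b (cocycle_int mu b f) s)].
Proof.
move=> fC /existsNP[b /existsNP[D /not_implyP[bC /not_implyP[D0 /not_implyP[bD]]]]].
move=> /existsNP[s /not_implyP[Ss /negP]]; rewrite -ltNge => /(rescale_gt D0)[t [t0 tD tm]].
pose a := of_real k t.
exists (fun g => a *: b g), s; split=> //.
- split; first exact: (continuous_scale (@continuous_const R k G K^o a) bC.1).
  by move=> g h; rewrite bC.2 scalerDr linearZ.
- move=> g Sg; rewrite rnormZr gtr0_norm//; apply: le_trans tD.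
  by rewrite ler_pM2l// bD.
- have -> : cocycle_int mu (fun g => a *: b g) f = a *: cocycle_int mu b f.
    rewrite /cocycle_int -(bochnerZ hG mu_fin (@rep_complete R k G r) a fC.2
      (continuous_scale fC.1 bC.1) (vanishes_scale b (@Cc_vanishes R k G f))).
    by congr bochner; apply/funext => g; rewrite !scalerA mulrC.
  rewrite (_ : moved _ _ s = a *: moved b (cocycle_int mu b f) s).
    by rewrite rnormZr gtr0_norm.
  by rewrite /moved linearZ scalerBr scalerDr.
Qed.

Lemma moved_convolution (f h : G -> K) (r : rep R k G) (b : G -> r) s : Cc1 mu f ->
  Cc1 mu h -> S_bounded S M r -> cocycle b ->
  let c := moved b (cocycle_int mu b h) in
  moved c (cocycle_int mu c f) s = moved b (cocycle_int mu b (convolution mu f h)) s.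
Proof.
move=> fC hC rM bC c.
rewrite (cocycle_int_convolution hG lcG mu_haar genS M_ge1 fC.1 hC.1 rM bC hC.2).
rewrite /c (cocycle_int_moved hG mu_haar _ fC bC) movedD; congr (moved b _ s).
rewrite [LHS]addrC; exact: subrK.
Qed.

Lemma moved_bound (r : rep R k G) (b : G -> r) (y : r) s (C : R) : S_bounded S M r ->
  S s -> rnorm (b s) <= 1 -> rnorm y <= C -> rnorm (moved b y s) <= 1 + (M + 1) * C.
Proof.
move=> rM Ss b1 yC; apply: le_trans (ler_rnormB _ _) _.
rewrite mulrDl mul1r addrA; apply: lerD => //.
apply: le_trans (ler_rnormD _ _) _; apply: lerD => //.
apply: le_trans (rep_op_le M_ge1 rM _ Ss) _.
by rewrite ler_wpM2l// (le_trans ler01).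
Qed.

(** Here [a] is the failing displacement at [s j], [c] the one at [s0], and [m] the one in the
    limit: [3 / 4 - 1 / 8] still exceeds [1 / 2]. *)
Lemma limit_gap (a c m : R) : 3 / 4 < a -> a <= c + 1 / 16 -> `|c - m| <= 1 / 16 ->
  m <= 1 / 2 -> False.
Proof. rewrite ler_norml; lra. Qed.

Theorem contracting_strong_nbhs (F : repclass k S M -> Prop) :
  has_kazhdan_projection mu F -> H1_vanishes_on F ->
  exists2 f, Cc1 mu f & strong_nbhs (rep_basis mu (S := S) (M := M)) F
    (fun p => forall r, members p r -> contracting mu S f r).
Proof.
move=> FK FH1; have M_ge0 : 0 <= M by exact: le_trans M_ge1.
(* Only the existence of a function of integral 1 is taken from this application. *)
have [phi phiC _] := kazhdan_local hG mu_haar cS SV S1 genS M_ge1 FK ltr01.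
have [C C_ge0 CP] := Cc_bound hG mu_haar cS SV S1 genS M_ge1 phiC.1.
pose C0 := 1 + (M + 1) * C.
have C0_ge0 : 0 <= C0 by rewrite addr_ge0// mulr_ge0// addr_ge0.
have half0 : 0 < 1 / 2 :> R by [].
have eta0 := divr_gt0 half0 (ltr_wpDl C0_ge0 ltr01).
(* The moved cocycles are bounded by [C0] on [S], and this choice of tolerance brings displacements
   up to [C0] below [1 / 2]. *)
have [f1 f1C f1P] := kazhdan_local hG mu_haar cS SV S1 genS M_ge1 FK eta0.
have fC : Cc1 mu (convolution mu f1 phi).
  split; first exact: (convolution_Cc hG mu_haar f1C.1 phiC.1).
  by rewrite (integral_convolution hG lcG mu_haar f1C.1 phiC.1) f1C.2 phiC.2 mulr1.
exists (convolution mu f1 phi) => // I le net dir acc; apply: contrapT => /forallNP no.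
move: (convolution mu f1 phi) fC (fun r b s => @moved_convolution f1 phi r b s f1C phiC)
  no => f fC fE no.
pose bad i := exists2 r, members (net i) r & ~ contracting mu S f r.
have freq i : exists2 j, le i j & bad j.
  have /existsNP[j /not_implyP[ij /existsNP[r /not_implyP[jr nr]]]] := no i.
  by exists j => //; exists r.
have [U [FU Ubad]] := tail_ultrafilter dir freq.
have ex_r i : exists r, members (net i) r /\ (bad i -> ~ contracting mu S f r).
  have [[r ri nr]|ngood] := pselect (bad i); first by exists r.
  have [r0 _ rE] := repclassP (net i); exists r0; split=> //.
  by rewrite rE; exact: rep_equiv_refl.
have [r rP] := choice ex_r.
have rM j : S_bounded S M (r j) := members_S_bounded M_ge1 (rP j).1.
have ex j : exists bs : (G -> r j) * G, [/\ cocycle bs.1,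
    (forall t, S t -> rnorm (bs.1 t) <= 1), S bs.2 &
    bad j -> 3 / 4 < rnorm (moved bs.1 (cocycle_int mu bs.1 f) bs.2)].
  have [jbad|ngood] := pselect (bad j).
    have [b [s [bC b1 Ss bs]]] := noncontracting_normalised fC.1 ((rP j).2 jbad).
    by exists (b, s).
  (* The zero cocycle is a default where contraction holds; [U] ignores these indices. *)
  exists (fun _ => 0, 1%g); split=> //.
    split; first exact: (@continuous_const R k G (r j)).
    by move=> g h; rewrite linear0 addr0.
  by move=> t _; rewrite rnorm0.
pose b j := (projT1 (cid (ex j))).1; pose s j := (projT1 (cid (ex j))).2.
have bC j : cocycle (b j) by rewrite /b; case: (projT2 (cid (ex j))).
have b1 j t : S t -> rnorm (b j t) <= 1.
  by rewrite /b; case: (projT2 (cid (ex j))) => _ + _ _; exact.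
have Ss j : S (s j) by rewrite /s; case: (projT2 (cid (ex j))).
have bs j : bad j -> 3 / 4 < rnorm (moved (b j) (cocycle_int mu (b j) f) (s j)).
  by rewrite /s /b; case: (projT2 (cid (ex j))).
pose c j := moved (b j) (cocycle_int mu (b j) phi).
have cC j : cocycle (c j) by exact: moved_cocycle.
have cC0 j t : S t -> rnorm (c j t) <= C0.
  move=> St; apply: (moved_bound (rM j) St (b1 j t St)).
  by rewrite -[leRHS]mulr1; apply: CP => //; exact: b1.
have c_eq (e : R) : 0 < e ->
    exists2 V, nbhs (1%g : G) V & forall j v, V v -> rnorm (c j v) <= e.
  move=> e0.
  have [V V1 VP] := moved_equicontinuous hG lcG mu_haar cS SV S1 genS M_ge1 phiC e0.
  by exists V => // j v; exact: (VP (r j) (b j) (rM j) (bC j) (b1 j)).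
have [r' [c' [r'M c'C c'S lim1 lim2]]] :=
  limit_cocycle hG lcG sepG mu_haar cS SV S1 genS M_ge1 FU rM cC C0_ge0 cC0 c_eq.
pose p := RepClass (ex_intro2 _ _ r' r'M (erefl (rep_equiv r'))).
have pr' : members p r' by exact: rep_equiv_refl.
have Fp : F p.
  apply: acc; apply: (@limit_accumulation_point I le net p U FU r r') => //.
  - by move=> i; apply: filterS (Ubad i) => j [].
  - by move=> j; case: (rP j).
have [x xc'] := FH1 p r' Fp pr' c' c'C.1 c'C.2.
(* The failing generator varies with [j], whereas [limit_cocycle] concerns a fixed one; compactness
   of [S] provides a limit. *)
have [s0 [Ss0 sU]] : exists s0, S s0 /\ forall A, nbhs s0 A -> \forall j \near U, A (s j).
  have [|t [St tU]] := @cS (s @ U) (fmap_proper_filter s _); first by apply: nearW.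
  exists t; split=> // A tA.
  have [//|nA] := in_ultra_setVsetC (s @^-1` A) FU.
  by have [y [nAy]] := tU (~` A) A nA tA.
have lim_le : rnorm (moved c' (cocycle_int mu c' f1) s0) <= 1 / 2.
  (* A fixed point [x] means [c' g = x - rep_op r' g x], the coboundary of [- x]. *)
  have c'E : c' = fun g => rep_op r' g (- x) - (- x).
    apply/funext => g; rewrite linearN opprK -{2}(xc' g) addrA addNr add0r.
    by [].
  have c'D t : S t -> rnorm (rep_op r' t (- x) - (- x)) <= C0.
    by move=> /c'S; rewrite c'E.
  have := f1P p r' (- x) C0 Fp pr' C0_ge0 c'D s0 Ss0 => /le_trans/(_ (div_mul_le half0 C0_ge0)).
  rewrite c'E (cocycle_int_coboundary hG mu_haar (- x) f1C).
  move: (rep_int mu f1 (- x)) => v; apply: le_trans; rewrite le_eqVlt; apply/orP; left.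
  apply/eqP; congr rnorm; rewrite /moved [rep_op r' s0 (v - _)]linearB.
  by rewrite [_ - - x + _]addrC subrKA opprB addrA subrK.
have M16 : 0 < 1 / 16 / M by rewrite !divr_gt0// (lt_le_trans ltr01).
(* Equicontinuity is used a second time, for [f] itself, to replace [s j] by [s0]: the displacement
   by [s0^-1 * s j] is at most [1 / 16 / M], and applying [s0] costs the factor [M]. *)
have [V V1 VP] := moved_equicontinuous hG lcG mu_haar cS SV S1 genS M_ge1 fC M16.
have e16 : 0 < 1 / 16 :> R by [].
have [[i0] _ _ _] := dir.
have [j [[_ jbad] [sj limj]]] := ultra_pos FU (filterI (Ubad i0)
  (filterI (sU _ (nbhs_lcoset s0 V1)) (lim2 f1 s0 _ f1C.1 Ss0 e16))).
rewrite /c (fE (r j) (b j) s0 (rM j) (bC j)) in limj.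
have [_ mM] := moved_cocycle (cocycle_int mu (b j) f) (bC j).
have near_s : rnorm (moved (b j) (cocycle_int mu (b j) f) (s j)) <=
    rnorm (moved (b j) (cocycle_int mu (b j) f) s0) + 1 / 16.
  rewrite -[in leLHS](mulVKg s0 (s j)) mM; apply: le_trans (ler_rnormD _ _) _.
  rewrite lerD2l; apply: le_trans (rep_op_le M_ge1 (rM j) _ Ss0) _.
  rewrite mulrC -ler_pdivlMr; last exact: lt_le_trans M_ge1.
  exact: (VP _ _ (rM j) (bC j) (b1 j) _ sj).
exact: (limit_gap (bs j jbad) near_s limj lim_le).
Qed.

End StrongNeighbourhood.

Unset Implicit Arguments.

Theorem theorem1p3 (R : realType) (k : scalar_kind) (G : topologicalGroupType)
    (mu : {measure set (borel G) -> \bar R}) (S : set G) (M : R)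
    (G_hausdorff : hausdorff_space G)
    (G_locally_compact : locally_compact [set: G])
    (G_separable : separable G)
    (G_infinite : infinite_set [set: G])
    (mu_haar : left_haar mu)
    (S_compact : compact S)
    (S_symmetric : forall g, S g -> S (g^-1)%g)
    (S_1 : S 1%g)
    (S_generates : generates S)
    (M_gt1 : 1 < M)
    (F : repclass k S M -> Prop)
    (F_kazhdan : has_kazhdan_projection mu F)
    (F_H1 : H1_vanishes_on F) :
  exists F' : repclass k S M -> Prop,
    [/\ strong_nbhs (rep_basis (k := k) mu (S := S) (M := M)) F F',
        has_kazhdan_projection mu F' & H1_vanishes_on F'].
Proof.
have M_ge1 := ltW M_gt1.
have [f fC fF] := contracting_strong_nbhs G_hausdorff G_locally_compact
  G_separable mu_haar S_compact S_symmetric S_1 S_generates M_ge1 F_kazhdan F_H1.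
exists (fun p => forall r, members p r -> contracting mu S f r); split=> //.
  apply: (kazhdan_of_contracting G_hausdorff G_locally_compact mu_haar S_compact
    S_symmetric S_1 S_generates M_ge1 fC) => p r pF; exact: pF.
move=> p r pF pr; have rM := members_S_bounded M_ge1 pr.
exact: (contracting_H1 G_hausdorff mu_haar S_compact S_symmetric S_1
  S_generates M_ge1 fC rM (pF r pr)).
Qed.
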